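(* Let $\mathcal{G}\rightrightarrows M$ be a Lie groupoid whose Lie algebroid $A$ fits into a Manin pair $(E,A)$. Let $R:(\mathbb{T}\mathcal{G},T\mathcal{G})\dashrightarrow(E\times\overline{E},A\times A)$ be a morphism of multiplicative Manin pairs over the groupoid morphism $(\mathtt{t},\mathtt{s}):\mathcal{G}\to M\times M$ such that the induced action of $A\times A$ on $\mathcal{G}$ is $(u,v)\mapsto u^r+\mathtt{i}(v)^l$. Then, for any choice of isotropic complement $\mathbf{C}$ for $A$ in $E$, the induced bivector field $\pi$ on $\mathcal{G}$, given by $$\mathrm{Graph}(\pi^\sharp)=R\circ(\mathbf{C}\times\mathbf{C}),$$ makes $\mathcal{G}$ into a quasi-Poisson groupoid integrating the Lie quasi-bialgebroid defined by the quasi-Manin triple $(E,A,\mathbf{C})$.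
   Context: Everything is real and $C^\infty$. For a Lie groupoid $\mathcal{G}\rightrightarrows M$ (source $\mathtt{s}$, target $\mathtt{t}$, multiplication $\mathtt{m}$, inversion $\mathtt{i}$), $A=\ker(T\mathtt{s})|_M$, anchor $T\mathtt{t}$, bracket by right-invariant vector fields; $u^r$ is the right-invariant vector field of $u\in\Gamma(A)$; $\mathtt{i}:A\to\ker(T\mathtt{t})|_M$ also denotes the map induced by inversion (extended to exterior powers), and $(\cdot)^l$ the left-invariant extension. Manin pair $(E,\mathbf{L})$: a Courant algebroid $E$ (with non-skew bracket $[\![\cdot,\cdot]\!]$, pairing $\langle\cdot,\cdot\rangle$, anchor $\mathtt{a}$) and a Dirac structure $\mathbf{L}\subset E$ (lagrangian subbundle with involutive sections), viewed as a Lie algebroid; here $A$ is identified as a Lie algebroid with a Dirac structure in $E$. $\overline{E}$ is $E$ with opposite pairing. An isotropic complement $\mathbf{C}$ is a subbundle with $E=A\oplus\mathbf{C}$, $\langle\mathbf{C},\mathbf{C}\rangle=0$; then $(E,A,\mathbf{C})$ is a quasi-Manin triple. Identifying $\mathbf{C}\cong A^*$ by the pairing, it defines a Lie quasi-bialgebroid $(A,d_*,\chi)$: the derivation $d_*:\Gamma(\wedge^\bullet A)\to\Gamma(\wedge^{\bullet+1}A)$ determined by $d_*f(\xi)=\mathcal{L}_{\mathtt{a}(\xi)}f$, $d_*u(\xi_1,\xi_2)=\mathcal{L}_{\mathtt{a}(\xi_1)}(\xi_2(u))-\mathcal{L}_{\mathtt{a}(\xi_2)}(\xi_1(u))-\langle[\![\xi_1,\xi_2]\!],u\rangle$,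 and $\chi\in\Gamma(\wedge^3A)$, $\chi(\xi_1,\xi_2,\xi_3)=\langle[\![\xi_1,\xi_2]\!],\xi_3\rangle$, for $f\in C^\infty(M)$, $u\in\Gamma(A)$, $\xi,\xi_i\in\Gamma(\mathbf{C})$. A Courant morphism $R:E_1\dashrightarrow E_2$ over $\phi:M_1\to M_2$ is a Dirac structure in $E_1\times\overline{E}_2$ with support on $\mathrm{Graph}(\phi)$, i.e. a lagrangian subbundle $R\subset(E_1\times\overline{E}_2)|_{\mathrm{Graph}(\phi)}$ whose anchor image is tangent to $\mathrm{Graph}(\phi)$ and such that the bracket of two sections restricting to sections of $R$ restricts to a section of $R$. A morphism of Manin pairs $(E_1,\mathbf{L}_1)\dashrightarrow(E_2,\mathbf{L}_2)$ is a Courant morphism for which the projection $R\cap(\mathbf{L}_1\times E_2)\to E_2$ is a fibrewise isomorphism onto $\mathbf{L}_2$. A CA-groupoid is a VB-groupoid $\mathcal{E}\rightrightarrows E_0$ over a Lie groupoid $\mathcal{G}$, with $\mathcal{E}\to\mathcal{G}$ a Courant algebroid such that the graph of its multiplication is a Dirac structure in $\mathcal{E}\times\mathcal{E}\times\overline{\mathcal{E}}$ with support on $\mathrm{Graph}(\mathtt{m})$. A multiplicative Manin pair is a Manin pair $(\mathcal{E},\mathbf{L})$ with $\mathcal{E}$ a CA-groupoid and $\mathbf{L}$ a VB-subgroupoid. A morphism of multiplicative Manin pairs is a morphism of Manin pairs, supported on a Lie groupoid morphism, that is a VB-subgroupoid of the product. Here $\mathbb{T}\mathcal{G}=T\mathcal{G}\oplus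 T^*\mathcal{G}$ is the standard (untwisted) Courant algebroid with the direct-sum tangent/cotangent VB-groupoid structure, and $E\times\overline{E}$ is the pair groupoid over $E$. The morphism $R$ induces an action of $A\times A$ on $\mathcal{G}$: $(u,v)$ acts by the unique $X$ with $((X,0),(u,v))\in R$. $R\circ(\mathbf{C}\times\mathbf{C})=\{(X,\alpha)\in\mathbb{T}\mathcal{G}:\exists\,e\in\mathbf{C}\times\mathbf{C},\ ((X,\alpha),e)\in R\}$. A quasi-Poisson groupoid $(\mathcal{G},\pi,\chi)$ is a Lie groupoid with a multiplicative bivector field $\pi$ and $\chi\in\Gamma(\wedge^3A)$ with $\frac12[\pi,\pi]=\chi^r+\mathtt{i}(\chi)^l$ and $[\pi,\chi^r]=0$. It integrates the Lie quasi-bialgebroid $(A,d_*,\chi)$ if $\mathcal{L}_{u^r}\pi=-(d_*u)^r$ and $i_{\mathtt{t}^*df}\pi=-(d_*f)^r$ for $u\in\Gamma(A)$, $f\in C^\infty(M)$. *)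

(* Defs.v *)
From HB Require Import structures.
From mathcomp Require Import all_boot all_order all_algebra perm.
From mathcomp Require Import all_classical all_reals all_analysis.
Set Implicit Arguments.
Unset Strict Implicit.
Unset Printing Implicit Defensive.
Import Order.TTheory GRing.Theory Num.Theory numFieldNormedType.Exports.
Local Open Scope classical_set_scope.
Local Open Scope ring_scope.

(* Each kind of geometric object is a record of raw data together with a
   predicate carrying the axioms (premanifold / manifold, prebundle /
   vector_bundle, precourant / courant_algebroid, pregroupoid / lie_groupoid),
   so that products, tangent bundles, etc. can be formed without proof
   obligations. *)

Definition the_or (T : Type) (x0 : T) (P : T -> Prop) : T :=
  if pselect (exists x, P x) is left h then projT1 (cid h) else x0.

Section Manifolds.
Context {R : realType}.

Fixpoint Ck n (k : nat) (U : set 'rV[R]_n) (f : 'rV[R]_n -> R) : Prop :=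
  (forall x, U x -> {for x, continuous f}) /\
  if k is k'.+1 then
    forall i : 'I_n,
      (forall x, U x -> derivable f x (delta_mx 0 i)) /\
      Ck k' U (fun x => 'D_(delta_mx 0 i) f x)
  else True.

(* meaningful for open U only *)
Definition smooth_Rn n (U : set 'rV[R]_n) (f : 'rV[R]_n -> R) : Prop :=
  forall k, Ck k U f.

Record chart (T : Type) (n : nat) := Chart {
  cdom : set T;
  cmap : T -> 'rV[R]_n;
  cinv : 'rV[R]_n -> T }.

Record premanifold := Premanifold {
  car :> topologicalType;
  dim : nat;
  atlas : set (chart car dim) }.

Definition is_chart (M : premanifold) (c : chart M (dim M)) : Prop :=
  [/\ open (cdom c), open (cmap c @` cdom c),
      forall x, cdom c x -> cinv c (cmap c x) = x,
      forall x, cdom c x -> {for x, continuous (cmap c)} &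
      forall y, (cmap c @` cdom c) y -> {for y, continuous (cinv c)}].

Definition manifold (M : premanifold) : Prop :=
  [/\ hausdorff_space M, @second_countable M,
      forall c, atlas c -> is_chart (c : chart M (dim M)),
      forall x : M, exists2 c, atlas c & cdom c x &
      forall c d : chart M (dim M), atlas c -> atlas d -> forall i : 'I_(dim M),
        smooth_Rn (cmap c @` (cdom c `&` cdom d))
                  (fun y => cmap d (cinv c y) ord0 i)].

Definition smooth_fun (M : premanifold) (f : M -> R) : Prop :=
  forall c : chart M (dim M), atlas c ->
    smooth_Rn (cmap c @` cdom c) (fun y => f (cinv c y)).

(* meaningful for open U only *)
Definition smooth_map_on (M N : premanifold) (U : set M) (phi : M -> N) : Prop :=
  (forall x, U x -> {for x, continuous phi}) /\
  forall (c : chart M (dim M)) (d : chart N (dim N)), atlas c -> atlas d ->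
    forall i : 'I_(dim N),
      smooth_Rn (cmap c @` [set x | [/\ U x, cdom c x & cdom d (phi x)]])
                (fun y => cmap d (phi (cinv c y)) ord0 i).

Definition smooth_map (M N : premanifold) (phi : M -> N) : Prop :=
  smooth_map_on setT phi.

Definition prod_chart (M N : premanifold)
    (c : chart M (dim M)) (d : chart N (dim N)) : chart (M * N) (dim M + dim N) :=
  {| cdom := [set p | cdom c p.1 /\ cdom d p.2];
     cmap := fun p => row_mx (cmap c p.1) (cmap d p.2);
     cinv := fun y => (cinv c (lsubmx y), cinv d (rsubmx y)) |}.

Definition prodman (M N : premanifold) : premanifold :=
  {| car := (M * N)%type;
     dim := dim M + dim N;
     atlas := [set e | exists c d, [/\ atlas c, atlas d & e = @prod_chart M N c d]] |}.

Definition is_derivation (M : premanifold) (x : M) (D : (M -> R) -> R) : Prop :=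
  (forall (a : R) (f g : M -> R), smooth_fun f -> smooth_fun g ->
     D (fun y => a * f y + g y) = a * D f + D g) /\
  (forall f g : M -> R, smooth_fun f -> smooth_fun g ->
     D (fun y => f y * g y) = D f * g x + f x * D g).

(* Tangent vectors are point derivations of the algebra of smooth functions;
   they are extended by 0 to the non-smooth functions so that two vectors with
   the same action on smooth functions are equal. *)
Definition derivations (M : premanifold) (x : M) : {pred ((M -> R) -> R^o)} :=
  fun D => `[< (forall f, ~ smooth_fun f -> D f = 0) /\ is_derivation x D >].

Lemma derivations_submod (M : premanifold) (x : M) :
  submod_closed (@derivations M x).
Proof.
split.
  apply/asboolP; split => //; split.
  - by move=> a f g _ _; rewrite /= mulr0 addr0.
  - by move=> f g _ _; rewrite /= mul0r mulr0 addr0.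
move=> a u v /asboolP[u0 [uD uM]] /asboolP[v0 [vD vM]]; apply/asboolP.
have E h : (a *: u + v) h = a * u h + v h by [].
split=> [f sf|]; last split=> [b f g sf sg|f g sf sg]; rewrite !E.
- by rewrite u0 // v0 // mulr0 addr0.
- by rewrite uD // vD // !mulrDr !mulrA [a * b]mulrC addrACA.
- by rewrite uM // vM // !mulrDr !mulrDl !mulrA [a * f x]mulrC addrACA.
Qed.

HB.instance Definition _ (M : premanifold) (x : M) := GRing.isSubmodClosed.Build R ((M -> R) -> R^o)
  (@derivations M x) (@derivations_submod M x).

Record tangent (M : premanifold) (x : M) := Tangent {
  tval :> (M -> R) -> R^o;
  tvalP : tval \in @derivations M x }.

HB.instance Definition _ (M : premanifold) (x : M) := [isSub for @tval M x].
HB.instance Definition _ (M : premanifold) (x : M) := [Choice of @tangent M x by <:].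
HB.instance Definition _ (M : premanifold) (x : M) := [SubChoice_isSubLmodule of @tangent M x by <:].

Definition linear_form (V : lmodType R) (f : V -> R) : Prop :=
  forall (a : R) (u v : V), f (a *: u + v) = a * f u + f v.

Definition linear_forms (V : lmodType R) : {pred (V -> R^o)} :=
  fun f => `[< linear_form f >].

Lemma linear_forms_submod (V : lmodType R) : submod_closed (@linear_forms V).
Proof.
split; first by apply/asboolP => a u v; rewrite /= mulr0 addr0.
move=> a f g /asboolP fL /asboolP gL; apply/asboolP => b u v.
have E h : (a *: f + g) h = a * f h + g h by [].
by rewrite !E fL gL !mulrDr !mulrA [a * b]mulrC addrACA.
Qed.

HB.instance Definition _ (V : lmodType R) := GRing.isSubmodClosed.Build R (V -> R^o)
  (@linear_forms V) (@linear_forms_submod V).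

Record dual (V : lmodType R) := Dual {
  dval :> V -> R^o;
  dvalP : dval \in @linear_forms V }.

HB.instance Definition _ (V : lmodType R) := [isSub for @dval V].
HB.instance Definition _ (V : lmodType R) := [Choice of @dual V by <:].
HB.instance Definition _ (V : lmodType R) := [SubChoice_isSubLmodule of @dual V by <:].

(* The total constructors below return 0 when the given map is not a
   derivation (not a linear form); they are applied to maps that are. *)
Definition mktangent (M : premanifold) (x : M) (D : (M -> R) -> R) : tangent x :=
  insubd (0 : tangent x) (fun f => if `[< smooth_fun f >] then D f else 0).

Definition mkdual (V : lmodType R) (f : V -> R) : dual V :=
  insubd (0 : dual V) f.

Definition push (M N : premanifold) (phi : M -> N) (x : M) (v : tangent x) :
    tangent (phi x) :=
  mktangent (phi x) (fun f => v (fun y => f (phi y))).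

Definition cotangent (M : premanifold) (x : M) := dual (tangent x).

Definition diff1 (M : premanifold) (f : M -> R) (x : M) : cotangent x :=
  mkdual (fun v : tangent x => v f).

Definition vfield (M : premanifold) := forall x : M, tangent x.
Definition covfield (M : premanifold) := forall x : M, cotangent x.

Definition smooth_vf (M : premanifold) (X : vfield M) : Prop :=
  forall f : M -> R, smooth_fun f -> smooth_fun (fun x => X x f).

Definition smooth_cov (M : premanifold) (al : covfield M) : Prop :=
  forall X : vfield M, smooth_vf X -> smooth_fun (fun x => al x (X x)).

Definition lie (M : premanifold) (X Y : vfield M) : vfield M := fun x =>
  mktangent x (fun f => X x (fun y => Y y f) - Y x (fun y => X y f)).

(* A vector bundle is a family of fibres with its space of smooth global
   sections. *)
Record prebundle (M : premanifold) := Prebundle {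
  fib :> M -> lmodType R;
  smooth_sec : set (forall x, fib x) }.

Definition section (M : premanifold) (V : prebundle M) := forall x, V x.

Definition basis_of_set (V : lmodType R) k (e : 'I_k -> V) (W : set V) : Prop :=
  (forall c : 'I_k -> R, \sum_i c i *: e i = 0 -> forall i, c i = 0) /\
  W = [set v | exists c : 'I_k -> R, v = \sum_i c i *: e i].

Definition vector_bundle (M : premanifold) (V : prebundle M) : Prop :=
  (* local frames, in which smooth sections have smooth coefficients *)
  (forall p : M, exists r (e : 'I_r -> section V),
    [/\ forall i, smooth_sec (e i),
        \forall x \near p, basis_of_set (fun i => e i x) [set: V x] &
        forall s : section V, smooth_sec s ->
          exists c : 'I_r -> M -> R, (forall i, smooth_fun (c i)) /\
            \forall x \near p, s x = \sum_i c i x *: e i x]) /\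
  (forall s : section V,
    (forall p : M, exists r (e : 'I_r -> section V) (c : 'I_r -> M -> R),
       [/\ forall i, smooth_sec (e i), forall i, smooth_fun (c i) &
           \forall x \near p, s x = \sum_i c i x *: e i x]) ->
    smooth_sec s).

(* W is a smooth subbundle of the pull-back of V along psi; when psi is an
   embedding this is a subbundle of the restriction of V to the image. *)
Definition subbundle_along (N M : premanifold) (psi : N -> M) (V : prebundle M)
    (W : forall x : N, set (V (psi x))) : Prop :=
  forall p : N, exists k (w : 'I_k -> section V),
    (forall i, smooth_sec (w i)) /\
    \forall x \near p, basis_of_set (fun i => w i (psi x)) (W x).

Definition subbundle (M : premanifold) (V : prebundle M)
    (W : forall x : M, set (V x)) : Prop :=
  subbundle_along (psi := id) W.

Record precourant (M : premanifold) := Precourant {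
  bun :> prebundle M;
  pairing : forall x, bun x -> bun x -> R;
  anchor : forall x, bun x -> (M -> R) -> R;
  bracket : section bun -> section bun -> section bun }.

Definition courant_algebroid (M : premanifold) (E : precourant M) : Prop :=
  let smooth (e : section E) := smooth_sec e in
  let act (e : section E) f : M -> R := fun x => anchor (e x) f in
  let ip (e1 e2 : section E) : M -> R := fun x => pairing (e1 x) (e2 x) in
  let br (e1 e2 : section E) := bracket e1 e2 in
  [/\ vector_bundle E,
      [/\ forall x (e : E x), linear_form (pairing e),
          forall x (e e' : E x), pairing e e' = pairing e' e,
          forall x (e : E x), (forall e', pairing e e' = 0) -> e = 0 &
          forall e e', smooth e -> smooth e' -> smooth_fun (ip e e')],
      [/\ forall x (e : E x), is_derivation x (anchor e),
          forall x f, smooth_fun f -> linear_form (fun e : E x => anchor e f) &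
          forall e f, smooth e -> smooth_fun f -> smooth_fun (act e f)],
      [/\ forall e1 e2, smooth e1 -> smooth e2 -> smooth (br e1 e2),
          forall (a : R) e1 e2 e3, smooth e1 -> smooth e2 -> smooth e3 ->
            br (fun x => a *: e1 x + e2 x) e3
            = (fun x => a *: br e1 e3 x + br e2 e3 x),
          forall (a : R) e1 e2 e3, smooth e1 -> smooth e2 -> smooth e3 ->
            br e1 (fun x => a *: e2 x + e3 x)
            = (fun x => a *: br e1 e2 x + br e1 e3 x) &
          forall e1 e2 f, smooth e1 -> smooth e2 -> smooth_fun f ->
            br e1 (fun x => f x *: e2 x)
            = (fun x => f x *: br e1 e2 x + act e1 f x *: e2 x)] &
      [/\ forall e1 e2 e3, smooth e1 -> smooth e2 -> smooth e3 ->
            br e1 (br e2 e3) = (fun x => br (br e1 e2) e3 x + br e2 (br e1 e3) x),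
          forall e1 e2 e3, smooth e1 -> smooth e2 -> smooth e3 ->
            act e1 (ip e2 e3) = (fun x => ip (br e1 e2) e3 x + ip e2 (br e1 e3) x),
          forall e1 e2 e3, smooth e1 -> smooth e2 -> smooth e3 ->
            (fun x => pairing (br e1 e2 x + br e2 e1 x) (e3 x))
            = act e3 (ip e1 e2) &
          forall e1 e2 f, smooth e1 -> smooth e2 -> smooth_fun f ->
            act (br e1 e2) f
            = (fun x => act e1 (act e2 f) x - act e2 (act e1 f) x)]].

Definition opp_courant (M : premanifold) (E : precourant M) : precourant M :=
  {| bun := E;
     pairing := fun x e e' => - pairing e e';
     anchor := fun x e f => anchor e f;
     bracket := @bracket M E |}.

Definition prod_bundle (M N : premanifold) (V : prebundle M) (W : prebundle N) :
    prebundle (prodman M N) :=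
  {| fib := fun p : prodman M N => (V p.1 * W p.2)%type : lmodType R;
     smooth_sec := [set s | forall p : prodman M N,
       exists k (a : 'I_k -> section V) (b : 'I_k -> section W)
              (f g : 'I_k -> prodman M N -> R),
         [/\ forall i, smooth_sec (a i), forall i, smooth_sec (b i),
             forall i, smooth_fun (f i), forall i, smooth_fun (g i) &
             \forall q \near p, s q = (\sum_i f i q *: a i q.1,
                                       \sum_i g i q *: b i q.2)]] |}.

Definition prod_courant (M N : premanifold) (E : precourant M) (F : precourant N)
    (B : section (prod_bundle E F) -> section (prod_bundle E F) ->
         section (prod_bundle E F)) : precourant (prodman M N) :=
  {| bun := prod_bundle E F;
     pairing := fun (p : prodman M N) (e e' : prod_bundle E F p) =>
       pairing e.1 e'.1 + pairing e.2 e'.2;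
     anchor := fun (p : prodman M N) (e : prod_bundle E F p) f =>
       anchor e.1 (fun y => f (y, p.2)) + anchor e.2 (fun z => f (p.1, z));
     bracket := B |}.

(* B is the bracket of the product Courant algebroid E x F,
   characterised (on smooth sections, uniquely) by being componentwise on
   pull-backs of sections of the factors. *)
Definition product_bracket (M N : premanifold) (E : precourant M) (F : precourant N)
    (B : section (prod_bundle E F) -> section (prod_bundle E F) ->
         section (prod_bundle E F)) : Prop :=
  courant_algebroid (prod_courant B) /\
  forall (e e' : section E) (h h' : section F),
    smooth_sec e -> smooth_sec e' -> smooth_sec h -> smooth_sec h' ->
    B (fun p => (e p.1, h p.2)) (fun p => (e' p.1, h' p.2))
    = (fun p => (bracket e e' p.1, bracket h h' p.2)).

Definition lagrangian (M : premanifold) (E : precourant M) (x : M)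
    (W : set (E x)) : Prop :=
  W = [set e | forall e', W e' -> pairing e e' = 0].

Definition dirac (M : premanifold) (E : precourant M) (L : forall x, set (E x)) : Prop :=
  [/\ subbundle L, forall x, lagrangian (L x) &
      forall e e' : section E, smooth_sec e -> smooth_sec e' ->
        (forall x, L x (e x)) -> (forall x, L x (e' x)) ->
        forall x, L x (bracket e e' x)].

Definition manin_pair (M : premanifold) (E : precourant M)
    (L : forall x, set (E x)) : Prop :=
  courant_algebroid E /\ dirac L.

(* Relations E1 --> E2 over phi, indexed by M1 through x |-> (x, phi x). *)
Definition courant_relation (M1 M2 : premanifold) (E1 : prebundle M1)
    (E2 : prebundle M2) (phi : M1 -> M2) :=
  forall x : M1, set (E1 x * E2 (phi x)).

Definition courant_morphism (M1 M2 : premanifold) (E1 : precourant M1)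
    (E2 : precourant M2) (phi : M1 -> M2) (Rel : courant_relation E1 E2 phi) : Prop :=
  smooth_map phi /\
  exists B : section (prod_bundle E1 (opp_courant E2)) -> _ -> _,
    product_bracket B /\
    let P := prod_courant B in
    [/\ subbundle_along (psi := fun x : M1 => (x, phi x) : prodman M1 M2) (V := P) Rel,
        forall x, lagrangian (E := P) (x := (x, phi x)) (Rel x),
        (* tangency of the anchor to the graph of phi *)
        forall x e1 e2, Rel x (e1, e2) -> forall f : M2 -> R, smooth_fun f ->
          anchor e2 f = anchor e1 (fun y => f (phi y)) &
        forall s s' : section P, smooth_sec s -> smooth_sec s' ->
          (forall x, Rel x (s (x, phi x))) -> (forall x, Rel x (s' (x, phi x))) ->
          forall x, Rel x (bracket s s' (x, phi x))].

Definition manin_morphism (M1 M2 : premanifold) (E1 : precourant M1)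
    (L1 : forall x, set (E1 x)) (E2 : precourant M2) (L2 : forall x, set (E2 x))
    (phi : M1 -> M2) (Rel : courant_relation E1 E2 phi) : Prop :=
  courant_morphism Rel /\
  forall x : M1,
    (forall e1 e2, Rel x (e1, e2) -> L1 x e1 -> L2 (phi x) e2) /\
    (forall e2, L2 (phi x) e2 -> exists! e1, L1 x e1 /\ Rel x (e1, e2)).

Definition smooth_TTstar (M : premanifold)
    (s : forall x : M, tangent x * cotangent x) : Prop :=
  smooth_vf (fun x => (s x).1) /\ smooth_cov (fun x => (s x).2).

Definition TTstar (M : premanifold) : prebundle M :=
  {| fib := fun x : M => (tangent x * cotangent x)%type : lmodType R;
     smooth_sec := @smooth_TTstar M |}.

Definition extend_vf (M : premanifold) (x : M) (v : tangent x) : vfield M :=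
  the_or (fun=> 0) (fun W : vfield M => smooth_vf W /\ W x = v).

(* [[X + al, Y + be]] = [X, Y] + L_X be - i_Y d al; the covector
   (L_X be - i_Y d al)_x is evaluated on the value at x of a vector field W by
   X(be(W)) - be([X, W]) - (Y(al(W)) - W(al(Y)) - al([Y, W])). *)
Definition dorfman (M : premanifold) (s s' : section (TTstar M)) : section (TTstar M) :=
  let X : vfield M := fun y => (s y).1 in
  let al : covfield M := fun y => (s y).2 in
  let Y : vfield M := fun y => (s' y).1 in
  let be : covfield M := fun y => (s' y).2 in
  fun x =>
    (lie X Y x,
     mkdual (fun w : tangent x =>
       let W := extend_vf w in
       X x (fun y => be y (W y)) - be x (lie X W x)
       - (Y x (fun y => al y (W y)) - W x (fun y => al y (Y y))
          - al x (lie Y W x)))).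

Definition standard_courant (M : premanifold) : precourant M :=
  {| bun := TTstar M;
     pairing := fun x (e e' : TTstar M x) => (e.2 e'.1 : R) + e'.2 e.1;
     anchor := fun x (e : TTstar M x) f => e.1 f;
     bracket := @dorfman M |}.

Definition tangent_part (M : premanifold) (x : M) : set (standard_courant M x) :=
  [set e | e.2 = 0].

End Manifolds.

Section Groupoids.
Context {R : realType}.

(* mul g h is meaningful when src g = tgt h *)
Record pregroupoid := Pregroupoid {
  arr : @premanifold R;
  obj : @premanifold R;
  src : arr -> obj;
  tgt : arr -> obj;
  unit : obj -> arr;
  inv : arr -> arr;
  mul : arr -> arr -> arr }.

Definition submersion (M N : @premanifold R) (phi : M -> N) : Prop :=
  smooth_map phi /\
  forall (x : M) (w : tangent (phi x)), exists v : tangent x, push phi v = w.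

Definition composable (G : pregroupoid) : set (prodman (arr G) (arr G)) :=
  [set p | src p.1 = tgt p.2].

(* smoothness on the submanifold of composable pairs: local existence of
   smooth extensions *)
Definition smooth_mul (G : pregroupoid) : Prop :=
  forall p, composable p ->
    exists (U : set (prodman (arr G) (arr G)))
           (Phi : prodman (arr G) (arr G) -> arr G),
      [/\ open U, U p, smooth_map_on U Phi &
          forall q, U q -> composable q -> Phi q = mul q.1 q.2].

Definition lie_groupoid (G : pregroupoid) : Prop :=
  [/\ manifold (arr G) /\ manifold (obj G),
      [/\ submersion (@src G), submersion (@tgt G), smooth_map (@unit G),
          smooth_map (@inv G) & smooth_mul G],
      [/\ forall x : obj G, src (unit x) = x,
          forall x : obj G, tgt (unit x) = x,
          forall g h : arr G, src g = tgt h -> src (mul g h) = src h &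
          forall g h : arr G, src g = tgt h -> tgt (mul g h) = tgt g],
      [/\ forall g h k : arr G, src g = tgt h -> src h = tgt k ->
            mul g (mul h k) = mul (mul g h) k,
          forall g : arr G, mul g (unit (src g)) = g &
          forall g : arr G, mul (unit (tgt g)) g = g] &
      [/\ forall g : arr G, src (inv g) = tgt g,
          forall g : arr G, tgt (inv g) = src g,
          forall g : arr G, mul g (inv g) = unit (tgt g) &
          forall g : arr G, mul (inv g) g = unit (src g)]].

Definition groupoid_morphism (G H : pregroupoid) (phi : arr G -> arr H) : Prop :=
  smooth_map phi /\
  forall g h : arr G, src g = tgt h ->
    src (phi g) = tgt (phi h) /\ phi (mul g h) = mul (phi g) (phi h).

Definition pair_groupoid (M : @premanifold R) : pregroupoid :=
  {| arr := prodman M M;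
     obj := M;
     src := fun p : prodman M M => p.2;
     tgt := fun p : prodman M M => p.1;
     unit := fun x => (x, x) : prodman M M;
     inv := fun p : prodman M M => (p.2, p.1) : prodman M M;
     mul := fun p q : prodman M M => (p.1, q.2) : prodman M M |}.

(* The multiplication and the inversion of a VB-groupoid over G, given by their
   graphs (c is the product of a and b; b is the inverse of a). *)
Record vb_structure (G : pregroupoid) (V : prebundle (arr G)) := VbStructure {
  vmul : forall g h k : arr G, V g -> V h -> V k -> Prop;
  vinv : forall g h : arr G, V g -> V h -> Prop }.

(* For a subbundle Rel this says that Rel is a VB-subgroupoid of the product:
   its units form a subbundle of the base (the source is a smooth family of
   projections onto it along the units) and its source is then fibrewise onto
   this subbundle. *)
Definition vb_closed (G H : pregroupoid) (V : prebundle (arr G))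
    (W : prebundle (arr H)) (SV : vb_structure V) (SW : vb_structure W)
    (phi : arr G -> arr H) (Rel : courant_relation V W phi) : Prop :=
  (forall (g h k : arr G) (a : V g) (b : V h) (c : V k)
          (a' : W (phi g)) (b' : W (phi h)) (c' : W (phi k)),
     vmul SV a b c -> vmul SW a' b' c' ->
     Rel g (a, a') -> Rel h (b, b') -> Rel k (c, c')) /\
  (forall (g h : arr G) (a : V g) (b : V h) (a' : W (phi g)) (b' : W (phi h)),
     vinv SV a b -> vinv SW a' b' -> Rel g (a, a') -> Rel h (b, b')).

Definition multiplicative_manin_morphism (G H : pregroupoid)
    (E : precourant (arr G)) (L : forall g, set (E g)) (SE : vb_structure E)
    (F : precourant (arr H)) (K : forall h, set (F h)) (SF : vb_structure F)
    (phi : arr G -> arr H) (Rel : courant_relation E F phi) : Prop :=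
  [/\ groupoid_morphism phi, manin_morphism L K Rel & vb_closed SE SF Rel].

(* z = Tm(v, w): for f smooth on G, f \o m is near (g, h) the restriction to
   composable pairs of a smooth function F on G x G, and Tm(v, w) f is the
   derivative of F along (v, w). *)
Definition tangent_mul (G : pregroupoid) (g h k : arr G)
    (v : tangent g) (w : tangent h) (z : tangent k) : Prop :=
  [/\ src g = tgt h, k = mul g h,
      forall f : obj G -> R, smooth_fun f ->
        v (fun y => f (src y)) = w (fun y => f (tgt y)) &
      forall (f : arr G -> R) (F : prodman (arr G) (arr G) -> R),
        smooth_fun f -> smooth_fun F ->
        (\forall q \near ((g, h) : prodman (arr G) (arr G)),
           composable q -> F q = f (mul q.1 q.2)) ->
        z f = v (fun y => F (y, h)) + w (fun y => F (g, y))].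

(* the product of composable covectors is characterised by
   <al . be, v . w> = <al, v> + <be, w> *)
Definition cotangent_mul (G : pregroupoid) (g h k : arr G)
    (al : cotangent g) (be : cotangent h) (ga : cotangent k) : Prop :=
  [/\ src g = tgt h, k = mul g h &
      forall (v : tangent g) (w : tangent h) (z : tangent k),
        tangent_mul v w z -> (ga z : R) = (al v : R) + be w].

Definition tangent_inv (G : pregroupoid) (g h : arr G)
    (v : tangent g) (w : tangent h) : Prop :=
  h = inv g /\ forall f : arr G -> R, smooth_fun f -> w f = v (fun y => f (inv y)).

Definition cotangent_inv (G : pregroupoid) (g h : arr G)
    (al : cotangent g) (be : cotangent h) : Prop :=
  h = inv g /\
  forall (v : tangent g) (w : tangent h), tangent_inv v w -> (be w : R) = - (al v : R).

Definition TTstar_groupoid (G : pregroupoid) : vb_structure (TTstar (arr G)) :=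
  @VbStructure G (TTstar (arr G))
    (fun g h k a b c => tangent_mul a.1 b.1 c.1 /\ cotangent_mul a.2 b.2 c.2)
    (fun g h a b => tangent_inv a.1 b.1 /\ cotangent_inv a.2 b.2).

Inductive pair_mul (M : @premanifold R) (V : prebundle M) :
    forall p q r : prodman M M,
      prod_bundle V V p -> prod_bundle V V q -> prod_bundle V V r -> Prop :=
| PairMul (x y z : M) (e1 : V x) (e2 : V y) (e3 : V z) :
    @pair_mul M V (x, y) (y, z) (x, z) (e1, e2) (e2, e3) (e1, e3).

Inductive pair_inv (M : @premanifold R) (V : prebundle M) :
    forall p q : prodman M M, prod_bundle V V p -> prod_bundle V V q -> Prop :=
| PairInv (x y : M) (e1 : V x) (e2 : V y) :
    @pair_inv M V (x, y) (y, x) (e1, e2) (e2, e1).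

Definition pair_vb_groupoid (M : @premanifold R) (V : prebundle M) :
    @vb_structure (pair_groupoid M) (prod_bundle V V) :=
  @VbStructure (pair_groupoid M) (prod_bundle V V) (@pair_mul M V) (@pair_inv M V).

Definition source_vertical (G : pregroupoid) (x : obj G) : {pred tangent (unit x)} :=
  fun v => `[< forall f : obj G -> R, smooth_fun f -> v (fun g => f (src g)) = 0 >].

Lemma source_vertical_submod (G : pregroupoid) (x : obj G) : submod_closed (@source_vertical G x).
Proof.
split; first by apply/asboolP.
move=> a u v /asboolP u0 /asboolP v0; apply/asboolP => f sf.
have E h : (a *: u + v : tangent _) h = a * u h + v h by [].
by rewrite E u0 // v0 // mulr0 addr0.
Qed.

HB.instance Definition _ (G : pregroupoid) (x : obj G) := GRing.isSubmodClosed.Build R (tangent (unit x))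
  (@source_vertical G x) (@source_vertical_submod G x).

Record algebroid_fibre (G : pregroupoid) (x : obj G) := AlgebroidFibre {
  aval :> tangent (unit x);
  avalP : aval \in @source_vertical G x }.

HB.instance Definition _ (G : pregroupoid) (x : obj G) := [isSub for @aval G x].
HB.instance Definition _ (G : pregroupoid) (x : obj G) := [Choice of @algebroid_fibre G x by <:].
HB.instance Definition _ (G : pregroupoid) (x : obj G) := [SubChoice_isSubLmodule of @algebroid_fibre G x by <:].

Definition algebroid (G : pregroupoid) : prebundle (obj G) :=
  {| fib := fun x : obj G => @algebroid_fibre G x : lmodType R;
     smooth_sec := [set u | forall f : arr G -> R, smooth_fun f ->
                            smooth_fun (fun x => aval (u x) f)] |}.

Definition algebroid_anchor (G : pregroupoid) (x : obj G) (u : algebroid G x)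
    (f : obj G -> R) : R :=
  aval u (fun g => f (tgt g)).

(* u^r at g is the product u . 0_g in the tangent groupoid *)
Definition right_inv (G : pregroupoid) (g : arr G) (u : algebroid G (tgt g)) :
    tangent g :=
  the_or 0 (fun z : tangent g => tangent_mul (aval u) (0 : tangent g) z).

(* i(v)^l at g is the product 0_g . Ti(v) *)
Definition left_inv (G : pregroupoid) (g : arr G) (v : algebroid G (src g)) :
    tangent g :=
  the_or 0 (fun z : tangent g =>
    tangent_mul (0 : tangent g) (push (@inv G) (aval v)) z).

Definition right_vf (G : pregroupoid) (u : section (algebroid G)) : vfield (arr G) :=
  fun g => right_inv (u (tgt g)).

Definition algebroid_bracket (G : pregroupoid) (u v : section (algebroid G)) :
    section (algebroid G) :=
  fun x => insubd (0 : @algebroid_fibre G x) (lie (right_vf u) (right_vf v) (unit x)).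

Definition algebroid_manin_pair (G : pregroupoid) (E : precourant (obj G))
    (iota : forall x, {linear algebroid G x -> E x}) : Prop :=
  [/\ manin_pair (fun x => range (iota x)),
      forall x, injective (iota x),
      forall u : section (algebroid G),
        smooth_sec u <-> smooth_sec (fun x => iota x (u x)),
      forall x (u : algebroid G x) f, smooth_fun f ->
        anchor (iota x u) f = algebroid_anchor u f &
      forall u v : section (algebroid G), smooth_sec u -> smooth_sec v ->
        (fun x => iota x (algebroid_bracket u v x))
        = bracket (fun x => iota x (u x)) (fun x => iota x (v x))].

(* Elements of wedge^k A (of wedge^k TG) are alternating k-linear forms on the
   dual spaces. *)
Definition alternating2 (V : lmodType R) (P : V -> V -> R) : Prop :=
  (forall a, linear_form (P a)) /\ (forall a, P a a = 0) /\
  (forall b, linear_form (P ^~ b)).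

Definition alternating3 (V : lmodType R) (P : V -> V -> V -> R) : Prop :=
  (forall a, alternating2 (P a)) /\ (forall b, alternating2 (fun a c => P a b c)) /\
  (forall c, alternating2 (fun a b => P a b c)).

Definition bivector_field (M : @premanifold R) :=
  forall x : M, cotangent x -> cotangent x -> R.
Definition trivector_field (M : @premanifold R) :=
  forall x : M, cotangent x -> cotangent x -> cotangent x -> R.

Definition is_bivector_field (M : @premanifold R) (pi : bivector_field M) : Prop :=
  (forall x, alternating2 (pi x)) /\
  forall al be : covfield M, smooth_cov al -> smooth_cov be ->
    smooth_fun (fun x => pi x (al x) (be x)).

Definition wedge2 (G : pregroupoid) :=
  forall x : obj G, dual (algebroid G x) -> dual (algebroid G x) -> R.
Definition wedge3 (G : pregroupoid) :=
  forall x : obj G,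
    dual (algebroid G x) -> dual (algebroid G x) -> dual (algebroid G x) -> R.

Definition smooth_dual_sec (G : pregroupoid)
    (a : forall x, dual (algebroid G x)) : Prop :=
  forall u : section (algebroid G), smooth_sec u -> smooth_fun (fun x => a x (u x)).

Definition is_wedge3_section (G : pregroupoid) (chi : wedge3 G) : Prop :=
  (forall x, alternating3 (chi x)) /\
  forall a b c, smooth_dual_sec a -> smooth_dual_sec b -> smooth_dual_sec c ->
    smooth_fun (fun x => chi x (a x) (b x) (c x)).

(* the transposes of u |-> u^r and of v |-> i(v)^l at g *)
Definition right_pull (G : pregroupoid) (g : arr G) (al : cotangent g) :
    dual (algebroid G (tgt g)) :=
  mkdual (fun u : algebroid G (tgt g) => al (right_inv u) : R).
Definition left_pull (G : pregroupoid) (g : arr G) (al : cotangent g) :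
    dual (algebroid G (src g)) :=
  mkdual (fun v : algebroid G (src g) => al (left_inv v) : R).

Definition right_bivector (G : pregroupoid) (b : wedge2 G) : bivector_field (arr G) :=
  fun g al be => b (tgt g) (right_pull al) (right_pull be).

Definition right_trivector (G : pregroupoid) (chi : wedge3 G) :
    trivector_field (arr G) :=
  fun g al be ga => chi (tgt g) (right_pull al) (right_pull be) (right_pull ga).

(* i(chi)^l *)
Definition left_trivector (G : pregroupoid) (chi : wedge3 G) :
    trivector_field (arr G) :=
  fun g al be ga => chi (src g) (left_pull al) (left_pull be) (left_pull ga).

(* A k-vector field as a multiderivation, reading the first k of a sequence of
   functions. *)
Definition multiderivation (M : @premanifold R) := (nat -> M -> R) -> M -> R.

Definition of_bivector (M : @premanifold R) (pi : bivector_field M) :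
    multiderivation M :=
  fun F x => pi x (diff1 (F 0%N) x) (diff1 (F 1%N) x).
Definition of_trivector (M : @premanifold R) (T : trivector_field M) :
    multiderivation M :=
  fun F x => T x (diff1 (F 0%N) x) (diff1 (F 1%N) x) (diff1 (F 2%N) x).

(* For P of degree p + 1 and Q of degree q + 1:
   (P o Q)(F_0, ..., F_{p+q}) is the signed sum, over (q+1, p)-shuffles s, of
   P (Q (F_{s 0}, ..., F_{s q}), F_{s (q+1)}, ..., F_{s (p+q)}), here written as
   an average over all permutations. *)
Definition schouten_comp (M : @premanifold R) (p q : nat)
    (P Q : multiderivation M) : multiderivation M :=
  fun F x =>
    ((q.+1)`! * p`!)%:R^-1 *
    \sum_(s : {perm 'I_(p + q).+1})
      (-1) ^+ s *
      (let Fs := fun k : nat => F (s (inord k)) in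
       P (fun j => if j is j'.+1 then Fs (q.+1 + j')%N else Q Fs) x).

(* Schouten bracket with [X, Q] = L_X Q for vector fields X; for
   pi = X /\ Y this gives [pi, pi] = 2 X /\ Y /\ [X, Y]. *)
Definition schouten (M : @premanifold R) (p q : nat) (P Q : multiderivation M) :
    multiderivation M :=
  fun F x =>
    (-1) ^+ (p * q) * schouten_comp p q P Q F x - schouten_comp q p Q P F x.

Definition lie_derivative_bivector (M : @premanifold R) (X : vfield M)
    (pi : bivector_field M) (f g : M -> R) : M -> R :=
  fun x =>
    X x (fun y => pi y (diff1 f y) (diff1 g y))
    - pi x (diff1 (fun y => X y f) x) (diff1 g x)
    - pi x (diff1 f x) (diff1 (fun y => X y g) x).

(* Graph(m) is coisotropic for pi + pi - pi; its conormal vectors are the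
   (al, be, - al . be). *)
Definition multiplicative_bivector (G : pregroupoid)
    (pi : bivector_field (arr G)) : Prop :=
  forall (g h k : arr G) (al al' : cotangent g) (be be' : cotangent h)
         (ga ga' : cotangent k),
    cotangent_mul al be ga -> cotangent_mul al' be' ga' ->
    pi g al al' + pi h be be' - pi k ga ga' = 0.

Definition quasi_poisson (G : pregroupoid) (pi : bivector_field (arr G))
    (chi : wedge3 G) : Prop :=
  [/\ lie_groupoid G,
      is_bivector_field pi /\ multiplicative_bivector pi,
      is_wedge3_section chi,
      forall F : nat -> arr G -> R, (forall i, smooth_fun (F i)) -> forall g,
        2^-1 * schouten 1 1 (of_bivector pi) (of_bivector pi) F g
        = of_trivector (right_trivector chi) F g
          + of_trivector (left_trivector chi) F g &
      forall F : nat -> arr G -> R, (forall i, smooth_fun (F i)) -> forall g,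
        schouten 1 2 (of_bivector pi) (of_trivector (right_trivector chi)) F g = 0].

Definition isotropic_complement (G : pregroupoid) (E : precourant (obj G))
    (iota : forall x, {linear algebroid G x -> E x})
    (C : forall x, set (E x)) : Prop :=
  [/\ subbundle C,
      forall x (e : E x),
        exists! uc : algebroid G x * E x, C x uc.2 /\ e = iota x uc.1 + uc.2 &
      forall x e e', C x e -> C x e' -> pairing e e' = 0].

(* a smooth section of C whose value at x is the element of C_x corresponding
   to a under C = A^*, xi |-> <xi, ->  *)
Definition complement_section (G : pregroupoid) (E : precourant (obj G))
    (iota : forall x, {linear algebroid G x -> E x}) (C : forall x, set (E x))
    (x : obj G) (a : dual (algebroid G x)) : section E :=
  the_or (fun=> 0) (fun xi : section E =>
    [/\ smooth_sec xi, forall y, C y (xi y) &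
        forall u : algebroid G x, pairing (xi x) (iota x u) = a u]).

Definition dstar_fun (G : pregroupoid) (E : precourant (obj G))
    (iota : forall x, {linear algebroid G x -> E x}) (C : forall x, set (E x))
    (f : obj G -> R) : section (algebroid G) :=
  fun x => the_or 0 (fun w : algebroid G x =>
    forall xi, C x xi -> pairing xi (iota x w) = anchor xi f).

Definition dstar_sec (G : pregroupoid) (E : precourant (obj G))
    (iota : forall x, {linear algebroid G x -> E x}) (C : forall x, set (E x))
    (u : section (algebroid G)) : wedge2 G :=
  fun x a1 a2 =>
    let xi1 := complement_section iota C a1 in
    let xi2 := complement_section iota C a2 in
    anchor (xi1 x) (fun y => pairing (xi2 y) (iota y (u y)))
    - anchor (xi2 x) (fun y => pairing (xi1 y) (iota y (u y)))
    - pairing (bracket xi1 xi2 x) (iota x (u x)).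

Definition triple_chi (G : pregroupoid) (E : precourant (obj G))
    (iota : forall x, {linear algebroid G x -> E x}) (C : forall x, set (E x)) :
    wedge3 G :=
  fun x a1 a2 a3 =>
    pairing (bracket (complement_section iota C a1) (complement_section iota C a2) x)
            (complement_section iota C a3 x).

(* d0 and d1 are the restrictions of the derivation d_* to functions and to
   sections of A, which determine it. *)
Definition integrates (G : pregroupoid) (pi : bivector_field (arr G))
    (d0 : (obj G -> R) -> section (algebroid G))
    (d1 : section (algebroid G) -> wedge2 G) : Prop :=
  (forall u : section (algebroid G), smooth_sec u ->
     forall f h : arr G -> R, smooth_fun f -> smooth_fun h -> forall g,
       lie_derivative_bivector (right_vf u) pi f h g
       = - right_bivector (d1 u) (diff1 f g) (diff1 h g)) /\
  (forall f : obj G -> R, smooth_fun f -> forall (g : arr G) (be : cotangent g),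
     pi g (diff1 (fun y => f (tgt y)) g) be = - (be (right_vf (d0 f) g) : R)).

(* Graph(pi^#) = Rel o (C x C), with pi^#(al) = pi(al, -) *)
Definition graph_is_composition (G : pregroupoid) (E : precourant (obj G))
    (phi : arr G -> prodman (obj G) (obj G))
    (Rel : courant_relation (TTstar (arr G)) (prod_bundle E E) phi)
    (C : forall x, set (E x)) (pi : bivector_field (arr G)) : Prop :=
  forall (g : arr G) (X : tangent g) (al : cotangent g),
    (forall be : cotangent g, (be X : R) = pi g al be) <->
    exists e : prod_bundle E E (phi g),
      [/\ C _ e.1, C _ e.2 & Rel g ((X, al), e)].

End Groupoids.

(* Main.v *)
Require Import Defs.
From HB Require Import structures.
From mathcomp Require Import all_boot all_order all_algebra perm.
From mathcomp Require Import all_classical all_reals all_analysis.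
From mathcomp Require Import ring lra.
Import Order.TTheory GRing.Theory Num.Theory numFieldNormedType.Exports.
Local Open Scope classical_set_scope.
Local Open Scope ring_scope.
Set Implicit Arguments.
Unset Strict Implicit.
Unset Printing Implicit Defensive.

(* The elements of R over g with covector part 0 are exactly the graph of the
   action of A x A, so R being lagrangian determines, for every covector al at g,
   a unique X with ((X, al), (xi, eta)) in R and xi, eta in C; this is pi^#. Over
   a function F the elements ((pi^# dF, dF), (xi, eta)) extend to smooth sections
   s_F of the product Courant algebroid P = TG x (E x E^-)^-, and all identities
   come from the bracket of P:
   - <[[s_F, s_H]], s_K> = 0 on the graph splits into the Jacobiator of pi minus
     the two copies of chi, which gives 1/2 [pi, pi] = chi^r + i(chi)^l;
   - the same computation with s_F replaced by (u^r; u, 0) gives L_{u^r} pi;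
   - let s''_F be s_F without its component over the target. The s''_F span an
     isotropic family whose trilinear form <[[-, -]], -> restricts to chi^r, and
     the Jacobi identity of P applied to four of them is [pi, chi^r] = 0.
   Multiplicativity: (i(v)^l)_g . (v^r)_h is related to 0, hence is 0, so the
   source component over g and the target component over h agree and the products
   in TG are again related.

   Tangent vectors being derivations, the analysis enters through Hadamard's
   lemma (coordinate frames) and a level-set argument (a derivation at a
   composable pair that is tangent to the composable pairs only depends on
   restrictions to them, so the tangent multiplication exists). *)

(** * Calculus in R^n *)

(** The bracket of P acts on global smooth sections and is explicit only on pull-backs from the
    three factors, whereas the C-components of s_F vary with the point of G. The way out is that
    <[[e1, e2]], e3> depends only on the values at a point as long as the sections involved are
    isotropic everywhere. At a given point s_F may therefore be traded for a pull-back with frozen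
    C-components. Frames of A and C being local, F is first multiplied by a bump function; cutting
    off F rather than dF keeps the covector part exact. For [pi, chi^r] = 0 the full sections are
    useless in the Jacobi identity, because their trilinear form vanishes on the graph. Without the
    target component they stay isotropic, and that zero becomes chi^r. They leave R, which two facts
    make up for: the form is constant along the target, so its derivatives reduce to derivatives on
    G along pi^#; and the pairing of two truncated brackets is exactly the target term missing from
    the zero pairing of the full brackets. *)

Section Calculus.
Context {R : realType}.
Implicit Types (n m k : nat).

Lemma near_ord n (T : Type) (F : set_system T) (P : 'I_n -> T -> Prop) :
  Filter F -> (forall i, \forall x \near F, P i x) ->
  \forall x \near F, forall i, P i x.
Proof. by move=> FF H; exact: (@filter_forall _ 'I_n (fun i => P i) F FF H). Qed.

Lemma cvg_bigsum n (T : Type) (F : set_system T) (q : 'I_n -> T -> R) (l : 'I_n -> R) :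
  Filter F -> (forall i, q i x @[x --> F] --> l i) ->
  \sum_i q i x @[x --> F] --> \sum_i l i.
Proof.
move=> FF H; apply: (@cvg_big _ _ _ _ _ _ _ _ _ q l) => //; exact: add_continuous.
Qed.

Lemma is_derive_line (V : normedModType R) (f : V -> R) (w v : V) (s : R) :
  derivable f (s *: v + w) v ->
  is_derive s 1 (fun s : R => f (s *: v + w)) ('D_v f (s *: v + w)).
Proof.
move=> df.
have E : (fun h : R => h^-1 *: (f (h *: v + (s *: v + w)) - f (s *: v + w))) =
  (fun h : R => h^-1 *: (f ((h *: (1 : R) + s) *: v + w) - f (s *: v + w))).
  by apply/funext => h; rewrite scalerDl addrA [h *: 1]mulr1.
by split; [rewrite /derivable -E; exact: df | rewrite /derive -E].
Qed.

(** The steps along coordinate axes in [partials_close_increment] may be negative, so the endpoints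
    come in no fixed order. *)
Lemma MVT_unordered (f df : R -> R) (a b : R) :
  (forall x, Num.min a b <= x <= Num.max a b -> is_derive x 1 f (df x)) ->
  exists2 c, Num.min a b <= c <= Num.max a b & f b - f a = df c * (b - a).
Proof.
have H (u v : R) : u <= v -> (forall x, u <= x <= v -> is_derive x 1 f (df x)) ->
    exists2 c, u <= c <= v & f v - f u = df c * (v - u).
  move=> uv D.
  have [||c] := @MVT_segment _ f df u v uv.
  - by move=> x; rewrite in_itv/= => /andP[ux xv]; apply: D; rewrite !ltW.
  - apply: derivable_within_continuous => x; rewrite in_itv/= => xuv.
    by have [] := D _ xuv.
  by rewrite in_itv/= => cuv E; exists c.
case: (leP a b) => [ab|/ltW ba] D; first by apply: H.
have [c cuv E] := H _ _ ba D; exists c => //.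
by rewrite -opprB E -mulrN opprB.
Qed.

Lemma rV_norm_coord n (x : 'rV[R]_n) i : `|x ord0 i| <= `|x|.
Proof.
by rewrite [leRHS]/Num.norm /= mx_normrE; apply/bigmax_geP; right; exists (ord0, i).
Qed.

Lemma rV_norm_lt n (x : 'rV[R]_n) e : 0 < e ->
  (forall i, `|x ord0 i| < e) -> `|x| < e.
Proof.
move=> e0 H; rewrite [ltLHS]/Num.norm /= mx_normrE; apply/bigmax_ltP; split=> //.
by move=> [i j] _ /=; rewrite ord1.
Qed.

Lemma rV_norm_le n (x : 'rV[R]_n) e : 0 <= e ->
  (forall i, `|x ord0 i| <= e) -> `|x| <= e.
Proof.
move=> e0 H; rewrite [leLHS]/Num.norm /= mx_normrE; apply/bigmax_leP; split=> //.
by move=> [i j] _ /=; rewrite ord1.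
Qed.

(* The segment from y to z is replaced by a path along the coordinate axes,
   which stays in the ball because the norm is the max norm. *)
Lemma partials_close_increment n (f : 'rV[R]_n -> R) (L : 'I_n -> R)
    (x : 'rV[R]_n) (r e : R) :
  (forall y, `|y - x| < r -> forall i, derivable f y (delta_mx 0 i) /\
     `|'D_(delta_mx 0 i) f y - L i| <= e) ->
  forall y z, `|y - x| < r -> `|z - x| < r ->
    `|f z - f y - \sum_i (z ord0 i - y ord0 i) * L i|
      <= e * \sum_i `|z ord0 i - y ord0 i|.
Proof.
move=> Hf y z yr zr.
have r0 : 0 < r by rewrite (le_lt_trans _ yr).
pose w (k : nat) : 'rV[R]_n := \row_j (if (j < k)%N then z ord0 j else y ord0 j).
have w0 : w 0%N = y by apply/rowP => j; rewrite mxE ltn0.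
have wn : w n = z by apply/rowP => j; rewrite mxE ltn_ord.
suff H k : (k <= n)%N ->
    `|f (w k) - f y - \sum_(i < n | (i < k)%N) (z ord0 i - y ord0 i) * L i|
      <= e * \sum_(i < n | (i < k)%N) `|z ord0 i - y ord0 i|.
  have := H n (leqnn n); rewrite wn.
  by under eq_bigl do rewrite ltn_ord; under [in leRHS]eq_bigl do rewrite ltn_ord.
elim: k => [_|k IH kn].
  by rewrite w0 subrr !big1 ?subrr ?normr0 ?mulr0// => i; rewrite ltn0.
pose ok : 'I_n := Ordinal kn.
have wS : w k.+1 = (z ord0 ok - y ord0 ok) *: delta_mx 0 ok + w k.
  apply/rowP => j; rewrite !mxE eqxx /= ltnS.
  have [->|jk] := eqVneq j ok; first by rewrite leqnn ltnn mulr1 subrK.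
  rewrite mulr0 add0r leq_eqVlt.
  by have /negPf -> : (j : nat) != k by apply: contra jk => /eqP jk; apply/eqP/val_inj.
have ball s : Num.min 0 (z ord0 ok - y ord0 ok) <= s <= Num.max 0 (z ord0 ok - y ord0 ok) ->
    `|s *: delta_mx 0 ok + w k - x| < r.
  move=> hs; apply: rV_norm_lt => // j; rewrite !mxE eqxx /=.
  have yj := le_lt_trans (rV_norm_coord (y - x) j) yr.
  have zj := le_lt_trans (rV_norm_coord (z - x) j) zr.
  rewrite !mxE in yj zj.
  have [jk|jk] := eqVneq j ok; last by rewrite mulr0 add0r; case: ifP.
  subst j; rewrite ltnn mulr1.
  move: hs yj zj; rewrite !ltr_norml.
  case: (leP 0 (z ord0 ok - y ord0 ok)) => h0 /andP[h1 h2] /andP[h3 h4] /andP[h5 h6];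
    apply/andP; split; lra.
have [c cin Ec] := @MVT_unordered (fun s => f (s *: delta_mx 0 ok + w k))
  (fun s => 'D_(delta_mx 0 ok) f (s *: delta_mx 0 ok + w k)) 0 (z ord0 ok - y ord0 ok)
  (fun s hs => is_derive_line (Hf _ (ball s hs) ok).1).
have [_ Dc] := Hf _ (ball c cin) ok.
rewrite scale0r add0r -wS subr0 in Ec.
have kbig (F : 'I_n -> R) : \sum_(i < n | (i < k.+1)%N) F i =
    F ok + \sum_(i < n | (i < k)%N) F i.
  rewrite (bigD1 ok) /=; last exact: leqnn.
  congr (_ + _); apply: eq_bigl => i.
  rewrite ltnS [RHS]ltn_neqAle andbC; congr (_ && _).
rewrite !kbig mulrDr.
have -> : f (w k.+1) - f y - ((z ord0 ok - y ord0 ok) * L ok +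
     \sum_(i < n | (i < k)%N) (z ord0 i - y ord0 i) * L i) =
   ('D_(delta_mx 0 ok) f (c *: delta_mx 0 ok + w k) - L ok) * (z ord0 ok - y ord0 ok) +
   (f (w k) - f y - \sum_(i < n | (i < k)%N) (z ord0 i - y ord0 i) * L i).
  rewrite -(subrK (f (w k)) (f (w k.+1))) Ec; ring.
apply: le_trans (ler_normD _ _) _; apply: lerD; last exact/IH/ltnW.
by rewrite normrM ler_wpM2r.
Qed.

(** Continuity is asked at [y] alone; together with existence of the partial derivatives nearby this
    already gives strict differentiability at [y]. *)
Definition C1_at n (f : 'rV[R]_n -> R) (y : 'rV[R]_n) : Prop :=
  (\forall z \near y, forall i, derivable f z (delta_mx 0 i)) /\
  forall i, {for y, continuous ('D_(delta_mx 0 i) f)}.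

(** This is strict differentiability: both endpoints vary near [y]. The chain rule fixes one of them
    at [y]; the contraction estimate in [level_set_tangent] moves both. *)
Lemma C1_at_increment n (f : 'rV[R]_n -> R) y (e : R) : C1_at f y -> 0 < e ->
  exists2 r, 0 < r & forall a b, `|a - y| < r -> `|b - y| < r ->
    `|f b - f a - \sum_i (b ord0 i - a ord0 i) * 'D_(delta_mx 0 i) f y|
      <= e * \sum_i `|b ord0 i - a ord0 i|.
Proof.
move=> [fd fc] e0.
have : \forall z \near y, forall i, derivable f z (delta_mx 0 i) /\
     `|'D_(delta_mx 0 i) f z - 'D_(delta_mx 0 i) f y| <= e.
  have fce : \forall z \near y, forall i, `|'D_(delta_mx 0 i) f z - 'D_(delta_mx 0 i) f y| <= e.
    have H i : \forall z \near y, `|'D_(delta_mx 0 i) f z - 'D_(delta_mx 0 i) f y| <= e.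
      by have /cvgrPdist_le/(_ _ e0) := fc i; apply: filterS => z; rewrite distrC.
    exact: near_ord H.
  near=> z => i; split; first by move: i; near: z.
  by move: i; near: z.
move=> /nbhs_normP[r /= r0 Hr]; exists r => // a b ay byr.
by apply: (partials_close_increment (x := y) (r := r)) => // z zr i; apply: Hr;
  rewrite /ball_/= distrC.
Unshelve. all: by end_near. Qed.

(** The inner maps are only known along one direction [v], so the outer function is compared with
    its linear part at the displaced point; strict differentiability bounds the error by a small
    multiple of the difference quotients of the inner maps. *)
Lemma is_derive_comp (V : normedModType R) m (f : 'rV[R]_m -> R)
    (Phi : 'I_m -> V -> R) (x v : V) (dPhi : 'I_m -> R) :
  (forall j, is_derive x v (Phi j) (dPhi j)) ->
  C1_at f (\row_j Phi j x) ->
  is_derive x v (fun z => f (\row_j Phi j z))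
    (\sum_j dPhi j * 'D_(delta_mx 0 j) f (\row_j Phi j x)).
Proof.
move=> dP f1; set y := \row_j Phi j x; set l := \sum_j _.
pose q j (h : R) := h^-1 *: (Phi j (h *: v + x) - Phi j x).
have qc j : q j h @[h --> 0^'] --> dPhi j.
  by have [/cvg_ex[/= d Hd] <-] := dP j; rewrite /derive (cvg_lim _ Hd).
have Pc j : Phi j (h *: v + x) @[h --> 0^'] --> Phi j x.
  have E : \forall h \near 0^', h * q j h + Phi j x = Phi j (h *: v + x).
    near=> h; rewrite /q /GRing.scale /= mulrA divff ?mul1r ?subrK//.
    by near: h; exact: nbhs_dnbhs_neq.
  apply: cvg_trans (near_eq_cvg E) _.
  have -> : nbhs (Phi j x) = nbhs (0 * dPhi j + Phi j x) by rewrite mul0r add0r.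
  by apply: cvgD (cvg_cst _); apply: cvgM (qc j); exact: cvg_within.
suff lim : h^-1 *: (f (\row_j Phi j (h *: v + x)) - f y) @[h --> 0^'] --> l.
  by split; [apply/cvg_ex; exists l | exact: cvg_lim lim].
(* Near 0 the sum of the absolute difference quotients stays below [C]: the added 1 absorbs the
   distance to the limit and keeps [C] positive. *)
pose C := \sum_j `|dPhi j| + 1.
have C0 : 0 < C by rewrite ltr_wpDl ?sumr_ge0.
have sq : \sum_j q j h * 'D_(delta_mx 0 j) f y @[h --> 0^'] --> l.
  by apply: cvg_bigsum => j; apply: cvgMr_tmp; exact: qc.
have sa : \sum_j `|q j h| @[h --> 0^'] --> \sum_j `|dPhi j|.
  by apply: cvg_bigsum => j; apply: cvg_norm; exact: qc.
apply/cvgrPdist_le => e e0.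
have [r r0 Hr] := C1_at_increment f1 (divr_gt0 (divr_gt0 e0 (ltr0n _ 2)) C0).
have small : \forall h \near 0^', forall j, `|Phi j (h *: v + x) - Phi j x| < r.
  have H j : \forall h \near 0^', `|Phi j (h *: v + x) - Phi j x| < r.
    by have /cvgrPdist_lt/(_ _ r0) := Pc j; apply: filterS => h; rewrite distrC.
  exact: near_ord H.
near=> h.
have h0 : h != 0 by near: h; exact: nbhs_dnbhs_neq.
have hs j : `|Phi j (h *: v + x) - Phi j x| < r by move: j; near: h.
have := Hr y (\row_j Phi j (h *: v + x)).
rewrite subrr normr0 => /(_ r0) H.
have {}H : `|f (\row_j Phi j (h *: v + x)) - f y -
      \sum_i (Phi i (h *: v + x) - Phi i x) * 'D_(delta_mx 0 i) f y| <=
      e / 2 / C * (\sum_i `|Phi i (h *: v + x) - Phi i x|).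
  have := H _; under eq_bigr do rewrite !mxE; under [in leRHS]eq_bigr do rewrite !mxE.
  by apply; apply: rV_norm_lt => // j; rewrite !mxE.
have {}H : `|h^-1 *: (f (\row_j Phi j (h *: v + x)) - f y) -
    \sum_j q j h * 'D_(delta_mx 0 j) f y| <= e / 2 / C * \sum_j `|q j h|.
  have -> : h^-1 *: (f (\row_j Phi j (h *: v + x)) - f y) -
    \sum_j q j h * 'D_(delta_mx 0 j) f y = h^-1 * (f (\row_j Phi j (h *: v + x)) - f y -
      \sum_i (Phi i (h *: v + x) - Phi i x) * 'D_(delta_mx 0 i) f y).
    rewrite mulrBr mulr_sumr; congr (_ - _).
    by apply: eq_bigr => j _; rewrite mulrA.
  have -> : \sum_j `|q j h| = `|h^-1| * \sum_i `|Phi i (h *: v + x) - Phi i x|.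
    by rewrite mulr_sumr; apply: eq_bigr => j _; rewrite normrM.
  by rewrite normrM mulrCA ler_wpM2l.
have A : \sum_j `|q j h| <= C.
  near: h; have /cvgrPdist_le/(_ _ ltr01) := sa.
  apply: filterS => h; rewrite distrC ler_norml => /andP[_].
  by rewrite lerBlDl.
have B : `|l - \sum_j q j h * 'D_(delta_mx 0 j) f y| <= e / 2.
  by near: h; have /cvgrPdist_le/(_ _ (divr_gt0 e0 (ltr0n _ 2))) := sq.
rewrite -(subrK (\sum_j q j h * 'D_(delta_mx 0 j) f y) l) -addrA.
apply: le_trans (ler_normD _ _) _.
rewrite [leRHS]splitr lerD// distrC (le_trans H)//.
rewrite -[leRHS](divfK (lt0r_neq0 C0)) ler_wpM2l//.
by rewrite !divr_ge0// ltW.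
Unshelve. all: by end_near. Qed.

Lemma is_derive_coord n (x v : 'rV[R]_n) j :
  is_derive x v (fun z : 'rV[R]_n => z ord0 j) (v ord0 j).
Proof.
have lim : h^-1 *: ((h *: v + x) ord0 j - x ord0 j) @[h --> (0 : R)^'] --> v ord0 j.
  have Eq : \forall h \near (0 : R)^', v ord0 j = h^-1 *: ((h *: v + x) ord0 j - x ord0 j).
    near=> h; rewrite !mxE addrK /GRing.scale /= mulrA mulVf ?mul1r//.
    by near: h; exact: nbhs_dnbhs_neq.
  exact: cvg_trans (near_eq_cvg Eq) (cvg_cst _).
by split; [apply: cvgP lim | exact: cvg_lim lim].
Unshelve. all: by end_near. Qed.

Lemma is_derive_C1 n (f : 'rV[R]_n -> R) (x v : 'rV[R]_n) : C1_at f x ->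
  is_derive x v f (\sum_j v ord0 j * 'D_(delta_mx 0 j) f x).
Proof.
move=> f1; have E (z : 'rV[R]_n) : \row_j z ord0 j = z by apply/rowP => j; rewrite mxE.
have := @is_derive_comp _ n f (fun j (z : 'rV[R]_n) => z ord0 j) x v (fun j => v ord0 j).
by rewrite E; under eq_fun do rewrite E; apply => // j; exact: is_derive_coord.
Qed.

End Calculus.

(** * Functions of class C^k: locality, sums, products, inverses, composition *)

Section Ck.
Context {R : realType}.
Implicit Types (n m k : nat).

Lemma row_continuous (T : topologicalType) m (Phi : 'I_m -> T -> R) (x : T) :
  (forall j, {for x, continuous (Phi j)}) ->
  (fun z => \row_j Phi j z) @ x --> (\row_j Phi j x : 'rV[R]_m).
Proof.
move=> H; apply/cvgrPdist_lt => e e0.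
have Hj j : \forall z \near x, `|Phi j x - Phi j z| < e.
  by have /cvgrPdist_lt := H j; apply.
have Hj' := near_ord _ Hj.
near=> z; apply: rV_norm_lt => // i; rewrite !mxE.
by move: i; near: z; exact: Hj'.
Unshelve. all: by end_near. Qed.

Lemma continuous_at_dist (T : topologicalType) (f : T -> R) (x : T) :
  (forall e, 0 < e -> \forall z \near x, `|f x - f z| <= e) -> {for x, continuous f}.
Proof. by move=> H; apply/cvgrPdist_le. Qed.

Lemma open_near_eq (T : topologicalType) (S : Type) (U : set T) (f g : T -> S) x :
  open U -> (forall z, U z -> f z = g z) -> U x -> \forall z \near x, f z = g z.
Proof. by move=> Uo fg Ux; apply: filterS fg _; exact: open_nbhs_nbhs. Qed.

Lemma near_eq_continuous (T S : topologicalType) (f g : T -> S) x :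
  (\forall z \near x, f z = g z) -> {for x, continuous f} -> {for x, continuous g}.
Proof.
move=> fg fc; rewrite /prop_for /continuous_at -(nbhs_singleton fg).
by apply: cvg_trans fc; apply: near_eq_cvg; apply: filterS fg => z ->.
Qed.

Lemma Ck_ext n k (U : set 'rV[R]_n) (f g : 'rV[R]_n -> R) :
  open U -> (forall x, U x -> f x = g x) -> Ck k U f -> Ck k U g.
Proof.
move=> Uo; elim: k f g => [|k IH] f g fg [fc fk]; split => //.
- by move=> x Ux; exact: near_eq_continuous (open_near_eq Uo fg Ux) (fc x Ux).
- by move=> x Ux; exact: near_eq_continuous (open_near_eq Uo fg Ux) (fc x Ux).
move=> i; have [fd fk'] := fk i; split.
  by move=> x Ux; exact: near_eq_derivable (open_near_eq Uo fg Ux) (fd x Ux).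
apply: IH fk' => x Ux; exact: near_eq_derive (open_near_eq Uo fg Ux).
Qed.

Lemma Ck_sub n k (U V : set 'rV[R]_n) (f : 'rV[R]_n -> R) :
  V `<=` U -> Ck k U f -> Ck k V f.
Proof.
move=> VU; elim: k f => [|k IH] f [fc fk]; first by split=> // x /VU/fc.
split=> [x /VU/fc//|i].
by have [fd fk'] := fk i; split => [x /VU/fd//|]; exact: IH.
Qed.

Lemma Ck_local n k (U : set 'rV[R]_n) (f : 'rV[R]_n -> R) :
  (forall x, U x -> exists2 V, V x & Ck k V f) -> Ck k U f.
Proof.
elim: k f => [|k IH] f H; split => //.
- by move=> x /H[V Vx [fc _]]; exact: fc.
- by move=> x /H[V Vx [fc _]]; exact: fc.
move=> i; split; first by move=> x /H[V Vx [_ /(_ i)[fd _]]]; exact: fd.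
by apply: IH => x /H[V Vx [_ /(_ i)[_ fk]]]; exists V.
Qed.

Lemma CkW n k (U : set 'rV[R]_n) (f : 'rV[R]_n -> R) : Ck k.+1 U f -> Ck k U f.
Proof.
elim: k f => [|k IH] f [fc fk]; split=> // i.
by have [fd fk'] := fk i; split=> //; exact: IH.
Qed.

Lemma Ck_continuous n k (U : set 'rV[R]_n) (f : 'rV[R]_n -> R) x :
  Ck k U f -> U x -> {for x, continuous f}.
Proof. by case: k => [|k] [fc _]; exact: fc. Qed.

Lemma CkS_derivable n k (U : set 'rV[R]_n) (f : 'rV[R]_n -> R) x i :
  Ck k.+1 U f -> U x -> derivable f x (delta_mx 0 i).
Proof. by move=> [_ fk] Ux; apply: (fk i).1. Qed.

Lemma CkS_derive n k (U : set 'rV[R]_n) (f : 'rV[R]_n -> R) i :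
  Ck k.+1 U f -> Ck k U ('D_(delta_mx 0 i) f).
Proof. by move=> [_ fk]; apply: (fk i).2. Qed.

Lemma Ck_cst n k (U : set 'rV[R]_n) (a : R) : Ck k U (fun=> a).
Proof.
elim: k a => [|k IH] a; split=> //; try by move=> x _; exact: cst_continuous.
move=> i; split; first by move=> x _; exact: derivable_cst.
by under eq_fun do rewrite derive_cst; exact: IH.
Qed.

Lemma Ck_coord n k (U : set 'rV[R]_n) (j : 'I_n) : Ck k U (fun y => y ord0 j).
Proof.
case: k => [|k]; split=> //; try by move=> x _; exact: coord_continuous.
move=> i; split => [x _|]; first by have [] := is_derive_coord x (delta_mx 0 i) j.
under eq_fun do rewrite (@derive_val _ _ _ _ _ _ _ (is_derive_coord _ (delta_mx 0 i) j)).
exact: Ck_cst.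
Qed.

Lemma CkD n k (U : set 'rV[R]_n) (f g : 'rV[R]_n -> R) : open U ->
  Ck k U f -> Ck k U g -> Ck k U (fun x => f x + g x).
Proof.
move=> Uo; elim: k f g => [|k IH] f g [fc fk] [gc gk]; split=> //.
- by move=> x Ux; exact: cvgD (fc x Ux) (gc x Ux).
- by move=> x Ux; exact: cvgD (fc x Ux) (gc x Ux).
move=> i; have [fd fk'] := fk i; have [gd gk'] := gk i; split.
  by move=> x Ux; exact: derivableD (fd x Ux) (gd x Ux).
apply: Ck_ext Uo _ (IH _ _ fk' gk') => x Ux.
by rewrite [RHS]deriveD//; [exact: fd|exact: gd].
Qed.

Lemma CkM n k (U : set 'rV[R]_n) (f g : 'rV[R]_n -> R) : open U ->
  Ck k U f -> Ck k U g -> Ck k U (fun x => f x * g x).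
Proof.
move=> Uo; elim: k f g => [|k IH] f g fS gS.
  have [fc _] := fS; have [gc _] := gS.
  by split=> // x Ux; exact: cvgM (fc x Ux) (gc x Ux).
have [fc fk] := fS; have [gc gk] := gS.
split; first by move=> x Ux; exact: cvgM (fc x Ux) (gc x Ux).
move=> i; have [fd fk'] := fk i; have [gd gk'] := gk i; split.
  by move=> x Ux; exact: derivableM (fd x Ux) (gd x Ux).
apply: Ck_ext Uo _ (CkD Uo (IH _ _ (CkW fS) gk') (IH _ _ (CkW gS) fk')) => x Ux.
by rewrite [RHS]deriveM//; [exact: fd|exact: gd].
Qed.

Lemma Ck_sum n k (U : set 'rV[R]_n) p (f : 'I_p -> 'rV[R]_n -> R) : open U ->
  (forall i, Ck k U (f i)) -> Ck k U (fun x => \sum_i f i x).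
Proof.
move=> Uo; elim: p f => [|p IH] f H.
  by under eq_fun do rewrite big_ord0; exact: Ck_cst.
by under eq_fun do rewrite big_ord_recl; apply: CkD => //; exact: IH.
Qed.

Lemma Ck_inv n k (U : set 'rV[R]_n) (f : 'rV[R]_n -> R) : open U ->
  (forall x, U x -> f x != 0) -> Ck k U f -> Ck k U (fun x => (f x)^-1).
Proof.
move=> Uo f0; elim: k => [|k IH] fS.
  by have [fc _] := fS; split=> // x Ux; apply: cvgV (fc x Ux); exact: f0.
have [fc fk] := fS; have fV := IH (CkW fS).
split; first by move=> x Ux; apply: cvgV (fc x Ux); exact: f0.
move=> i; have [fd fk'] := fk i; split.
  by move=> x Ux; apply: derivableV; [exact: f0|exact: fd].
apply: Ck_ext Uo _ (CkM Uo (CkM Uo (Ck_cst _ _ (-1)) (CkM Uo fV fV)) fk') => x Ux.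
rewrite deriveV; [|exact: f0|exact: fd].
by rewrite /GRing.scale /= mulN1r -invfM expr2.
Qed.

Lemma Ck_C1_at n k (U : set 'rV[R]_n) (f : 'rV[R]_n -> R) x : open U ->
  Ck k.+1 U f -> U x -> C1_at f x.
Proof.
move=> Uo [fc fk] Ux; split.
  apply: (@filterS _ (nbhs x) _ U); last exact: open_nbhs_nbhs.
  by move=> z Uz i; exact: (fk i).1.
by move=> i; case: k fk => [|k] fk; have [_ []] := fk i; move=> /(_ x Ux).
Qed.

Lemma Ck_comp n m k (U : set 'rV[R]_n) (V : set 'rV[R]_m) (f : 'rV[R]_m -> R)
    (Phi : 'I_m -> 'rV[R]_n -> R) : open U -> open V ->
  (forall j, Ck k U (Phi j)) -> Ck k V f ->
  (forall x, U x -> V (\row_j Phi j x)) ->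
  Ck k U (fun z => f (\row_j Phi j z)).
Proof.
move=> Uo Vo; elim: k f => [|k IH] f PS fS UV.
  have [fc _] := fS; split=> // x Ux.
  apply: continuous_comp; last by apply: fc; exact: UV.
  by apply: row_continuous => j; have [+ _] := PS j; apply.
have cont : forall x, U x -> {for x, continuous (fun z => f (\row_j Phi j z))}.
  have [fc _] := fS; move=> x Ux.
  apply: continuous_comp; last by apply: fc; exact: UV.
  by apply: row_continuous => j; have [+ _] := PS j; apply.
have D x i : U x -> is_derive x (delta_mx 0 i) (fun z => f (\row_j Phi j z))
    (\sum_j 'D_(delta_mx 0 i) (Phi j) x * 'D_(delta_mx 0 j) f (\row_j Phi j x)).
  move=> Ux; apply: is_derive_comp; last exact: Ck_C1_at Vo fS (UV _ Ux).
  by move=> j; apply: derivableP; exact: (CkS_derivable (PS j)).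
split=> // i; split; first by move=> x Ux; have [] := D x i Ux.
apply: (Ck_ext (f := fun x => \sum_j 'D_(delta_mx 0 i) (Phi j) x *
  'D_(delta_mx 0 j) f (\row_j Phi j x)) Uo) => [x Ux|]; last apply: (Ck_sum Uo) => j.
  by rewrite (@derive_val _ _ _ _ _ _ _ (D x i Ux)).
apply: (CkM Uo); first exact: (CkS_derive i (PS j)).
by apply: (IH ('D_(delta_mx 0 j) f)) => // [j'|]; [exact: CkW|exact: (CkS_derive j fS)].
Qed.

End Ck.

(** * Flat functions and cut-offs *)

Section Bump.
Context {R : realType}.
Implicit Types (n m k : nat).

(** The powers of 1/t are carried along because the family is then closed under differentiation: the
    derivative of t^-m e^(-1/t) is t^-(m+2) e^(-1/t) - m t^-(m+1) e^(-1/t). *)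
Definition flat_exp m (t : R) : R := if 0 < t then (t^-1) ^+ m * expR (- t^-1) else 0.

Lemma flat_exp_ge0 m t : 0 <= flat_exp m t.
Proof.
rewrite /flat_exp; case: ifPn => // t0.
by rewrite mulr_ge0 ?expR_ge0// exprn_ge0// invr_ge0 ltW.
Qed.

Lemma flat_exp_gt0 m t : 0 < t -> 0 < flat_exp m t.
Proof. by move=> t0; rewrite /flat_exp t0 mulr_gt0 ?expR_gt0// exprn_gt0// invr_gt0. Qed.

Lemma flat_exp_le0 m t : t <= 0 -> flat_exp m t = 0.
Proof. by move=> t0; rewrite /flat_exp ltNge t0. Qed.

(** With u = 1 / ((m+1) t) one has u < e^u, hence u^(m+1) <= e^(1/t). A linear bound is what
    differentiability at 0 requires. *)
Lemma flat_exp_le m t : 0 < t -> flat_exp m t <= (m.+1%:R ^+ m.+1) * t.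
Proof.
move=> t0; rewrite /flat_exp t0.
have u0 : 0 < (m.+1%:R * t)^-1 by rewrite invr_gt0 mulr_gt0.
have : ((m.+1%:R * t)^-1) ^+ m.+1 <= expR (t^-1).
  have -> : t^-1 = m.+1%:R * (m.+1%:R * t)^-1.
    by rewrite invfM mulrA mulfV ?mul1r// pnatr_eq0.
  rewrite expRM_natl ler_pXn2r ?nnegrE ?expR_ge0 ?ltW//.
  by rewrite (le_lt_trans _ (expR_gt1Dx _)) ?lerDr ?gt_eqF.
move=> H.
rewrite expRN -(@ler_pM2r _ (expR t^-1)) ?expR_gt0// mulfVK ?gt_eqF ?expR_gt0//.
apply: (@le_trans _ _ ((m.+1%:R ^+ m.+1 * t) * ((m.+1%:R * t)^-1) ^+ m.+1)).
  have a0 : m.+1%:R ^+ m.+1 != 0 :> R by rewrite expf_neq0// pnatr_eq0.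
  rewrite invfM exprMn [t^-1 ^+ m.+1]exprSr [m.+1%:R^-1 ^+ _]exprVn mulrACA mulfV// mul1r mulrCA.
  by rewrite mulfV ?gt_eqF// mulr1.
by rewrite ler_wpM2l// mulr_ge0// ltW.
Qed.

Lemma is_derive_lineE (V : normedModType R) (f : V -> R) (x v : V) (d : R) :
  is_derive x v f d <-> is_derive (0 : R) (1 : R) (fun s : R => f (s *: v + x)) d.
Proof.
have E : (fun h : R => h^-1 *: (f (h *: v + x) - f x)) =
  (fun h : R => h^-1 *: (f ((h *: (1 : R) + 0) *: v + x) - f (0 *: v + x))).
  by apply/funext => h; rewrite addr0 scale0r add0r [h *: 1]mulr1.
by split=> -[D1 D2]; split; move: D1 D2; rewrite /derivable /derive E.
Qed.

Lemma is_derive_comp_R (V : normedModType R) (g : R -> R) (h : V -> R) (x v : V) (a b : R) :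
  is_derive (h x) 1 g a -> is_derive x v h b ->
  is_derive x v (fun z => g (h z)) (a * b).
Proof.
move=> dg /is_derive_lineE dh; apply/is_derive_lineE.
by apply: is_derive1_comp; rewrite scale0r add0r.
Qed.

Lemma is_derive_flat_exp m (t : R) :
  is_derive t 1 (flat_exp m) (flat_exp m.+2 t - m%:R * flat_exp m.+1 t).
Proof.
have [t0|t0|<-] := ltgtP 0 t.
- apply: (@near_eq_is_derive _ _ _ (fun t : R => (t^-1) ^+ m * expR (- t^-1))).
    near=> z; rewrite /flat_exp ifT//; near: z; exact: lt_nbhsr.
  have tn0 : t != 0 by rewrite gt_eqF.
  have dV : is_derive t 1 (fun t : R => t^-1) (- (t^-1) ^+ 2).
    split; first exact: derivableV.
    by rewrite deriveV// derive_id exprVn [_ *: _]mulr1.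
  have dN : is_derive t 1 (fun t : R => - t^-1) ((t^-1) ^+ 2).
    by have := is_deriveN dV; rewrite opprK.
  have dE : is_derive t 1 (fun t : R => expR (- t^-1)) (expR (- t^-1) * (t^-1) ^+ 2).
    exact: (is_derive_comp_R (is_derive_expR _) dN).
  have dX : is_derive t 1 (fun t : R => t^-1 ^+ m) ((m%:R * t^-1 ^+ m.-1) * - (t^-1) ^+ 2).
    apply: (is_derive_comp_R (g := fun y : R => y ^+ m)) dV.
    have := @is_deriveX _ _ id m t^-1 1 1 (is_derive_id _ _).
    have E : (id ^+ m : R -> R) = (fun y => y ^+ m) by apply: funext => y; rewrite exprfctE.
    by rewrite E [_ *: _]mulr1.
  have := is_deriveM dX dE.
  rewrite /flat_exp t0 => H; apply: is_derive_eq H _.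
  rewrite /GRing.scale /=; case: m {dX} => [|m] /=; first by rewrite !mul0r expr0; ring.
  by rewrite !exprS; ring.
- apply: (@near_eq_is_derive _ _ _ (fun=> 0)).
    near=> z; rewrite flat_exp_le0// ltW//; near: z; exact: lt_nbhsl.
  by rewrite !flat_exp_le0 ?ltW// mulr0 subr0; exact: is_derive_cst.
rewrite !flat_exp_le0// mulr0 subr0.
suff lim : h^-1 *: (flat_exp m (h *: 1 + 0) - flat_exp m 0) @[h --> (0 : R)^'] --> (0 : R).
  by split; [apply: cvgP lim | exact: cvg_lim lim].
apply/cvgrPdist_le => e e0.
(* The constant of [flat_exp_le] for the exponent m + 1: the difference quotient of [flat_exp m] at
   0 is [flat_exp m.+1]. *)
pose C : R := m.+2%:R ^+ m.+2.
have C0 : 0 < C by rewrite exprn_gt0.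
near=> h.
have h0 : h != 0 by near: h; exact: nbhs_dnbhs_neq.
rewrite addr0 [h *: 1]mulr1 (@flat_exp_le0 _ 0)// subr0 sub0r normrN.
have he : `|h| <= e / C.
  by near: h; apply: dnbhs0_le; rewrite divr_gt0.
have [hp|hn] := ltP 0 h; last by rewrite flat_exp_le0// scaler0 normr0 ltW.
have -> : h^-1 *: flat_exp m h = flat_exp m.+1 h.
  by rewrite /flat_exp hp exprS -mulrA.
rewrite ger0_norm ?flat_exp_ge0// (le_trans (flat_exp_le _ hp))//.
by rewrite -/C mulrC -ler_pdivlMr// (le_trans _ he)// ler_norm.
Unshelve. all: by end_near. Qed.

Lemma Ck_flat_exp n k (U : set 'rV[R]_n) (h : 'rV[R]_n -> R) m : open U ->
  Ck k U h -> Ck k U (fun x => flat_exp m (h x)).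
Proof.
move=> Uo; have cont : forall m, continuous (flat_exp m).
  move=> p t; apply: differentiable_continuous; apply/derivable1_diffP.
  by have [] := is_derive_flat_exp p t.
elim: k m => [|k IH] m hS.
  have [hc _] := hS; split=> // x Ux.
  by apply: continuous_comp; [exact: hc|exact: cont].
have [hc hk] := hS.
split; first by move=> x Ux; apply: continuous_comp; [exact: hc|exact: cont].
have D x i : U x -> is_derive x (delta_mx 0 i) (fun x => flat_exp m (h x))
    ((flat_exp m.+2 (h x) - m%:R * flat_exp m.+1 (h x)) * 'D_(delta_mx 0 i) h x).
  move=> Ux; apply: is_derive_comp_R; first exact: is_derive_flat_exp.
  by apply: derivableP; exact: CkS_derivable hS Ux.
move=> i; split; first by move=> x Ux; have [] := D x i Ux.
apply: (Ck_ext (f := fun x => (flat_exp m.+2 (h x) + - m%:R * flat_exp m.+1 (h x))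
   * 'D_(delta_mx 0 i) h x) Uo) => [x Ux|].
  by rewrite (@derive_val _ _ _ _ _ _ _ (D x i Ux)) mulNr.
apply: (CkM Uo); last exact: (CkS_derive i hS).
apply: (CkD Uo); first exact: IH (CkW hS).
by apply: (CkM Uo); [exact: Ck_cst|exact: IH (CkW hS)].
Qed.

(** The Euclidean square replaces the norm of row vectors, which is a maximum and in general not
    smooth. *)
Definition sqdist n (p x : 'rV[R]_n) : R := \sum_i (x ord0 i - p ord0 i) ^+ 2.

(** The usual quotient of flat functions, with value 1 up to squared distance e and 0 from 2 e on;
    the two terms of the denominator never vanish together. *)
Definition cutoff n (p : 'rV[R]_n) (e : R) (x : 'rV[R]_n) : R :=
  flat_exp 0 (2 * e - sqdist p x) *
  (flat_exp 0 (2 * e - sqdist p x) + flat_exp 0 (sqdist p x - e))^-1.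

Lemma Ck_sqdist n k (U : set 'rV[R]_n) p : open U -> Ck k U (sqdist p).
Proof.
move=> Uo; apply: (Ck_sum Uo) => i.
have H : Ck k U (fun x => x ord0 i - p ord0 i).
  by apply: (CkD Uo); [exact: Ck_coord|exact: Ck_cst].
exact: CkM.
Qed.

Lemma Ck_cutoff n k (U : set 'rV[R]_n) p e : open U -> 0 < e -> Ck k U (cutoff p e).
Proof.
move=> Uo e0.
have A : Ck k U (fun x => flat_exp 0 (2 * e - sqdist p x)).
  apply: Ck_flat_exp => //; apply: (CkD Uo); first exact: Ck_cst.
  apply: (Ck_ext (f := fun x => -1 * sqdist p x) Uo) => [x _|]; first by rewrite mulN1r.
  by apply: (CkM Uo); [exact: Ck_cst|exact: Ck_sqdist].
have B : Ck k U (fun x => flat_exp 0 (sqdist p x - e)).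
  apply: Ck_flat_exp => //; apply: (CkD Uo); last exact: Ck_cst.
  exact: Ck_sqdist.
apply: (CkM Uo) => //; apply: (Ck_inv Uo); last exact: CkD.
move=> x _; rewrite gt_eqF//.
have [h|h] := ltP e (sqdist p x).
  by rewrite ltr_wpDl ?flat_exp_ge0// flat_exp_gt0// subr_gt0.
by rewrite ltr_wpDr ?flat_exp_ge0// flat_exp_gt0//; lra.
Qed.

Lemma cutoff1 n (p x : 'rV[R]_n) e : 0 < e -> sqdist p x <= e -> cutoff p e x = 1.
Proof.
move=> e0 h; rewrite /cutoff (@flat_exp_le0 _ (_ - e)) ?subr_le0// addr0 divff//.
by rewrite gt_eqF// flat_exp_gt0//; lra.
Qed.

Lemma cutoff0 n (p x : 'rV[R]_n) e : 2 * e <= sqdist p x -> cutoff p e x = 0.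
Proof. by move=> h; rewrite /cutoff flat_exp_le0 ?mul0r// subr_le0. Qed.

Lemma sqdist_small n (p : 'rV[R]_n) (e : R) : 0 < e -> \forall x \near p, sqdist p x <= e.
Proof.
move=> e0; have c : {for p, continuous (sqdist p)}.
  by have [+ _] := Ck_sqdist 0 p (@openT 'rV[R]_n); apply.
have /cvgrPdist_le/(_ _ e0) := c; apply: filterS => x.
have -> : sqdist p p = 0 by rewrite /sqdist big1// => i _; rewrite subrr expr0n.
by rewrite sub0r normrN; apply: le_trans; exact: ler_norm.
Qed.

Lemma sqdist_norm n (p x : 'rV[R]_n) (r : R) : 0 <= r ->
  sqdist p x <= r ^+ 2 -> `|x - p| <= r.
Proof.
move=> r0 h; apply: rV_norm_le => // i; rewrite !mxE.
rewrite -(@ler_pXn2r _ 2)// ?nnegrE// real_normK ?num_real//.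
apply: le_trans h; rewrite /sqdist (bigD1 i)//= lerDl.
by apply: sumr_ge0 => j _; exact: sqr_ge0.
Qed.

End Bump.

(** * Hadamard's lemma on a ball *)

Section Hadamard.
Context {R : realType}.
Implicit Types (n m k : nat).
Local Notation mu := (@lebesgue_measure R).

Definition contract n (p y : 'rV[R]_n) (t : R) : 'rV[R]_n := t *: (y - p) + p.

(** Differentiating along [y] brings a factor t out of [contract], so the weight t^m makes the
    family stable under partial derivatives. Hadamard's coefficients are the case m = 0. *)
Definition radial_avg n m (p : 'rV[R]_n) (h : 'rV[R]_n -> R) (y : 'rV[R]_n) : R :=
  (\int[mu]_(t in `[0%R, 1%R]) (t ^+ m * h (contract p y t)))%R.

Lemma contract_norm n (p y : 'rV[R]_n) t : 0 <= t <= 1 ->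
  `|contract p y t - p| <= `|y - p|.
Proof.
move=> /andP[t0 t1]; rewrite /contract addrK normrZ ger0_norm//.
by rewrite ler_piMl.
Qed.

Lemma ball_bound n (p : 'rV[R]_n) r r' (h : 'rV[R]_n -> R) : r' < r ->
  Ck 0 [set y | `|y - p| < r] h ->
  exists2 M, 0 <= M & forall y, `|y - p| <= r' -> `|h y| <= M.
Proof.
move=> rr [hc _].
pose K := [set y : 'rV[R]_n | `|y - p| <= r'].
have Kc : compact K.
  apply: bounded_closed_compact.
    exists (r' + `|p|); split; first exact: num_real.
    move=> M rM y yK /=; rewrite -(subrK p y) (le_trans (ler_normD _ _))//.
    by rewrite (le_trans _ (ltW rM))// lerD2r.
  have -> : K = (fun y => `|y - p|) @^-1` [set t | t <= r'] by [].
  apply: closed_comp; last exact: closed_le.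
  move=> y _; apply: continuous_comp; last exact: norm_continuous.
  by apply: continuousB; [exact: cvg_id|exact: cst_continuous].
have hK : {within K, continuous h}.
  apply: continuous_in_subspaceT => y; rewrite inE => yK.
  by apply: hc; exact: le_lt_trans rr.
have [M [_ HM]] := compact_bounded (continuous_compact hK Kc).
exists (Num.max 0 (M + 1)); first by rewrite le_max lexx.
move=> y yK; rewrite le_max; apply/orP; right.
by apply: HM; [rewrite ltrDl | exists y].
Qed.

Lemma open_normball n (p : 'rV[R]_n) (r : R) : open [set y : 'rV[R]_n | `|y - p| < r].
Proof.
rewrite (_ : [set y | _] = (fun y => `|y - p|) @^-1` [set t | t < r])//.
apply: open_comp; last exact: open_lt.
move=> y _; apply: continuous_comp; last exact: norm_continuous.
by apply: continuousB; [exact: cvg_id|exact: cst_continuous].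
Qed.

Section avg.
Variables (n : nat) (p : 'rV[R]_n) (r : R).
Local Notation B := [set y : 'rV[R]_n | `|y - p| < r].

Lemma contract_continuous (y : 'rV[R]_n) : continuous (contract p y).
Proof.
move=> t; have c : (fun t : R => t *: (y - p) + p) @ t --> t *: (y - p) + p.
  by apply: cvgD (cvg_cst _); apply: cvgZr_tmp; exact: cvg_id.
exact: c.
Qed.

Lemma avg_integrand_within m h y : Ck 0 B h -> B y ->
  {within `[0%R, 1%R], continuous (fun t => t ^+ m * h (contract p y t))}.
Proof.
move=> [hc _] By; apply: continuous_in_subspaceT => t; rewrite inE/= in_itv/= => t01.
have c1 : (fun t : R => t ^+ m) @ t --> t ^+ m by exact: exprn_continuous.
have c2 : (fun t => h (contract p y t)) @ t --> h (contract p y t).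
  apply: continuous_comp; first exact: contract_continuous.
  by apply: hc; rewrite /= (le_lt_trans (contract_norm _ _ t01)).
exact: cvgM c1 c2.
Qed.

Lemma avg_integrable m h y : Ck 0 B h -> B y ->
  mu.-integrable `[0%R, 1%R] (EFin \o (fun t => t ^+ m * h (contract p y t))).
Proof.
move=> hc By; apply: continuous_compact_integrable; first exact: segment_compact.
exact: avg_integrand_within.
Qed.

Lemma integrable_unit (c : R) : mu.-integrable `[0%R, 1%R] (EFin \o (fun=> c)).
Proof.
apply: continuous_compact_integrable; first exact: segment_compact.
by apply: continuous_subspaceT => x; exact: cst_continuous.
Qed.

Lemma Rintegral_unit (c : R) : (\int[mu]_(t in `[0%R, 1%R]) c)%R = c.
Proof.
by rewrite Rintegral_cst//= lebesgue_measure_itv/= lte_fin ltr01 oppr0 adde0 mulr1.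
Qed.

Lemma avg_bound m h r' M y : r' < r -> Ck 0 B h ->
  (forall z, `|z - p| <= r' -> `|h z| <= M) -> `|y - p| <= r' ->
  `|radial_avg m p h y| <= M.
Proof.
move=> rr hc HM yr.
have By : B y by exact: le_lt_trans rr.
have M0 : 0 <= M by rewrite (le_trans _ (HM _ yr)).
have int := avg_integrable m hc By.
apply: le_trans (le_normr_Rintegral _ int) _ => //.
rewrite -[leRHS]Rintegral_unit; apply: le_Rintegral => //.
- by have := integrable_norm int.
- exact: integrable_unit.
move=> t; rewrite /= in_itv/= => t01.
have /andP[t0 t1] := t01.
rewrite normrM normrX ger0_norm// -[leRHS]mul1r ler_pM//.
- exact: exprn_ge0.
- exact: exprn_ile1.
by apply: HM; rewrite (le_trans (contract_norm _ _ t01)).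
Qed.

Lemma contract_line y i (s t : R) :
  contract p (s *: delta_mx 0 i + y) t = (t * s) *: delta_mx 0 i + contract p y t.
Proof. by rewrite /contract -addrA scalerDr scalerA addrA. Qed.

(** Differentiation under the integral sign along the line through [y], dominated by a bound of the
    partial derivative of [h] on a closed ball. *)
Lemma is_derive_avg m h y i : Ck 1 B h -> B y ->
  is_derive y (delta_mx 0 i) (radial_avg m p h)
    (radial_avg m.+1 p ('D_(delta_mx 0 i) h) y).
Proof.
move=> h1 By; have h0 := CkW h1.
have dh0 := CkS_derive i h1.
(* The midpoint between |y - p| and r: the parameter may move by [e] while everything stays in a
   compact ball inside the domain. *)
pose r' := (r + `|y - p|) / 2.
have rr : r' < r by move: By; rewrite /r' /=; lra.
pose e := (r - `|y - p|) / 2.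
have e0 : 0 < e by move: By; rewrite /e /=; lra.
have [M M0 HM] := ball_bound rr dh0.
have close s : s \in `]-e, e[ -> `|s *: delta_mx 0 i + y - p| <= r'.
  rewrite in_itv/= -ltr_norml => se; rewrite -addrA (le_trans (ler_normD _ _))//.
  have -> : r' = e + `|y - p| by rewrite /r' /e; lra.
  rewrite lerD2r normrZ (le_trans _ (ltW se))// ler_piMr//.
  apply: rV_norm_le => // j; rewrite mxE eqxx /=.
  by case: eqP => _; rewrite ?normr1 ?normr0.
have D s t : s \in `]-e, e[ -> 0 <= t <= 1 ->
    is_derive s 1 (fun s => t ^+ m * h (contract p (s *: delta_mx 0 i + y) t))
     (t ^+ m.+1 * 'D_(delta_mx 0 i) h (contract p (s *: delta_mx 0 i + y) t)).
  move=> se t01.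
  have Bz : B (contract p (s *: delta_mx 0 i + y) t).
    by rewrite /= (le_lt_trans (contract_norm _ _ t01))// (le_lt_trans _ rr)// close.
  rewrite contract_line in Bz *.
  have d1 : derivable h ((t * s) *: delta_mx 0 i + contract p y t) (delta_mx 0 i).
    exact: (CkS_derivable h1 Bz).
  move: d1 => /is_derive_line d1.
  have d2 : is_derive s 1 (fun s : R => t * s) t.
    by have := is_deriveZ t (is_derive_id (s : R) (1 : R)); rewrite [_ *: _]mulr1.
  have d3 := @is_derive1_comp _ (fun u => h (u *: delta_mx 0 i + contract p y t))
    (fun s => t * s) s _ _ d1 d2.
  have d4 := is_deriveZ (t ^+ m) d3.
  apply: is_derive_eq; last first.
    rewrite exprSr -mulrA [t * _]mulrC; reflexivity.
  by under eq_fun do rewrite contract_line.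
pose f s t := t ^+ m * h (contract p (s *: delta_mx 0 i + y) t).
have pE s t : s \in `]-e, e[ -> 0 <= t <= 1 -> partial1of2 f s t =
   t ^+ m.+1 * 'D_(delta_mx 0 i) h (contract p (s *: delta_mx 0 i + y) t).
  move=> se t01; rewrite partial1of2E.
  by rewrite (@derive_val _ _ _ _ _ _ _ (D s t se t01)).
have I0 : (`]-e, e[%classic : set R) 0 by rewrite /= in_itv/= oppr_lt0 e0.
have mI : measurable (`[0%R, 1%R]%classic : set (measurableTypeR R)) by [].
have i1 s : (`]-e, e[%classic : set R) s -> mu.-integrable `[0%R, 1%R] (EFin \o f s).
  by move=> se; apply: avg_integrable => //; rewrite /= (le_lt_trans _ rr)// close.
have i2 s t : (`]-e, e[%classic : set R) s -> (`[0%R, 1%R]%classic : set R) t ->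
    derivable (f ^~ t) s 1.
  by move=> se; rewrite /= in_itv/= => t01; have [] := D s t se t01.
have i3 s t : (`]-e, e[%classic : set R) s -> (`[0%R, 1%R]%classic : set R) t ->
    `|partial1of2 f s t| <= M.
  move=> se; rewrite /= in_itv/= => t01; rewrite pE//.
  have /andP[t0 t1] := t01.
  rewrite normrM normrX ger0_norm// -[leRHS]mul1r ler_pM//.
  - exact: exprn_ge0.
  - exact: exprn_ile1.
  by apply: HM; rewrite (le_trans (contract_norm _ _ t01))// close.
have U := @differentiation_under_integral _ _ _ mu f _ mI 0 (-e) e I0 i1 i2
  (fun=> M) (fun=> M0) (integrable_unit M) i3.
have V := @derivable_under_integral _ _ _ mu f _ mI 0 (-e) e I0 i1 i2
  (fun=> M) (fun=> M0) (integrable_unit M) i3.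
apply/is_derive_lineE; split; first exact: V.
rewrite -derive1E [LHS]U; apply: eq_Rintegral => t.
rewrite inE/= in_itv/= => t01; rewrite pE// ?scale0r ?add0r//.
Qed.

(** A partial derivative of an average is again an average with m raised by one, so the induction on
    k runs over all m and h at once. *)
Lemma Ck_avg k m h : smooth_Rn B h -> Ck k B (radial_avg m p h).
Proof.
elim: k m h => [|k IH] m h hs; last first.
  split.
    by move=> y By; exact: Ck_continuous (IH m h hs) By.
  move=> i; split.
    by move=> y By; have [] := is_derive_avg m i (hs 1%N) By.
  have : Ck k B ('D_(delta_mx 0 i) (radial_avg m p h)); last by [].
  apply: (Ck_ext (f := radial_avg m.+1 p ('D_(delta_mx 0 i) h)) (@open_normball n p r)).
    by move=> y By; rewrite (@derive_val _ _ _ _ _ _ _ (is_derive_avg m i (hs 1%N) By)).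
  by apply: IH => j; exact: (CkS_derive i (hs j.+1)).
(* Continuity comes from the partial derivatives: they exist and are bounded, so
   [partials_close_increment] with L = 0 makes the average Lipschitz. *)
split=> // y By.
pose r' := (r + `|y - p|) / 2.
have rr : r' < r by move: By; rewrite /r' /=; lra.
have yr' : `|y - p| < r' by move: By; rewrite /r' /=; lra.
have /choice[M HM] : forall i : 'I_n, exists M,
    0 <= M /\ forall y, `|y - p| <= r' -> `|'D_(delta_mx 0 i) h y| <= M.
  by move=> i; have [M] := ball_bound rr (CkS_derive i (hs 1%N)); exists M.
pose S := \sum_i M i.
have S0 : 0 <= S by apply: sumr_ge0 => i _; exact: (HM i).1.
have MS i : M i <= S.
  by rewrite /S (bigD1 i)//= lerDl; apply: sumr_ge0 => j _; exact: (HM j).1.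
have inc z : `|z - p| < r' ->
    `|radial_avg m p h z - radial_avg m p h y| <= S * \sum_i `|z ord0 i - y ord0 i|.
  move=> zr.
  have := @partials_close_increment _ _ (radial_avg m p h) (fun=> 0) p r' S _ y z yr' zr.
  under eq_bigr do rewrite mulr0; rewrite big1// subr0; apply.
  move=> w wr i; rewrite subr0.
  have d := is_derive_avg m i (hs 1%N) (lt_trans wr rr).
  split; first by have [] := d.
  rewrite (@derive_val _ _ _ _ _ _ _ d).
  apply: (@avg_bound m.+1 _ r' S w rr (CkS_derive i (hs 1%N)) _ (ltW wr)) => z' zr'.
  by rewrite (le_trans ((HM i).2 _ zr')).
apply: continuous_at_dist => e e0.
pose d := e / (S * n%:R + 1).
have C0 : 0 < S * n%:R + 1 by rewrite ltr_wpDl// mulr_ge0.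
have d0 : 0 < d by rewrite divr_gt0.
near=> z.
have zr : `|z - p| < r'.
  near: z; apply: (@open_nbhs_nbhs _ y [set z | `|z - p| < r']).
  by split => //; exact: open_normball.
have zd : `|z - y| <= d.
  apply: ltW; near: z; apply: (@open_nbhs_nbhs _ y [set z | `|z - y| < d]).
  by split; [exact: open_normball | rewrite /= subrr normr0].
rewrite distrC (le_trans (inc z zr))//.
apply: (@le_trans _ _ (S * (n%:R * d))).
  rewrite ler_wpM2l// -[n in n%:R]card_ord mulr_natl -sumr_const ler_sum// => i _.
  by have := rV_norm_coord (z - y) i; rewrite !mxE => /le_trans; apply.
rewrite mulrA /d mulrA ler_pdivrMr// [leRHS]mulrC ler_wpM2r ?(ltW e0)//.
by rewrite lerDl ler01.
Unshelve. all: by end_near. Qed.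

End avg.

(** The difference f y - f p is the integral over [0, 1] of the derivative of t |-> f (p + t (y -
    p)); the ball is star-shaped about p, and the coefficients are the radial averages of the
    partial derivatives. *)
Lemma hadamard n (p : 'rV[R]_n) (r : R) (f : 'rV[R]_n -> R) : 0 < r ->
  smooth_Rn [set y : 'rV[R]_n | `|y - p| < r] f ->
  exists g : 'I_n -> 'rV[R]_n -> R,
    [/\ forall i, smooth_Rn [set y : 'rV[R]_n | `|y - p| < r] (g i),
        forall i, g i p = 'D_(delta_mx 0 i) f p &
        forall y, `|y - p| < r ->
          f y = f p + \sum_i (y ord0 i - p ord0 i) * g i y].
Proof.
move=> r0 fs; exists (fun i => radial_avg 0 p ('D_(delta_mx 0 i) f)).
have ds i : smooth_Rn [set y : 'rV[R]_n | `|y - p| < r] ('D_(delta_mx 0 i) f).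
  by move=> k; exact: (CkS_derive i (fs k.+1)).
split=> [i k|i|y yr]; first exact: Ck_avg.
  rewrite -[RHS]Rintegral_unit; apply: eq_Rintegral => t _.
  by rewrite /contract subrr scaler0 add0r expr0 mul1r.
pose F t := f (contract p y t).
pose F' t := \sum_i (y ord0 i - p ord0 i) * 'D_(delta_mx 0 i) f (contract p y t).
have oB := @open_normball n p r.
have Bt t : 0 <= t <= 1 -> `|contract p y t - p| < r.
  by move=> t01; rewrite (le_lt_trans (contract_norm _ _ t01)).
have dF (t : R) : 0 <= t <= 1 -> is_derive t 1 F (F' t).
  move=> t01; have f1 := Ck_C1_at oB (fs 1%N) (Bt t t01).
  have D := is_derive_C1 (y - p) f1.
  have [D1 D2] := D.
  have := is_derive_line D1; rewrite D2 => H.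
  apply: is_derive_eq H _; rewrite /F'.
  by apply: eq_bigr => i _; rewrite !mxE.
have cDt i (t : R) : 0 <= t <= 1 -> {for t, continuous
    (fun t => (y ord0 i - p ord0 i) * 'D_(delta_mx 0 i) f (contract p y t))}.
  move=> t01; have c : (fun t => 'D_(delta_mx 0 i) f (contract p y t)) @ t -->
      'D_(delta_mx 0 i) f (contract p y t).
    apply: (@continuous_comp _ _ _ (contract p y) ('D_(delta_mx 0 i) f) t);
      first exact: contract_continuous.
    exact: Ck_continuous (ds i 0%N) (Bt t t01).
  exact: cvgMl_tmp c.
have cD i : {within `[0%R, 1%R], continuous
    (fun t => (y ord0 i - p ord0 i) * 'D_(delta_mx 0 i) f (contract p y t))}.
  by apply: continuous_in_subspaceT => t; rewrite inE/= in_itv/= => t01; exact: cDt.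
have cF' : {within `[0%R, 1%R], continuous F'}.
  apply: continuous_in_subspaceT => t; rewrite inE/= in_itv/= => t01.
  have := @cvg_bigsum _ n R (nbhs t) (fun i t => (y ord0 i - p ord0 i) *
    'D_(delta_mx 0 i) f (contract p y t)); apply => i; exact: cDt.
have FTC : (\int[mu]_(t in `[0%R, 1%R]) F' t)%R = F 1 - F 0.
  rewrite /Rintegral (@continuous_FTC2 _ F' F) ?ltr01//.
    split.
    - move=> t; rewrite in_itv/= => /andP[t0 t1].
      by have [] := dF t; rewrite ?(ltW t0) ?(ltW t1).
    - apply: cvg_at_right_filter; apply: differentiable_continuous.
      by apply/derivable1_diffP; have [] := dF 0; rewrite ?lexx ?ler01.
    - apply: cvg_at_left_filter; apply: differentiable_continuous.
      by apply/derivable1_diffP; have [] := dF 1; rewrite ?lexx ?ler01.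
  move=> t; rewrite in_itv/= => /andP[t0 t1].
  have D : is_derive t 1 F (F' t) by apply: dF; rewrite ?(ltW t0) ?(ltW t1).
  by rewrite derive1E (@derive_val _ _ _ _ _ _ _ D).
have E1 : F 1 = f y by rewrite /F /contract scale1r subrK.
have E0 : F 0 = f p by rewrite /F /contract scale0r add0r.
apply/eqP; rewrite addrC -subr_eq -E1 -E0 -FTC; apply/eqP.
have intD i : mu.-integrable `[0%R, 1%R]
    (EFin \o (fun t => (y ord0 i - p ord0 i) * 'D_(delta_mx 0 i) f (contract p y t))).
  by apply: continuous_compact_integrable => //; exact: segment_compact.
rewrite /F'; elim: index_enum => [|i s IH].
  rewrite big_nil; under eq_Rintegral do rewrite big_nil.
  by rewrite Rintegral_unit.
rewrite big_cons; under eq_Rintegral do rewrite big_cons.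
rewrite RintegralD//; last first.
  pose g i (t : R) := (y ord0 i - p ord0 i) * 'D_(delta_mx 0 i) f (contract p y t).
  rewrite (_ : EFin \o _ = (fun t => \sum_(i <- s) (EFin \o g i) t)%E).
    by apply: integrable_sum => // j _; exact: intD.
  by apply/funext => t /=; rewrite sumEFin.
congr (_ + _) => //; rewrite RintegralZl//.
  congr (_ * _); rewrite /radial_avg; apply: eq_Rintegral => t _; by rewrite /= expr0 mul1r.
have := @avg_integrable n p r 0 ('D_(delta_mx 0 i) f) y (ds i 0%N) yr.
congr (mu.-integrable _ _); apply/funext => t /=.
by rewrite expr0 mul1r.
Qed.

End Hadamard.

(** * Tangent vectors to level sets *)

Section Lyusternik.
Context {R : realType}.
Implicit Types (n m k : nat).

HB.instance Definition _ m := NormedModule.copy 'rV[R]_m 'rV[R]_m.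

Lemma contraction_fixpoint m (T : 'rV[R]_m -> 'rV[R]_m) (d : R) : 0 <= d ->
  (forall w, `|w| <= d -> `|T w| <= d) ->
  (forall w w', `|w| <= d -> `|w'| <= d -> `|T w - T w'| <= 2^-1 * `|w - w'|) ->
  exists2 w, `|w| <= d & T w = w.
Proof.
move=> d0 Td Tc; pose U := [set w : 'rV[R]_m | `|w| <= d].
have Tf : set_fun U U T by [].
pose f : {fun U >-> U} := mkfun_fun Tf.
have q0 : (0 : R) <= 2^-1 by rewrite invr_ge0.
have fc : is_contraction f.
  exists (NngNum q0); split; first by rewrite /= invf_lt1// ltr1n.
  by move=> [w w'] [/= Uw Uw']; exact: Tc.
have Uc : closed U.
  have -> : U = (fun y => `|y|) @^-1` [set t | t <= d] by [].
  by apply: closed_comp; [move=> y _; exact: norm_continuous | exact: closed_le].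
have Un : U !=set0 by exists 0; rewrite /U/= normr0.
by have [w Uw wE] := banach_fixed_point fc Uc Un; exists w.
Qed.

Lemma uniform_radius m (P : 'I_m -> R -> Prop) :
  (forall i r r', r' <= r -> P i r -> P i r') ->
  (forall i, exists2 r, 0 < r & P i r) -> exists2 r, 0 < r & forall i, P i r.
Proof.
elim: m P => [|m IH] P mono H; first by exists 1 => // -[].
have [r r0 Hr] := IH (fun i => P (lift ord0 i)) (fun i => mono (lift ord0 i)) (fun i => H (lift
  ord0 i)).
have [s s0 Hs] := H ord0; exists (Num.min r s); first by rewrite lt_min r0.
move=> i; case: (unliftP ord0 i) => [j|] ->.
  by apply: mono (Hr j); rewrite ge_min lexx.
by apply: mono Hs; rewrite ge_min lexx orbT.
Qed.

(* For small t a fixed point of w |-> w - (Phi (p + t v + sum_j w_j V_j) - Phi p)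
   gives a point of the level set at distance o(t) from p + t v. *)
Lemma level_set_tangent N m (p : 'rV[R]_N) (Phi : 'I_m -> 'rV[R]_N -> R)
    (K : 'rV[R]_N -> R) (V : 'I_m -> 'rV[R]_N) (v : 'rV[R]_N) :
  (forall i, C1_at (Phi i) p) -> C1_at K p ->
  (forall i j, \sum_a V j ord0 a * 'D_(delta_mx 0 a) (Phi i) p = (i == j)%:R) ->
  (forall i, \sum_a v ord0 a * 'D_(delta_mx 0 a) (Phi i) p = 0) ->
  (\forall y \near p, (forall i, Phi i y = Phi i p) -> K y = K p) ->
  \sum_a v ord0 a * 'D_(delta_mx 0 a) K p = 0.
Proof.
move=> Phi1 K1 VE vE near0.
pose L (w : 'rV[R]_m) := \sum_j w ord0 j *: V j.
(* [A] bounds the sum of the coordinates of [L w] per unit of |w|, [A'] is the same sum for v, and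
   [B] bounds the derivative of K along [L w] per unit of |w|. *)
pose A := \sum_j \sum_a `|V j ord0 a|.
pose A' := \sum_a `|v ord0 a|.
pose B := \sum_a (\sum_j `|V j ord0 a|) * `|'D_(delta_mx 0 a) K p|.
have A0 : 0 <= A by do 2! apply: sumr_ge0 => ? _.
have A'0 : 0 <= A' by apply: sumr_ge0 => ? _.
have B0 : 0 <= B by apply: sumr_ge0 => a _; rewrite mulr_ge0// sumr_ge0.
have LE w a : (L w) ord0 a = \sum_j w ord0 j * V j ord0 a.
  by rewrite summxE; apply: eq_bigr => j _; rewrite mxE.
have Lcoord w a : `|(L w) ord0 a| <= `|w| * \sum_j `|V j ord0 a|.
  rewrite LE (le_trans (ler_norm_sum _ _ _))// mulr_sumr ler_sum// => j _.
  by rewrite normrM ler_wpM2r// rV_norm_coord.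
have Lsum w : \sum_a `|(L w) ord0 a| <= `|w| * A.
  rewrite /A exchange_big mulr_sumr ler_sum// => a _; exact: Lcoord.
have LB w w' : L (w - w') = L w - L w'.
  by rewrite -sumrB; apply: eq_bigr => j _; rewrite !mxE scalerBl.
have LPhi w i : \sum_a (L w) ord0 a * 'D_(delta_mx 0 a) (Phi i) p = w ord0 i.
  under eq_bigr do rewrite LE mulr_suml.
  rewrite exchange_big /= (bigD1 i)//= [X in _ + X]big1 ?addr0 => [|j ji].
    by under eq_bigr do rewrite -mulrA; rewrite -mulr_sumr VE eqxx mulr1.
  by under eq_bigr do rewrite -mulrA; rewrite -mulr_sumr VE eq_sym (negPf ji) mulr0.
have Lnorm w : `|L w| <= `|w| * A.
  apply: rV_norm_le => [|a]; first by rewrite mulr_ge0.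
  rewrite (le_trans (Lcoord _ _))// ler_wpM2l// /A exchange_big /=.
  by rewrite (bigD1 a)//= lerDl; apply: sumr_ge0 => b _; exact: sumr_ge0.
have vnorm : `|v| <= A'.
  apply: rV_norm_le => // a; rewrite /A' (bigD1 a)//= lerDl; exact: sumr_ge0.
(* Along the level set K is unchanged, while to first order it changes by t times the derivative
   along v, up to errors of size d t (B + 1); d is arbitrary. *)
suff bound d : 0 < d -> `|\sum_a v ord0 a * 'D_(delta_mx 0 a) K p| <= d * (B + 1).
  apply/eqP; rewrite -normr_le0 leNgt; apply/negP => c0.
  set c := `| _ | in c0 bound.
  have B1 : 0 < 2 * (B + 1) by rewrite mulr_gt0// ltr_wpDl.
  have := bound _ (divr_gt0 c0 B1).
  by rewrite invfM mulrA mulfVK ?gt_eqF ?ltr_wpDl// ler_pdivlMr//; lra.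
move=> d0.
(* The first bound makes the fixed point map 1/2-Lipschitz, the second keeps its value at 0 below d
   t / 2; together they preserve the ball of radius d t. *)
pose e := Num.min ((2 * (A + 1))^-1) (d / (2 * (A' + 1))).
have A1 : 0 < A + 1 by rewrite ltr_wpDl.
have A'1 : 0 < A' + 1 by rewrite ltr_wpDl.
have e0 : 0 < e by rewrite lt_min invr_gt0 divr_gt0 ?mulr_gt0.
have eA : e * A <= 2^-1.
  apply: (@le_trans _ _ (e * (A + 1))); first by rewrite ler_wpM2l ?(ltW e0)// lerDl.
  by rewrite -ler_pdivlMr// -invfM ge_min lexx.
have eA' : e * A' <= d / 2.
  apply: (@le_trans _ _ (e * (A' + 1))); first by rewrite ler_wpM2l ?(ltW e0)// lerDl.
  by rewrite -ler_pdivlMr// -mulrA -invfM ge_min lexx orbT.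
have [r r0 Hr] : exists2 r, 0 < r & forall i a b, `|a - p| < r -> `|b - p| < r ->
    `|Phi i b - Phi i a - \sum_c (b ord0 c - a ord0 c) * 'D_(delta_mx 0 c) (Phi i) p|
      <= e * \sum_c `|b ord0 c - a ord0 c|.
  apply: (uniform_radius (P := fun i r => forall a b, `|a - p| < r -> `|b - p| < r ->
    `|Phi i b - Phi i a - \sum_c (b ord0 c - a ord0 c) * 'D_(delta_mx 0 c) (Phi i) p|
      <= e * \sum_c `|b ord0 c - a ord0 c|)).
    by move=> i r r' rr H a b ar br; apply: H; exact: lt_le_trans rr.
  by move=> i; exact: (C1_at_increment (Phi1 i) e0).
have [rK rK0 HK] := C1_at_increment K1 e0.
have [s s0 Hs] : exists2 s, 0 < s & forall y, `|y - p| < s ->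
    (forall i, Phi i y = Phi i p) -> K y = K p.
  move/nbhs_normP: near0 => [s /= s0 Hs]; exists s => // y ys.
  by apply: Hs; rewrite /ball_/= distrC.
pose r1 := Num.min r (Num.min rK s).
have r10 : 0 < r1 by rewrite !lt_min r0 rK0.
pose D := A' + d * A + 1.
have D0 : 0 < D by rewrite ltr_wpDl// addr_ge0// mulr_ge0// ltW.
(* Small enough for [G w] to stay within r1 of p whenever |w| <= d t. *)
pose t := r1 / (2 * D).
have t0 : 0 < t by rewrite divr_gt0// mulr_gt0.
pose G w := t *: v + L w + p.
have GE w : G w - p = t *: v + L w by rewrite /G addrK.
have dt0 : 0 < d * t by rewrite mulr_gt0.
have Gball w : `|w| <= d * t -> `|G w - p| < r1.
  move=> wd; rewrite GE; apply: (@le_lt_trans _ _ (t * (A' + d * A))).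
    rewrite mulrDr (le_trans (ler_normD _ _))// lerD//.
      by rewrite normrZ gtr0_norm// ler_wpM2l// ltW.
    by rewrite (le_trans (Lnorm _))// mulrCA mulrA ler_wpM2r.
  have -> : r1 = t * (2 * D) by rewrite /t divfK// gt_eqF// mulr_gt0.
  by rewrite ltr_pM2l// /D; have := mulr_ge0 (ltW d0) A0; lra.
have Gr w : `|w| <= d * t -> `|G w - p| < r.
  by move=> /Gball; rewrite !lt_min => /andP[].
have pr : `|p - p| < r by rewrite subrr normr0.
pose T (w : 'rV[R]_m) : 'rV[R]_m := \row_i (w ord0 i - (Phi i (G w) - Phi i p)).
have w0d : `|(0 : 'rV[R]_m)| <= d * t by rewrite normr0 ltW.
have Tlip w w' : `|w| <= d * t -> `|w'| <= d * t -> `|T w - T w'| <= 2^-1 * `|w - w'|.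
  move=> wd wd'; apply: rV_norm_le => [|i]; first by rewrite mulr_ge0.
  have := Hr i (G w') (G w) (Gr _ wd') (Gr _ wd).
  have GG a : (G w) ord0 a - (G w') ord0 a = (L (w - w')) ord0 a.
    by rewrite LB /G !mxE; ring.
  under eq_bigr do rewrite GG; under [in leRHS]eq_bigr do rewrite GG.
  rewrite LPhi => H.
  rewrite -[leLHS]normrN !mxE; apply: le_trans (le_trans H _).
    by rewrite !mxE le_eqVlt; apply/orP; left; apply/eqP; congr (`|_|); ring.
  apply: (@le_trans _ _ (e * (`|w - w'| * A))); first by rewrite ler_wpM2l ?(ltW e0)//.
  by rewrite mulrCA mulrC ler_wpM2r.
have T0 : `|T 0| <= 2^-1 * (d * t).
  apply: rV_norm_le => [|i]; first by rewrite mulr_ge0 ?ltW.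
  have := Hr i p (G 0) pr (Gr _ w0d).
  have L0 : L 0 = 0 by rewrite /L big1// => j _; rewrite mxE scale0r.
  have GG a : (G 0) ord0 a - p ord0 a = t * v ord0 a.
    by rewrite /G L0 !mxE; ring.
  under eq_bigr do rewrite GG -mulrA; under [in leRHS]eq_bigr do rewrite GG normrM.
  rewrite -!mulr_sumr vE mulr0 subr0 !mxE sub0r normrN gtr0_norm// => H.
  rewrite (le_trans H)// mulrCA [leRHS](_ : _ = t * (d / 2)); last by field.
  by rewrite ler_wpM2l ?(ltW t0).
have Tin w : `|w| <= d * t -> `|T w| <= d * t.
  move=> wd; rewrite -(subrK (T 0) (T w)) (le_trans (ler_normD _ _))//.
  have := Tlip _ _ wd w0d; rewrite subr0 => H.
  by have := lerD H T0; move=> /le_trans; apply; lra.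
have [w wd Tw] := contraction_fixpoint (ltW dt0) Tin Tlip.
have PhiG i : Phi i (G w) = Phi i p.
  move/rowP: Tw => /(_ i); rewrite mxE => /eqP.
  by rewrite -subr_eq0 addrAC subrr sub0r oppr_eq0 subr_eq0 => /eqP.
have [GrK Gs] : `|G w - p| < rK /\ `|G w - p| < s.
  by have := Gball _ wd; rewrite !lt_min => /and3P[].
have KG := Hs _ Gs PhiG.
have prK : `|p - p| < rK by rewrite subrr normr0.
have := HK p (G w) prK GrK.
rewrite KG subrr sub0r normrN.
have GG a : (G w) ord0 a - p ord0 a = t * v ord0 a + (L w) ord0 a.
  by rewrite /G !mxE; ring.
under eq_bigr do rewrite GG mulrDl -mulrA.
under [in leRHS]eq_bigr do rewrite GG.
rewrite big_split /= -mulr_sumr => H1.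
set c := \sum_a v ord0 a * _ in H1 *.
have H2 : `|\sum_a (L w) ord0 a * 'D_(delta_mx 0 a) K p| <= (d * t) * B.
  rewrite (le_trans (ler_norm_sum _ _ _))// /B mulr_sumr ler_sum// => a _.
  rewrite normrM mulrA ler_wpM2r// (le_trans (Lcoord _ _))// ler_wpM2r//.
  exact: sumr_ge0.
have H3 : \sum_i `|t * v ord0 i + (L w) ord0 i| <= t * A' + (d * t) * A.
  apply: (@le_trans _ _ (\sum_i (`|t * v ord0 i| + `|(L w) ord0 i|))).
    by apply: ler_sum => i _; exact: ler_normD.
  rewrite big_split /= lerD//.
    by rewrite /A' mulr_sumr ler_sum// => a _; rewrite normrM gtr0_norm.
  by rewrite (le_trans (Lsum _))// ler_wpM2r.
have H4 : `|t * c| <= e * (t * A' + d * t * A) + d * t * B.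
  rewrite -(addrK (\sum_a (L w) ord0 a * 'D_(delta_mx 0 a) K p) (t * c)).
  rewrite (le_trans (ler_normB _ _))// lerD// (le_trans H1)//.
  by rewrite ler_wpM2l ?(ltW e0).
rewrite -(ler_pM2l t0); apply: (@le_trans _ _ `|t * c|).
  by rewrite normrM gtr0_norm.
rewrite (le_trans H4)//.
have -> : e * (t * A' + d * t * A) + d * t * B = t * (e * A' + d * (e * A) + d * B) by ring.
rewrite ler_wpM2l ?(ltW t0)//.
have : d * (e * A) <= d * 2^-1 by rewrite ler_wpM2l ?(ltW d0).
by lra.
Qed.

End Lyusternik.

(** * Manifolds and tangent vectors *)

Section Manifolds.
Context {R : realType}.
Local Notation premanifold := (@premanifold R).
Local Notation dim := Defs.dim.
Implicit Types (M N L : premanifold).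

Lemma near_openP (T : topologicalType) (p : T) (P : T -> Prop) :
  (\forall q \near p, P q) -> exists2 U, open U /\ U p & forall q, U q -> P q.
Proof.
move=> E; have : nbhs p P by [].
by rewrite nbhsE => -[U [Uo Up] UP]; exists U.
Qed.

Definition smooth_atlas M : Prop :=
  [/\ hausdorff_space M,
      forall c, atlas c -> is_chart (c : chart M (dim M)),
      forall x : M, exists2 c, atlas c & cdom c x &
      forall c d : chart M (dim M), atlas c -> atlas d -> forall i : 'I_(dim M),
        smooth_Rn (cmap c @` (cdom c `&` cdom d))
                  (fun y => cmap d (cinv c y) ord0 i)].

Lemma manifold_smooth_atlas M : manifold M -> smooth_atlas M.
Proof. by case=> h _ a b c; split. Qed.

Lemma chart_imageE M (c : chart M (dim M)) (U : set M) y : is_chart c ->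
  (cmap c @` (cdom c `&` U)) y <-> (cmap c @` cdom c) y /\ U (cinv c y).
Proof.
move=> [_ _ cK _ _]; split=> [[q [cq Uq] <-]|[[q cq <-]]].
  by split; [exists q | rewrite cK].
by rewrite cK // => Uq; exists q.
Qed.

Lemma open_chart_image M (c : chart M (dim M)) (U : set M) : is_chart c ->
  open U -> open (cmap c @` (cdom c `&` U)).
Proof.
move=> cc Uo; have [_ io cK _ ic] := cc.
rewrite openE => y /(chart_imageE _ _ cc) [cy Uy].
have H : \forall z \near y, (cmap c @` cdom c) z /\ U (cinv c z).
  near=> z; split; near: z; first exact: open_nbhs_nbhs.
  by apply: (ic y cy); exact: open_nbhs_nbhs.
by apply: filterS H => z /(chart_imageE _ _ cc).
Unshelve. all: by end_near. Qed.

Section Functions.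
Variables (M : premanifold).
Hypothesis Ma : smooth_atlas M.

Let chM c : atlas c -> is_chart (c : chart M (dim M)).
Proof. by have [_ + _ _] := Ma; apply. Qed.

Lemma smooth_fun_local (f : M -> R) :
  (forall p : M, exists2 f', smooth_fun f' & \forall q \near p, f q = f' q) -> smooth_fun f.
Proof.
move=> H c ac k; have cc := chM ac.
have [_ _ cK _ _] := cc.
apply: Ck_local => _ [p cp <-]; have [f' sf' E] := H p.
have [U [Uo Up] UE] : exists2 U, open U /\ U p & forall q, U q -> f q = f' q.
  exact: near_openP.
exists (cmap c @` (cdom c `&` U)); first by exists p.
apply: (Ck_ext (f := fun y => f' (cinv c y)) (open_chart_image cc Uo)).
  by move=> y /(chart_imageE _ _ cc) [_ Uy]; rewrite UE.
apply: Ck_sub (sf' c ac k) => y /(chart_imageE _ _ cc) [] //.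
Qed.

(** Multiply by a cut-off in the chart and extend by 0. Smoothness outside the chart rests on the
    Hausdorff property: the compact support of the cut-off is closed in M. *)
Lemma chart_extend (c : chart M (dim M)) (p : M) (W : set 'rV[R]_(dim M))
    (g : 'rV[R]_(dim M) -> R) (V : set M) :
  atlas c -> cdom c p -> open W -> W (cmap c p) -> smooth_Rn W g -> open V -> V p ->
  exists f : M -> R, [/\ smooth_fun f, \forall q \near p, f q = g (cmap c q) &
    forall q : M, ~ V q -> \forall q' \near q, f q' = 0].
Proof.
move=> ac cp Wo Wp sg Vo Vp; have cc := chM ac.
have [co io cK cC ciC] := cc.
pose p' := cmap c p.
pose W' := W `&` (cmap c @` (cdom c `&` V)).
have W'o : open W' by apply: openI => //; exact: open_chart_image.
have W'p : W' p' by split => //; exists p.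
have : nbhs p' W' by exact: open_nbhs_nbhs.
move=> /nbhs_normP[r0 /= r00 Hr0].
pose r := r0 / 2; have rp : 0 < r by rewrite divr_gt0.
(* Chosen so that 2 e = r^2: the support of the cut-off lies in the ball of radius r, which is
   smaller than r0. *)
pose e := r ^+ 2 / 2; have e0 : 0 < e by rewrite divr_gt0// exprn_gt0.
have e2 : 2 * e = r ^+ 2 by rewrite /e; field.
pose K := [set y | sqdist p' y <= 2 * e].
have KW : K `<=` W'.
  move=> y; rewrite /K /= e2 => /(sqdist_norm (ltW rp)) yr.
  by apply: Hr0; rewrite /ball_/= distrC (le_lt_trans yr)// /r; lra.
have sqc : continuous (sqdist p').
  by move=> y; exact: (Ck_continuous (Ck_sqdist 0 p' openT)).
have Kcl : closed K.
  apply: (@closed_comp _ _ (sqdist p') [set t | t <= 2 * e]); last exact: closed_le.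
  by move=> y _; exact: sqc.
have Kc : compact K.
  apply: bounded_closed_compact => //.
  exists (r + `|p'|); split; first exact: num_real.
  move=> b rb y /=; rewrite /K /= e2 => /(sqdist_norm (ltW rp)) yr.
  by rewrite -(subrK p' y) (le_trans (ler_normD _ _))// (le_trans _ (ltW rb))// lerD2r.
pose S := cinv c @` K.
have Sc : closed S.
  apply: compact_closed; first by case: Ma.
  apply: continuous_compact => //; apply: continuous_in_subspaceT => y.
  rewrite inE => /KW [_ [q [cq _] <-]]; apply: ciC; by exists q.
have SE q : S q -> [/\ cdom c q, V q & sqdist p' (cmap c q) <= 2 * e].
  move=> [y Ky <-]; have [_ [q' [cq' Vq'] qE]] := KW _ Ky.
  by rewrite -qE cK //; split=> //; rewrite qE.
pose h y := cutoff p' e y * g y.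
have hs : smooth_Rn setT h.
  move=> k; apply: Ck_local => y _.
  have [yK|yK] := pselect (K y).
    exists W; first by have [] := KW _ yK.
    by apply: (CkM Wo); [exact: Ck_cutoff | exact: sg].
  exists (~` K) => //; have Ko : open (~` K) by rewrite openC.
  apply: (Ck_ext (f := fun=> 0) Ko); last exact: Ck_cst.
  by move=> z /= /negP; rewrite -ltNge => /ltW zK; rewrite /h cutoff0 ?mul0r.
pose f q := if pselect (cdom c q) is left _ then h (cmap c q) else 0.
have f0 q : ~ S q -> f q = 0.
  rewrite /f; case: pselect => // cq Sq; rewrite /h cutoff0 ?mul0r// ltW// ltNge.
  apply/negP => qK; apply: Sq; exists (cmap c q) => //; exact: cK.
have f0near q : ~ S q -> \forall q' \near q, f q' = 0.
  move=> Sq; have So : open (~` S) by rewrite openC.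
  by apply: (@filterS _ (nbhs q) _ (~` S)); [move=> z; exact: f0 | exact: open_nbhs_nbhs].
exists f; split.
- move=> d ad k; have dd := chM ad; have [_ _ dK _ _] := dd.
  apply: Ck_local => _ [q dq <-].
  have [cq|cq] := pselect (cdom c q).
    exists (cmap d @` (cdom d `&` cdom c)); first by exists q.
    have Oo := open_chart_image dd co.
    apply: (Ck_ext (f := fun y => h (\row_j cmap c (cinv d y) ord0 j)) Oo).
      move=> y /(chart_imageE _ _ dd) [_ cy]; rewrite /f; case: pselect => // _.
      by congr h; apply/rowP => j; rewrite mxE.
    apply: (@Ck_comp _ _ _ k _ setT h (fun j y => cmap c (cinv d y) ord0 j)) => //.
      exact: openT.
    move=> j; have [_ _ _ tr] := Ma; exact: tr.
  have Sq : ~ S q by move=> /SE[].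
  have So : open (~` S) by rewrite openC.
  exists (cmap d @` (cdom d `&` ~` S)); first by exists q.
  apply: (Ck_ext (f := fun=> 0) (open_chart_image dd So)); last exact: Ck_cst.
  by move=> y /(chart_imageE _ _ dd) [_ Sy]; rewrite f0.
- have cnear : \forall q \near p, sqdist p' (cmap c q) <= e.
    exact: (cC p cp _ (sqdist_small p' e0)).
  near=> q; rewrite /f; case: pselect => [_|]; last first.
    by case; near: q; exact: open_nbhs_nbhs.
  by rewrite /h cutoff1 ?mul1r//; near: q.
- by move=> q Vq; apply: f0near => /SE[].
Unshelve. all: by end_near. Qed.

(** The function vanishes on a neighbourhood of each point outside [V], so its derivatives vanish
    there too and products with objects defined on [V] extend smoothly by 0. *)
Lemma bump (p : M) (V : set M) : open V -> V p ->
  exists f : M -> R, [/\ smooth_fun f, \forall q \near p, f q = 1 &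
    forall q : M, ~ V q -> \forall q' \near q, f q' = 0].
Proof.
move=> Vo Vp; have [_ _ cov _] := Ma; have [c ac cp] := cov p.
by apply: (@chart_extend c p setT (fun=> 1) V) => //; [exact: openT | move=> k; exact: Ck_cst].
Qed.

Lemma smooth_cst (a : R) : smooth_fun (fun _ : M => a).
Proof. by move=> c ac k; exact: Ck_cst. Qed.

Let imo c : atlas c -> open (cmap (c : chart M (dim M)) @` cdom c).
Proof. by move/chM => []. Qed.

Lemma smoothD (f g : M -> R) : smooth_fun f -> smooth_fun g -> smooth_fun (fun x => f x + g x).
Proof. by move=> sf sg c ac k; apply: (CkD (imo ac)); [exact: sf|exact: sg]. Qed.

Lemma smoothM (f g : M -> R) : smooth_fun f -> smooth_fun g -> smooth_fun (fun x => f x * g x).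
Proof. by move=> sf sg c ac k; apply: (CkM (imo ac)); [exact: sf|exact: sg]. Qed.

Lemma smooth_sum n (f : 'I_n -> M -> R) : (forall i, smooth_fun (f i)) ->
  smooth_fun (fun x => \sum_i f i x).
Proof. by move=> sf c ac k; apply: (Ck_sum (imo ac)) => i; exact: sf. Qed.

Lemma smoothN (f : M -> R) : smooth_fun f -> smooth_fun (fun x => - f x).
Proof.
move=> sf; have -> : (fun x => - f x) = (fun x => -1 * f x).
  by apply/funext => x; rewrite mulN1r.
by apply: smoothM => //; exact: smooth_cst.
Qed.

Lemma smoothB (f g : M -> R) : smooth_fun f -> smooth_fun g -> smooth_fun (fun x => f x - g x).
Proof. by move=> sf sg; apply: smoothD => //; exact: smoothN. Qed.

Lemma smooth_inv (f : M -> R) : (forall x, f x != 0) -> smooth_fun f ->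
  smooth_fun (fun x => (f x)^-1).
Proof. by move=> f0 sf c ac k; apply: (Ck_inv (imo ac)) => //; exact: sf. Qed.

Lemma smooth_continuous (f : M -> R) (p : M) : smooth_fun f -> {for p, continuous f}.
Proof.
move=> sf; have [_ _ cov _] := Ma; have [c ac cp] := cov p.
have [co _ cK cC _] := chM ac.
have H : {for p, continuous (fun q => f (cinv c (cmap c q)))}.
  apply: (@continuous_comp _ _ _ (cmap c) (fun y => f (cinv c y)) p); first exact: cC.
  by apply: (Ck_continuous (sf c ac 0%N)); exists p.
apply: near_eq_continuous H.
by apply: (open_near_eq co) => // q cq; rewrite cK.
Qed.

(** With b a bump function vanishing where f does, f / (f^2 + (1 - b)^2) is smooth everywhere and
    equals 1/f where b = 1. *)
Lemma smooth_inv_near (f : M -> R) (p : M) : smooth_fun f -> f p != 0 ->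
  exists2 f', smooth_fun f' & \forall q \near p, f' q = (f q)^-1.
Proof.
move=> sf fp; pose V := [set q | f q != 0].
have Vo : open V.
  apply: (@open_comp _ _ f [set t | t != 0]); first by move=> q _; exact: smooth_continuous.
  exact: open_neq.
have [b [sb b1 b0]] := bump Vo fp.
pose g q := f q * f q + (1 - b q) * (1 - b q).
have sg : smooth_fun g.
  apply: smoothD; first exact: smoothM.
  by apply: smoothM; apply: smoothB => //; exact: smooth_cst.
have g0 q : g q != 0.
  rewrite gt_eqF// /g -!expr2; have [fq|fq] := eqVneq (f q) 0.
    have /b0/nbhs_singleton -> : ~ V q by rewrite /V /= fq eqxx.
    by rewrite fq subr0 expr0n expr1n add0r.
  by rewrite ltr_wpDr ?sqr_ge0// lt0r sqr_ge0 andbT expf_neq0.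
exists (fun q => f q * (g q)^-1); first by apply: smoothM => //; exact: smooth_inv.
near=> q.
have -> : g q = f q * f q.
  by rewrite /g (_ : b q = 1) ?subrr ?mulr0 ?addr0//; near: q.
rewrite invfM mulrA mulfV ?mul1r//.
by near: q; exact: open_nbhs_nbhs.
Unshelve. all: by end_near. Qed.

End Functions.

End Manifolds.

(** * Smooth maps and products of manifolds *)

Section SmoothMaps.
Context {R : realType}.
Local Notation premanifold := (@premanifold R).
Local Notation dim := Defs.dim.
Implicit Types (M N L : premanifold).

(** For a map smooth on [U] only, such as a local extension of the groupoid multiplication, the
    pull-back is smooth near [p]; [chart_extend] turns its germ into a global smooth function. *)
Lemma smooth_pullback_near M N (U : set M) (phi : M -> N) (f : N -> R) (p : M) :
  smooth_atlas M -> smooth_atlas N -> open U -> smooth_map_on U phi -> U p ->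
  smooth_fun f -> exists2 f', smooth_fun f' & \forall q \near p, f' q = f (phi q).
Proof.
move=> Ma Na Uo [phic phis] Up sf.
have [_ chM covM _] := Ma; have [_ chN covN _] := Na.
have [c ac cp] := covM p; have [d ad dp] := covN (phi p).
have [co _ cK cC _] := chM c ac; have [do_ dio dK dC _] := chN d ad.
have [V [Vo Vp] VE] : exists2 V, open V /\ V p & forall q, V q -> cdom d (phi q) /\ U q /\ cdom c q.
  apply: near_openP; near=> q; repeat split; near: q.
  - by apply: (phic p Up); exact: open_nbhs_nbhs.
  - exact: open_nbhs_nbhs.
  - exact: open_nbhs_nbhs.
pose W := cmap c @` (cdom c `&` V).
have Wo : open W by exact: open_chart_image (chM c ac) Vo.
have Wp : W (cmap c p) by exists p.
have Wsub : W `<=` cmap c @` [set x | [/\ U x, cdom c x & cdom d (phi x)]].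
  by move=> _ [q [cq Vq] <-]; exists q => //; have [? []] := VE q Vq.
have sg : smooth_Rn W (fun y => f (phi (cinv c y))).
  move=> k; apply: (Ck_ext (f := fun y => f (cinv d (\row_j cmap d (phi (cinv c y)) ord0 j))) Wo).
    move=> y Wy; have [q [cq Vq] yE] := Wy.
    rewrite (_ : \row_j _ = cmap d (phi (cinv c y))); last by apply/rowP => j; rewrite mxE.
    by rewrite dK// -yE cK//; have [] := VE q Vq.
  apply: (@Ck_comp _ _ _ k W (cmap d @` cdom d) (fun y => f (cinv d y))
    (fun j y => cmap d (phi (cinv c y)) ord0 j)) => //.
  - by move=> j; apply: (Ck_sub Wsub); exact: phis.
  - exact: sf.
  - move=> y [q [cq Vq] <-]; rewrite cK//.
    by exists (phi q); [have [] := VE q Vq | apply/rowP => j; rewrite mxE].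
have [f' [sf' E _]] := chart_extend Ma ac cp Wo Wp sg openT I.
exists f' => //; near=> q; rewrite (near E q)// cK//.
by near: q; exact: open_nbhs_nbhs.
Unshelve. all: by end_near. Qed.

Lemma smooth_pullback M N (phi : M -> N) (f : N -> R) :
  smooth_atlas M -> smooth_atlas N -> smooth_map phi -> smooth_fun f ->
  smooth_fun (fun q => f (phi q)).
Proof.
move=> Ma Na sp sf; apply: (smooth_fun_local Ma) => p.
have [f' sf' E] := smooth_pullback_near Ma Na openT sp (p := p) I sf.
by exists f' => //; apply: filterS E => q ->.
Qed.

Lemma smooth_map_id M : smooth_atlas M -> smooth_map (fun x : M => x).
Proof.
move=> Ma; split=> [x _|c d ac ad i]; first exact: cvg_id.
have [_ _ _ tr] := Ma; have := tr c d ac ad i.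
congr (smooth_Rn (_ @` _) _).
by apply/seteqP; split => x /= []; [split | move=> _; split].
Qed.

Lemma smooth_map_cst M N (y : N) : smooth_map (fun _ : M => y).
Proof.
split=> [x _|c d ac ad i k]; first exact: cst_continuous.
exact: Ck_cst.
Qed.

Lemma lsubmx_continuous m n : continuous (lsubmx : 'rV[R]_(m + n) -> 'rV[R]_m).
Proof. by move=> x; apply: differentiable_continuous; exact: differentiable_lsubmx. Qed.

Lemma rsubmx_continuous m n : continuous (rsubmx : 'rV[R]_(m + n) -> 'rV[R]_n).
Proof. by move=> x; apply: differentiable_continuous; exact: differentiable_rsubmx. Qed.

Lemma row_mx_continuous (T : topologicalType) m n (f : T -> 'rV[R]_m) (g : T -> 'rV[R]_n) x :
  {for x, continuous f} -> {for x, continuous g} ->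
  {for x, continuous (fun z => row_mx (f z) (g z))}.
Proof.
move=> fc gc.
have E (z : T) : row_mx (f z) (g z) = \row_j (row_mx (f z) (g z)) ord0 j.
  by apply/rowP => j; rewrite [RHS]mxE.
have : (fun z => \row_j (row_mx (f z) (g z)) ord0 j) @ x -->
    (\row_j (row_mx (f x) (g x)) ord0 j : 'rV[R]_(m + n)).
  apply: row_continuous => j; case: (splitP j) => k jk.
    have -> : j = lshift n k by apply/val_inj.
    apply: (@near_eq_continuous _ _ (fun z => f z ord0 k)).
      by apply: nearW => z; rewrite row_mxEl.
    apply: (@continuous_comp _ _ _ f (fun y : 'rV[R]_m => y ord0 k) x) => //.
    exact: coord_continuous.
  have -> : j = rshift m k by apply/val_inj.
  apply: (@near_eq_continuous _ _ (fun z => g z ord0 k)).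
    by apply: nearW => z; rewrite row_mxEr.
  apply: (@continuous_comp _ _ _ g (fun y : 'rV[R]_n => y ord0 k) x) => //.
  exact: coord_continuous.
by rewrite -E; under eq_fun do rewrite -E.
Qed.

Lemma Ck_lsub m n k (U : set 'rV[R]_(m + n)) (V : set 'rV[R]_m) (f : 'rV[R]_m -> R) :
  open U -> open V -> Ck k V f -> (forall y, U y -> V (lsubmx y)) ->
  Ck k U (fun y => f (lsubmx y)).
Proof.
move=> Uo Vo fS UV.
have E (y : 'rV[R]_(m + n)) : lsubmx y = \row_j y ord0 (lshift n j) by apply/rowP => j;
  rewrite !mxE.
apply: (Ck_ext (f := fun y => f (\row_j y ord0 (lshift n j))) Uo) => [y _|]; first by rewrite -E.
apply: (@Ck_comp _ _ _ k U V f (fun j (y : 'rV[R]_(m + n)) => y ord0 (lshift n j))) => //.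
  by move=> j; exact: Ck_coord.
by move=> y Uy; rewrite -E; exact: UV.
Qed.

Lemma Ck_rsub m n k (U : set 'rV[R]_(m + n)) (V : set 'rV[R]_n) (f : 'rV[R]_n -> R) :
  open U -> open V -> Ck k V f -> (forall y, U y -> V (rsubmx y)) ->
  Ck k U (fun y => f (rsubmx y)).
Proof.
move=> Uo Vo fS UV.
have E (y : 'rV[R]_(m + n)) : rsubmx y = \row_j y ord0 (rshift m j) by apply/rowP => j;
  rewrite !mxE.
apply: (Ck_ext (f := fun y => f (\row_j y ord0 (rshift m j))) Uo) => [y _|]; first by rewrite -E.
apply: (@Ck_comp _ _ _ k U V f (fun j (y : 'rV[R]_(m + n)) => y ord0 (rshift m j))) => //.
  by move=> j; exact: Ck_coord.
by move=> y Uy; rewrite -E; exact: UV.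
Qed.

Lemma prod_chart_image M N (c : chart M (dim M)) (d : chart N (dim N)) (U : set M) (V : set N) :
  cmap (prod_chart c d) @` [set p | (cdom c p.1 /\ U p.1) /\ (cdom d p.2 /\ V p.2)] =
  [set y | (cmap c @` (cdom c `&` U)) (lsubmx y) /\ (cmap d @` (cdom d `&` V)) (rsubmx y)].
Proof.
apply/seteqP; split=> y /=.
  move=> [[p q] /= [[cp Up] [dq Vq]] <-]; rewrite row_mxKl row_mxKr.
  by split; [exists p | exists q].
move=> [[p [cp Up] yl] [q [dq Vq] yr]]; exists (p, q) => //=.
by rewrite yl yr hsubmxK.
Qed.

Lemma smooth_map_pair L M N (phi : L -> M) (psi : L -> N) :
  smooth_map phi -> smooth_map psi ->
  smooth_map (fun x : L => (phi x, psi x) : prodman M N).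
Proof.
move=> [phic phis] [psic psis]; split=> [x _|c e ac [d1 [d2 [ad1 ad2 ->]]] i k].
  by apply: cvg_pair; [exact: phic | exact: psic].
rewrite /=; case: (splitP i) => j ij.
  have -> : i = lshift (dim N) j by apply/val_inj.
  have H : Ck k (cmap c @` [set x | [/\ setT x, cdom c x & cdom d1 (phi x)]])
      (fun y => cmap d1 (phi (cinv c y)) ord0 j) by exact: phis.
  have {}H := Ck_sub _ H.
  rewrite (_ : (fun y => _) = (fun y => cmap d1 (phi (cinv c y)) ord0 j)); last first.
    by apply/funext => y; rewrite /= row_mxEl.
  by apply: H => _ [q /= [_ cq [? _]] <-]; exists q.
have -> : i = rshift (dim M) j by apply/val_inj.
have H : Ck k (cmap c @` [set x | [/\ setT x, cdom c x & cdom d2 (psi x)]])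
    (fun y => cmap d2 (psi (cinv c y)) ord0 j) by exact: psis.
have {}H := Ck_sub _ H.
rewrite (_ : (fun y => _) = (fun y => cmap d2 (psi (cinv c y)) ord0 j)); last first.
  by apply/funext => y; rewrite /= row_mxEr.
by apply: H => _ [q /= [_ cq [_ ?]] <-]; exists q.
Qed.

Section product.
Variables M N : premanifold.
Hypotheses (Ma : smooth_atlas M) (Na : smooth_atlas N).

Lemma open_sub_set (U : set 'rV[R]_(dim M)) (V : set 'rV[R]_(dim N)) : open U -> open V ->
  open [set y : 'rV[R]_(dim M + dim N) | U (lsubmx y) /\ V (rsubmx y)].
Proof.
move=> Uo Vo; apply: openI.
  by apply: (@open_comp _ _ lsubmx U) => // y _; exact: lsubmx_continuous.
by apply: (@open_comp _ _ rsubmx V) => // y _; exact: rsubmx_continuous.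
Qed.

Lemma prod_is_chart (c : chart M (dim M)) (d : chart N (dim N)) :
  is_chart c -> is_chart d -> is_chart (M := prodman M N) (prod_chart c d).
Proof.
move=> [co cio cK cC ciC] [do_ dio dK dC diC].
have imE : cmap (prod_chart c d) @` cdom (prod_chart c d) =
    [set y | (cmap c @` cdom c) (lsubmx y) /\ (cmap d @` cdom d) (rsubmx y)].
  have := prod_chart_image c d setT setT; rewrite !setIT => <-.
  by congr (_ @` _); apply/seteqP; split => -[p q] /=; [move=> [? ?] | move=> [[? _] [? _]]].
split.
- by apply: openI; [apply: (@open_comp _ _ fst (cdom c)) | apply: (@open_comp _ _ snd (cdom d))]
  => // p _; [exact: cvg_fst | exact: cvg_snd].
- by rewrite imE; exact: open_sub_set.
- by move=> [p q] /= [cp dq]; rewrite row_mxKl row_mxKr cK// dK.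
- move=> [p q] [/= cp dq]; apply: (@row_mx_continuous _ _ _ (fun z => cmap c z.1) (fun z => cmap
  d z.2)).
    by apply: (@continuous_comp _ _ _ fst (cmap c) (p, q)); [exact: cvg_fst | exact: cC].
  by apply: (@continuous_comp _ _ _ snd (cmap d) (p, q)); [exact: cvg_snd | exact: dC].
- move=> y; rewrite imE => -[/= cy dy].
  have h1 : (fun z : 'rV[R]_(dim M + dim N) => cinv c (lsubmx z)) @ y --> cinv c (lsubmx y).
    by apply: (@continuous_comp _ _ _ lsubmx (cinv c) y); [exact: lsubmx_continuous | exact: ciC].
  have h2 : (fun z : 'rV[R]_(dim M + dim N) => cinv d (rsubmx z)) @ y --> cinv d (rsubmx y).
    by apply: (@continuous_comp _ _ _ rsubmx (cinv d) y); [exact: rsubmx_continuous | exact: diC].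
  exact: cvg_pair h1 h2.
Qed.

Lemma smooth_map_fst : smooth_map (fun p : prodman M N => p.1).
Proof.
have [_ chM _ trM] := Ma; have [_ chN _ _] := Na.
split=> [x _|c e [c1 [c2 [ac1 ac2 ->]]] ae i k]; first exact: cvg_fst.
have [co1 cio1 _ _ _] := chM c1 ac1; have [_ cio2 _ _ _] := chN c2 ac2.
have [eo _ _ _ _] := chM e ae.
have V1o := open_chart_image (chM c1 ac1) eo.
have oo := open_sub_set V1o cio2.
apply: (@Ck_sub _ _ k [set y | (cmap c1 @` (cdom c1 `&` cdom e)) (lsubmx y) /\
   (cmap c2 @` cdom c2) (rsubmx y)]).
  move=> _ [[p q] [_ /= [cp cq] ep] <-] /=; rewrite row_mxKl row_mxKr.
  by split; [exists p | exists q].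
apply: (Ck_lsub oo V1o (trM c1 e ac1 ae i k)) => y; by move=> [].
Qed.

Lemma smooth_map_snd : smooth_map (fun p : prodman M N => p.2).
Proof.
have [_ chM _ _] := Ma; have [_ chN _ trN] := Na.
split=> [x _|c e [c1 [c2 [ac1 ac2 ->]]] ae i k]; first exact: cvg_snd.
have [_ cio1 _ _ _] := chM c1 ac1; have [co2 cio2 _ _ _] := chN c2 ac2.
have [eo _ _ _ _] := chN e ae.
have V1o := open_chart_image (chN c2 ac2) eo.
have oo := open_sub_set cio1 V1o.
apply: (@Ck_sub _ _ k [set y | (cmap c1 @` cdom c1) (lsubmx y) /\
   (cmap c2 @` (cdom c2 `&` cdom e)) (rsubmx y)]).
  move=> _ [[p q] [_ /= [cp cq] ep] <-] /=; rewrite row_mxKl row_mxKr.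
  by split; [exists p | exists q].
apply: (Ck_rsub oo V1o (trN c2 e ac2 ae i k)) => y; by move=> [].
Qed.

Lemma prod_smooth_atlas : smooth_atlas (prodman M N).
Proof.
have [hM chM covM trM] := Ma; have [hN chN covN trN] := Na.
split.
- have c1 (p : M * N) : fst @ p --> p.1 by exact: cvg_fst.
  have c2 (p : M * N) : snd @ p --> p.2 by exact: cvg_snd.
  move=> [p1 p2] [q1 q2] H; congr pair; [apply: hM|apply: hN] => A B Ap Bq.
    have [[z1 z2] [/= zA zB]] := H (fst @^-1` A) (fst @^-1` B) (c1 (p1, p2) A Ap) (c1 (q1,
      q2) B Bq).
    by exists z1.
  have [[z1 z2] [/= zA zB]] := H (snd @^-1` A) (snd @^-1` B) (c2 (p1, p2) A Ap) (c2 (q1, q2) B Bq).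
  by exists z2.
- by move=> c [c1 [c2 [ac1 ac2 ->]]]; apply: prod_is_chart; [exact: chM | exact: chN].
- move=> [p q]; have [c ac cp] := covM p; have [d ad dq] := covN q.
  by exists (prod_chart c d) => //; exists c, d.
move=> c d ac ad i k.
(* Compatibility of product charts is smoothness of the identity, read as the pair of the two
   projections. *)
have := smooth_map_pair smooth_map_fst smooth_map_snd.
have -> : (fun x : prodman M N => (x.1, x.2) : prodman M N) = id.
  by apply/funext => -[].
move=> [_ /(_ c d ac ad i k)].
by apply: Ck_sub => _ [p [cp dp] <-]; exists p.
Qed.

End product.

End SmoothMaps.

(** * Derivations and coordinate frames *)

Section Tangent.
Context {R : realType}.
Local Notation premanifold := (@premanifold R).
Local Notation dim := Defs.dim.
Implicit Types (M N L : premanifold).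

Lemma mkdualE (V : lmodType R) (f : V -> R) (v : V) : linear_form f -> mkdual f v = f v.
Proof.
move=> fl; rewrite /mkdual.
have fP : (f : V -> R^o) \in @linear_forms R V by apply/asboolP.
by rewrite /insubd insubT.
Qed.

Lemma dual_linear (V : lmodType R) (a : dual V) : linear_form (a : V -> R).
Proof. exact/asboolP/dvalP. Qed.

Lemma dual_ext (V : lmodType R) (a b : dual V) : (forall v, a v = b v) -> a = b.
Proof. by move=> H; apply/val_inj/funext. Qed.

Section LinearForm.
Variables (V : lmodType R) (f : V -> R).
Hypothesis fl : linear_form f.
Lemma linear_form0 : f 0 = 0.
Proof. by have := fl (-1) 0 0; rewrite scaleN1r oppr0 add0r mulN1r addNr. Qed.
Lemma linear_formD u v : f (u + v) = f u + f v.
Proof. by move: (fl 1 u v); rewrite scale1r mul1r. Qed.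
Lemma linear_formZ a u : f (a *: u) = a * f u.
Proof. by rewrite -[a *: u]addr0 fl linear_form0 addr0. Qed.
Lemma linear_formN u : f (- u) = - f u.
Proof. by rewrite -scaleN1r linear_formZ mulN1r. Qed.
Lemma linear_formB u v : f (u - v) = f u - f v.
Proof. by rewrite linear_formD linear_formN. Qed.
Lemma linear_form_sum n (g : 'I_n -> V) : f (\sum_i g i) = \sum_i f (g i).
Proof.
elim: n g => [|n IH] g; first by rewrite !big_ord0 linear_form0.
by rewrite !big_ord_recl linear_formD IH.
Qed.
End LinearForm.

Section derivations.
Variables (M : premanifold).
Hypothesis Ma : smooth_atlas M.

Lemma tangent_derivation (x : M) (v : tangent x) : is_derivation x v.
Proof. by have /asboolP[] := tvalP v. Qed.

Lemma tangent_nonsmooth (x : M) (v : tangent x) f : ~ smooth_fun f -> v f = 0.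
Proof. by have /asboolP[+ _] := tvalP v; apply. Qed.

Lemma tangent_ext (x : M) (v w : tangent x) :
  (forall f, smooth_fun f -> v f = w f) -> v = w.
Proof.
move=> H; apply/val_inj/funext => f; change (v f = w f).
by have [/H//|sf] := pselect (smooth_fun f); rewrite !tangent_nonsmooth.
Qed.

Lemma derivation_ext (x : M) (D D' : (M -> R) -> R) : is_derivation x D ->
  (forall f, smooth_fun f -> D' f = D f) -> is_derivation x D'.
Proof.
move=> [Dl Dm] H; split=> [a f g sf sg|f g sf sg].
  by rewrite !H//; [exact: Dl|apply: (smoothD Ma) => //; apply: (smoothM Ma) => //;
    exact: smooth_cst].
by rewrite !H//; [exact: Dm|exact: (smoothM Ma)].
Qed.

Lemma mktangentE (x : M) D f : is_derivation x D -> smooth_fun f ->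
  (mktangent x D) f = D f.
Proof.
move=> Dd sf; rewrite /mktangent.
set D' := (fun f : M -> R => if `[< smooth_fun f >] then D f else 0).
have D'E g : smooth_fun g -> D' g = D g by move=> sg; rewrite /D' asboolT.
have DP : (D' : (M -> R) -> R^o) \in @derivations R M x.
  apply/asboolP; split; last exact: derivation_ext Dd D'E.
  by move=> g sg; rewrite /D' asboolF.
by rewrite /insubd insubT /= D'E.
Qed.

Section calculus.
Variables (x : M) (D : (M -> R) -> R).
Hypothesis Dd : is_derivation x D.

Lemma derD f g : smooth_fun f -> smooth_fun g -> D (fun y => f y + g y) = D f + D g.
Proof.
move=> sf sg; have [Dl _] := Dd; have := Dl 1 f g sf sg.
by rewrite mul1r => <-; congr D; apply/funext => y; rewrite mul1r.
Qed.

Lemma derM f g : smooth_fun f -> smooth_fun g ->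
  D (fun y => f y * g y) = D f * g x + f x * D g.
Proof. by move=> sf sg; have [_] := Dd; apply. Qed.

Lemma der_cst a : D (fun _ => a) = 0.
Proof.
have s1 := smooth_cst (M := M).
have D1 : D (fun=> 1) = 0.
  have : D (fun=> 1) = D (fun=> 1) * 1 + 1 * D (fun=> 1).
    by rewrite -[RHS](derM (s1 1) (s1 1)); congr D; apply/funext => y; rewrite mulr1.
  by rewrite mulr1 mul1r => /eqP; rewrite -subr_eq subrr eq_sym => /eqP.
have D0 : D (fun=> 0) = 0.
  have : D (fun=> 0) = D (fun=> 0) + D (fun=> 0).
    by rewrite -derD//; congr D; apply/funext => y; rewrite addr0.
  by move=> /eqP; rewrite -subr_eq subrr eq_sym => /eqP.
have [Dl _] := Dd; have E := Dl a _ _ (s1 1) (s1 0).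
transitivity (a * D (fun=> 1) + D (fun=> 0)); last by rewrite D1 D0 mulr0 addr0.
by rewrite -E; congr D; apply/funext => y; rewrite mulr1 addr0.
Qed.

Lemma derZ a f : smooth_fun f -> D (fun y => a * f y) = a * D f.
Proof.
by move=> sf; rewrite derM// ?der_cst ?mul0r ?add0r//; exact: smooth_cst.
Qed.

Lemma derN f : smooth_fun f -> D (fun y => - f y) = - D f.
Proof.
by move=> sf; rewrite -mulN1r -derZ//; congr D; apply/funext => y; rewrite mulN1r.
Qed.

Lemma derB f g : smooth_fun f -> smooth_fun g -> D (fun y => f y - g y) = D f - D g.
Proof. by move=> sf sg; rewrite derD ?derN//; exact: (smoothN Ma). Qed.

Lemma der_sum n (f : 'I_n -> M -> R) : (forall i, smooth_fun (f i)) ->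
  D (fun y => \sum_i f i y) = \sum_i D (f i).
Proof.
elim: n f => [|n IH] f sf.
  by rewrite big_ord0; under eq_fun do rewrite big_ord0; exact: der_cst.
rewrite big_ord_recl; under eq_fun do rewrite big_ord_recl.
by rewrite derD ?IH//; exact: (smooth_sum Ma).
Qed.

Lemma der_local f g : smooth_fun f -> smooth_fun g ->
  (\forall y \near x, f y = g y) -> D f = D g.
Proof.
move=> sf sg E; have [U [Uo Ux] UE] := near_openP E.
have [b [sb b1 b0]] := bump Ma Uo Ux.
apply/eqP; rewrite -subr_eq0 -derB//; apply/eqP.
have sfg : smooth_fun (fun y => f y - g y) by exact: (smoothB Ma).
have s1b : smooth_fun (fun y => 1 - b y) by apply: (smoothB Ma) => //; exact: smooth_cst.
have -> : (fun y => f y - g y) = (fun y => (1 - b y) * (f y - g y)).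
  apply/funext => y; have [/UE ->|Uy] := pselect (U y); first by rewrite subrr mulr0.
  by rewrite (nbhs_singleton (b0 y Uy)) subr0 mul1r.
by rewrite derM// (nbhs_singleton b1) (nbhs_singleton E) !subrr mulr0 mul0r addr0.
Qed.

(** By Hadamard's lemma f = f x + sum_a (X_a - X_a x) G_a near x. A derivation only sees this germ,
    and on each product it leaves D X_a times G_a x, the partial derivative. *)
Lemma der_coordE (c : chart M (dim M)) (X : 'I_(dim M) -> M -> R) f :
  atlas c -> cdom c x -> (forall a, smooth_fun (X a)) ->
  (forall a, \forall q \near x, X a q = cmap c q ord0 a) -> smooth_fun f ->
  D f = \sum_a D (X a) * 'D_(delta_mx 0 a) (fun y => f (cinv c y)) (cmap c x).
Proof.
move=> ac cx sX XE sf.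
have [_ chM _ _] := Ma; have [co cio cK cC ciC] := chM c ac.
have : nbhs (cmap c x) (cmap c @` cdom c) by apply: open_nbhs_nbhs; split => //; exists x.
move=> /nbhs_normP[r /= r0 Hr].
pose B := [set y | `|y - cmap c x| < r].
have BW : B `<=` cmap c @` cdom c.
  by move=> y yr; apply: Hr; rewrite /ball_/= distrC.
have sB : smooth_Rn B (fun y => f (cinv c y)).
  by move=> k; exact: Ck_sub BW (sf c ac k).
have [g [sg gp gE]] := hadamard r0 sB.
have oB : open B by exact: open_normball.
have Bx : B (cmap c x) by rewrite /B/= subrr normr0.
have /choice[G HG] : forall a, exists G : M -> R, smooth_fun G /\ \forall q \near x, G q =
  g a (cmap c q).
  move=> a; have [G [sG GE _]] := chart_extend Ma ac cx oB Bx (sg a) openT I.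
  by exists G.
pose h q := f x + \sum_a (X a q - X a x) * G a q.
have sXa a : smooth_fun (fun q => X a q - X a x).
  by apply: (smoothB Ma) => //; exact: smooth_cst.
have sterm a : smooth_fun (fun q => (X a q - X a x) * G a q).
  by apply: (smoothM Ma) => //; exact: (HG a).1.
have sh : smooth_fun h by apply: (smoothD Ma); [exact: smooth_cst | exact: (smooth_sum Ma)].
have fh : \forall q \near x, f q = h q.
  have HX : \forall q \near x, forall a, X a q = cmap c q ord0 a by apply: near_ord.
  have HGn : \forall q \near x, forall a, G a q = g a (cmap c q).
    by apply: near_ord => a; exact: (HG a).2.
  have Bn : \forall q \near x, B (cmap c q) by apply: (cC x cx); exact: open_nbhs_nbhs.
  near=> q.
  have cq : cdom c q by near: q; exact: open_nbhs_nbhs.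
  have Bq : B (cmap c q) by near: q; exact: Bn.
  have E1 : f q = f (cinv c (cmap c q)) by rewrite cK.
  rewrite E1 (gE _ Bq) (cK _ cx) /h; congr (_ + _); apply: eq_bigr => a _.
  have -> : X a q = cmap c q ord0 a by move: a; near: q; exact: HX.
  have -> : G a q = g a (cmap c q) by move: a; near: q; exact: HGn.
  by rewrite (nbhs_singleton (XE a)).
rewrite (der_local sf sh fh).
have -> : D h = D (fun=> f x) + D (fun q => \sum_a (X a q - X a x) * G a q).
  by apply: derD; [exact: smooth_cst|exact: (smooth_sum Ma)].
rewrite der_cst add0r der_sum//; apply: eq_bigr => a _.
rewrite derM//; last exact: (HG a).1.
rewrite subrr mul0r addr0 derB//; last exact: smooth_cst.
by rewrite der_cst subr0 (nbhs_singleton (HG a).2) gp.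
Unshelve. all: by end_near. Qed.

End calculus.

Lemma coordinates (p : M) : exists (c : chart M (dim M)) (X : 'I_(dim M) -> M -> R),
  [/\ atlas c, cdom c p, forall a, smooth_fun (X a) &
      forall a, \forall q \near p, X a q = cmap c q ord0 a].
Proof.
have [_ chM cov _] := Ma; have [c ac cp] := cov p.
have /choice[X HX] : forall a : 'I_(dim M), exists X : M -> R,
    smooth_fun X /\ \forall q \near p, X q = cmap c q ord0 a.
  move=> a; have [X [sX XE _]] := chart_extend Ma ac cp openT I
    (fun k => Ck_coord k setT a) openT I.
  by exists X.
by exists c, X; split=> // a; have [] := HX a.
Qed.

(* The coordinate vector fields are cut off outside the chart. *)
Lemma coordinate_frame (p : M) (c : chart M (dim M)) (X : 'I_(dim M) -> M -> R) :
  atlas c -> cdom c p -> (forall a, smooth_fun (X a)) ->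
  (forall a, \forall q \near p, X a q = cmap c q ord0 a) ->
  exists d : 'I_(dim M) -> vfield M,
  [/\ forall a, smooth_vf (d a),
      forall a b, \forall q \near p, d a q (X b) = (a == b)%:R &
      \forall q \near p, forall v : tangent q, v = \sum_a v (X a) *: d a q].
Proof.
move=> ac cp sX XE.
have [_ chM _ _] := Ma; have [co cio cK cC ciC] := chM c ac.
have [b [sb b1 b0]] := bump Ma co cp.
pose Dc a f q : R := if pselect (cdom c q) is left _
  then b q * 'D_(delta_mx 0 a) (fun y => f (cinv c y)) (cmap c q) else 0.
have fD f q a : smooth_fun f -> cdom c q ->
    is_derive (cmap c q) (delta_mx 0 a) (fun y => f (cinv c y))
      ('D_(delta_mx 0 a) (fun y => f (cinv c y)) (cmap c q)).
  move=> sf cq; apply: derivableP.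
  by apply: (CkS_derivable (sf c ac 1%N)); exists q.
have DcD a q : is_derivation q (fun f => Dc a f q).
  rewrite /Dc; split=> [r f g sf sg|f g sf sg]; case: pselect => [cq|_]; last 1 first.
  - by rewrite mul0r mulr0 addr0.
  - have d1 := fD f q a sf cq; have d2 := fD g q a sg cq.
    have := is_deriveD (is_deriveZ r d1) d2 => d3.
    rewrite (_ : (fun y => r * f (cinv c y) + g (cinv c y)) =
      (r \*: (fun y => f (cinv c y))) + (fun y => g (cinv c y)))//.
    rewrite (@derive_val _ _ _ _ _ _ _ d3) mulrDr; congr (_ + _).
    by rewrite mulrCA.
  - by rewrite mulr0 addr0.
  have d1 := fD f q a sf cq; have d2 := fD g q a sg cq.
  have d3 := is_deriveM d1 d2.
  rewrite (_ : (fun y => f (cinv c y) * g (cinv c y)) =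
    (fun y => f (cinv c y)) * (fun y => g (cinv c y)))//.
  rewrite (@derive_val _ _ _ _ _ _ _ d3) cK//.
  by rewrite /GRing.scale /=; ring.
pose d a q := mktangent q (fun f => Dc a f q).
have dE a q f : smooth_fun f -> d a q f = Dc a f q by move=> sf; exact: mktangentE.
exists d; split=> //.
- move=> a f sf; apply: (smooth_fun_local Ma) => q.
  have [cq|cq] := pselect (cdom c q).
    have sDf : smooth_Rn (cmap c @` cdom c) ('D_(delta_mx 0 a) (fun y => f (cinv c y))).
      by move=> k; exact: (CkS_derive a (sf c ac k.+1)).
    have Wq : (cmap c @` cdom c) (cmap c q) by exists q.
    have [f' [sf' fE _]] := chart_extend Ma ac cq cio Wq sDf openT I.
    exists (fun z => b z * f' z); first exact: (smoothM Ma).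
    near=> z; rewrite dE// /Dc; case: pselect => [_|[]]; last first.
      by near: z; exact: open_nbhs_nbhs.
    by congr (_ * _); rewrite (near fE z).
  exists (fun=> 0); first exact: smooth_cst.
  have := b0 q cq; apply: filterS => z bz; rewrite dE// /Dc.
  by case: pselect => // _; rewrite bz mul0r.
- move=> a a'; have XE' := near_join (XE a').
  near=> q; rewrite dE// /Dc.
  have cq : cdom c q by near: q; exact: open_nbhs_nbhs.
  case: pselect => // _; have -> : b q = 1 by near: q.
  have XEq : \forall z \near q, X a' z = cmap c z ord0 a' by near: q.
  rewrite mul1r.
  have E : \forall y \near cmap c q, X a' (cinv c y) = y ord0 a'.
    have h1 : \forall y \near cmap c q, X a' (cinv c y) = cmap c (cinv c y) ord0 a'.
      have Wq : (cmap c @` cdom c) (cmap c q) by exists q.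
      have XEq' : nbhs (cinv c (cmap c q)) (fun z => X a' z = cmap c z ord0 a').
        by rewrite cK.
      exact: (ciC _ Wq _ XEq').
    have h2 : \forall y \near cmap c q, (cmap c @` cdom c) y.
      by apply: open_nbhs_nbhs; split => //; exists q.
    near=> y; rewrite (near h1 y)//.
    have [z cz <-] : (cmap c @` cdom c) y by near: y.
    by rewrite cK.
  rewrite (near_eq_derive _ E).
  rewrite (@derive_val _ _ _ _ _ _ _ (is_derive_coord (cmap c q) (delta_mx 0 a) a')).
  by rewrite mxE eqxx /= eq_sym.
(* [der_coordE] at q requires the coordinate functions on a whole neighbourhood of q, whence the
   iterated [near]. *)
- have XE' : \forall q \near p, forall a, \forall z \near q, X a z = cmap c z ord0 a.
    have H a : \forall q \near p, \forall z \near q, X a z = cmap c z ord0 a.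
      exact: near_join (XE a).
    exact: (near_ord _ H).
  near=> q => v; apply: tangent_ext => f sf.
  have cq : cdom c q by near: q; exact: open_nbhs_nbhs.
  rewrite (der_coordE (tangent_derivation v) ac cq sX _ sf); last first.
    by near: q; exact: XE'.
  have sumE (s : seq 'I_(dim M)) : (\sum_(a <- s) v (X a) *: d a q : tangent q) f =
      \sum_(a <- s) v (X a) * d a q f.
    by elim: s => [|a s IH]; rewrite ?big_nil// !big_cons -IH.
  rewrite sumE; apply: eq_bigr => a _; congr (_ * _); rewrite dE// /Dc.
  case: pselect => // _; have -> : b q = 1 by near: q.
  by rewrite mul1r.
Unshelve. all: by end_near. Qed.

Lemma frame (p : M) : exists (X : 'I_(dim M) -> M -> R) (d : 'I_(dim M) -> vfield M),
  [/\ forall a, smooth_fun (X a), forall a, smooth_vf (d a),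
      forall a b, \forall q \near p, d a q (X b) = (a == b)%:R &
      \forall q \near p, forall v : tangent q, v = \sum_a v (X a) *: d a q].
Proof.
have [c [X [ac cp sX XE]]] := coordinates p.
by have [d [sd dX E]] := coordinate_frame ac cp sX XE; exists X, d.
Qed.

End derivations.
End Tangent.

(** * Tangent maps, derivations on products, vector fields *)

Section Tangent2.
Context {R : realType}.
Local Notation premanifold := (@premanifold R).
Local Notation dim := Defs.dim.
Implicit Types (M N L : premanifold).

Lemma push_derivation M N (phi : M -> N) (x : M) (D : (M -> R) -> R) :
  smooth_atlas M -> smooth_atlas N -> smooth_map phi -> is_derivation x D ->
  is_derivation (phi x) (fun f => D (fun y => f (phi y))).
Proof.
move=> Ma Na sp [Dl Dm]; split=> [a f g sf sg|f g sf sg].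
  by apply: Dl; exact: (smooth_pullback Ma Na sp).
by apply: Dm; exact: (smooth_pullback Ma Na sp).
Qed.

Lemma pushE M N (phi : M -> N) (x : M) (v : tangent x) f :
  smooth_atlas M -> smooth_atlas N -> smooth_map phi -> smooth_fun f ->
  push phi v f = v (fun y => f (phi y)).
Proof.
move=> Ma Na sp sf; rewrite /push mktangentE//.
exact: (push_derivation Ma Na sp (tangent_derivation v)).
Qed.

Section slices.
Variables M N : premanifold.
Hypotheses (Ma : smooth_atlas M) (Na : smooth_atlas N).

Lemma smooth_slice1 (K : prodman M N -> R) (q : N) :
  smooth_fun K -> smooth_fun (fun y : M => K (y, q)).
Proof.
have sm := smooth_map_pair (smooth_map_id Ma) (smooth_map_cst M q).
exact: (smooth_pullback Ma (prod_smooth_atlas Ma Na) sm).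
Qed.

Lemma smooth_slice2 (K : prodman M N -> R) (p : M) :
  smooth_fun K -> smooth_fun (fun z : N => K (p, z)).
Proof.
have sm := smooth_map_pair (smooth_map_cst N p) (smooth_map_id Na).
exact: (smooth_pullback Na (prod_smooth_atlas Ma Na) sm).
Qed.

Lemma smooth_fst (f : M -> R) : smooth_fun f -> smooth_fun (fun p : prodman M N => f p.1).
Proof. exact: (smooth_pullback (prod_smooth_atlas Ma Na) Ma (smooth_map_fst Ma Na)). Qed.

Lemma smooth_snd (f : N -> R) : smooth_fun f -> smooth_fun (fun p : prodman M N => f p.2).
Proof. exact: (smooth_pullback (prod_smooth_atlas Ma Na) Na (smooth_map_snd Ma Na)). Qed.

Lemma prod_derivation (p : M) (q : N) D D' : is_derivation p D -> is_derivation q D' ->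
  is_derivation (M := prodman M N) (p, q)
    (fun K => D (fun y => K (y, q)) + D' (fun z => K (p, z))).
Proof.
move=> [Dl Dm] [Dl' Dm']; split=> [a f g sf sg|f g sf sg].
  rewrite (Dl a (fun y => f (y, q)) (fun y => g (y, q))) ?(Dl' a (fun z => f (p,
    z)) (fun z => g (p, z))).
  - by rewrite mulrDr addrACA.
  - exact: smooth_slice2.
  - exact: smooth_slice2.
  - exact: smooth_slice1.
  - exact: smooth_slice1.
rewrite (Dm (fun y => f (y, q)) (fun y => g (y, q))) ?(Dm' (fun z => f (p, z)) (fun z => g (p, z))).
- by rewrite mulrDl mulrDr addrACA.
- exact: smooth_slice2.
- exact: smooth_slice2.
- exact: smooth_slice1.
- exact: smooth_slice1.
Qed.

(** Each product coordinate depends on one factor only, and by [der_coordE] a derivation is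
    determined by its values on coordinates. *)
Lemma prod_derivation_ext (p : M) (q : N) (D D' : (prodman M N -> R) -> R) :
  is_derivation (M := prodman M N) (p, q) D -> is_derivation (M := prodman M N) (p, q) D' ->
  (forall f : M -> R, smooth_fun f -> D (fun z => f z.1) = D' (fun z => f z.1)) ->
  (forall f : N -> R, smooth_fun f -> D (fun z => f z.2) = D' (fun z => f z.2)) ->
  forall K, smooth_fun K -> D K = D' K.
Proof.
move=> Dd Dd' E1 E2 K sK.
have [c [X [ac cp sX XE]]] := coordinates Ma p.
have [d [Y [ad dq sY YE]]] := coordinates Na q.
pose Z (i : 'I_(dim M + dim N)) (z : prodman M N) : R :=
  match fintype.split i with inl a => X a z.1 | inr b => Y b z.2 end.
have sZ i : smooth_fun (Z i).
  by rewrite /Z; case: (fintype.split i) => [a|b]; [exact: smooth_fst | exact: smooth_snd].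
pose e : chart (prodman M N) (dim (prodman M N)) := prod_chart c d.
have ZE i : \forall z \near ((p, q) : prodman M N), Z i z =
  (cmap e z : 'rV[R]_(dim M + dim N)) ord0 i.
  rewrite /Z /=; case: splitP => j ij.
    have -> : i = lshift (dim N) j by apply/val_inj.
    have : \forall z \near ((p, q) : prodman M N), X j z.1 = cmap c z.1 ord0 j.
      by have := XE j; exact: cvg_fst.
    by apply: filterS => z ->; rewrite row_mxEl.
  have -> : i = rshift (dim M) j by apply/val_inj.
  have : \forall z \near ((p, q) : prodman M N), Y j z.2 = cmap d z.2 ord0 j.
    by have := YE j; exact: cvg_snd.
  by apply: filterS => z ->; rewrite row_mxEr.
have PNa := prod_smooth_atlas Ma Na.
have acd : atlas e by exists c, d.
have cdpq : cdom e (p, q) by [].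
rewrite (der_coordE PNa Dd acd cdpq sZ ZE sK) (der_coordE PNa Dd' acd cdpq sZ ZE sK).
apply: eq_bigr => i _; congr (_ * _).
by rewrite /Z; case: (fintype.split i) => [a|b]; [exact: E1 | exact: E2].
Qed.

(** Both sides are derivations at (p, psi p), so they need only be compared on functions of one
    factor. The rule later compares derivatives along the graph with the anchor of P. *)
Lemma graph_rule (psi : M -> N) (p : M) (v : tangent p) (K : prodman M N -> R) :
  smooth_map psi -> smooth_fun K ->
  v (fun y => K (y, psi y)) = v (fun y => K (y, psi p)) + v (fun y => K (p, psi y)).
Proof.
move=> sp sK; have PNa := prod_smooth_atlas Ma Na.
have Dv := tangent_derivation v.
have sg := smooth_map_pair (smooth_map_id Ma) sp.
have D1 := push_derivation Ma PNa sg Dv.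
have D2 := prod_derivation Dv (push_derivation Ma Na sp Dv).
apply: (prod_derivation_ext D1 D2 _ _ sK) => f sf /=.
  by rewrite (der_cst (push_derivation Ma Na sp Dv)) addr0.
by rewrite (der_cst Dv) add0r.
Qed.

End slices.

Section fields.
Variable M : premanifold.
Hypothesis Ma : smooth_atlas M.
Implicit Types (X Y : vfield M).

Lemma lie_derivation X Y (x : M) : smooth_vf X -> smooth_vf Y ->
  is_derivation x (fun f => X x (fun y => Y y f) - Y x (fun y => X y f)).
Proof.
move=> sX sY.
have dX (y : M) := tangent_derivation (X y); have dY (y : M) := tangent_derivation (Y y).
split=> [a f g sf sg|f g sf sg].
  have E (Z : vfield M) : (fun y => Z y (fun z => a * f z + g z)) =
      (fun y => a * Z y f + Z y g).
    by apply/funext => y; have [+ _] := tangent_derivation (Z y); apply.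
  rewrite !E (dX x).1 ?(dY x).1; [ring|exact: sX|exact: sX|exact: sY|exact: sY].
have E (Z : vfield M) : (fun y => Z y (fun z => f z * g z)) =
    (fun y => Z y f * g y + f y * Z y g).
  by apply/funext => y; have [_] := tangent_derivation (Z y); apply.
rewrite !E.
have D (v : tangent x) (a b c d : M -> R) : smooth_fun a -> smooth_fun b ->
    smooth_fun c -> smooth_fun d ->
    v (fun y => a y * b y + c y * d y) = v a * b x + a x * v b + (v c * d x + c x * v d).
  move=> sa sb sc sd; have dv := tangent_derivation v.
  rewrite (derD dv) ?(derM dv)//; exact: (smoothM Ma).
rewrite !D ?sX ?sY//; try exact: sX; try exact: sY.
by ring.
Qed.

Lemma lieE X Y (x : M) f : smooth_vf X -> smooth_vf Y -> smooth_fun f ->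
  lie X Y x f = X x (fun y => Y y f) - Y x (fun y => X y f).
Proof. by move=> sX sY sf; rewrite /lie mktangentE//; exact: lie_derivation. Qed.

Lemma tangent_addE (x : M) (u v : tangent x) f : (u + v) f = u f + v f.
Proof. by []. Qed.
Lemma tangent_scaleE (x : M) (a : R) (v : tangent x) f : (a *: v) f = a * v f.
Proof. by []. Qed.
Lemma tangent0E (x : M) f : (0 : tangent x) f = 0.
Proof. by []. Qed.
Lemma tangent_sumE (x : M) n (v : 'I_n -> tangent x) f :
  (\sum_i v i) f = \sum_i v i f.
Proof.
elim: n v => [|n IH] v; first by rewrite !big_ord0.
by rewrite !big_ord_recl tangent_addE IH.
Qed.

Lemma smooth_vf0 : smooth_vf (fun x : M => 0).
Proof. by move=> f _; exact: smooth_cst. Qed.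

Lemma smooth_vfZ (a : M -> R) X : smooth_fun a -> smooth_vf X ->
  smooth_vf (fun x => a x *: X x).
Proof. by move=> sa sX f sf; exact: (smoothM Ma sa (sX _ sf)). Qed.

Lemma smooth_vf_sum n (X : 'I_n -> vfield M) : (forall i, smooth_vf (X i)) ->
  smooth_vf (fun x => \sum_i X i x).
Proof.
move=> sX f sf; under eq_fun do rewrite tangent_sumE.
exact: (smooth_sum Ma (fun i => sX i _ sf)).
Qed.

Lemma extend_tangent (x : M) (v : tangent x) : exists2 X, smooth_vf X & X x = v.
Proof.
have [X [d [sX sd _ E]]] := frame Ma x.
exists (fun y => \sum_a v (X a) *: d a y).
  by apply: smooth_vf_sum => a; apply: smooth_vfZ => //; exact: smooth_cst.
by rewrite -(nbhs_singleton E).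
Qed.

Lemma extend_vfP (x : M) (v : tangent x) : smooth_vf (extend_vf v) /\ extend_vf v x = v.
Proof.
rewrite /extend_vf /the_or; case: pselect => [h|[]].
  by case: cid => W [].
by have [X sX Xx] := extend_tangent v; exists X.
Qed.

Lemma diff1E (f : M -> R) (x : M) (v : tangent x) : diff1 f x v = v f.
Proof. by rewrite /diff1 mkdualE// => a u w. Qed.

Lemma smooth_cov_diff1 (f : M -> R) : smooth_fun f -> smooth_cov (diff1 f).
Proof. by move=> sf X sX; under eq_fun do rewrite diff1E; exact: sX. Qed.

Lemma smooth_covZ (a : M -> R) (al : covfield M) : smooth_fun a -> smooth_cov al ->
  smooth_cov (fun x => a x *: al x).
Proof. by move=> sa sal X sX; exact: (smoothM Ma sa (sal _ sX)). Qed.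

Lemma smooth_cov0 : smooth_cov (fun x : M => 0).
Proof. by move=> X _; exact: smooth_cst. Qed.

Lemma dual_sumE (V : lmodType R) n (b : 'I_n -> dual V) v : (\sum_i b i) v = \sum_i b i v.
Proof.
elim: n b => [|n IH] b; first by rewrite !big_ord0.
by rewrite !big_ord_recl -IH.
Qed.

End fields.
End Tangent2.

(** * The tangent groupoid *)

Section LevelSets.
Context {R : realType}.
Local Notation premanifold := (@premanifold R).

(** [level_set_tangent] read in a chart; the derivations [E j] dual to the [Psi i] express that Psi
    is a submersion at p. *)
Lemma derivation_level_set (P : premanifold) m (p : P) (Psi : 'I_m -> P -> R) (K : P -> R)
    (D : (P -> R) -> R) (E : 'I_m -> (P -> R) -> R) :
  smooth_atlas P -> (forall i, smooth_fun (Psi i)) -> smooth_fun K ->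
  is_derivation p D -> (forall j, is_derivation p (E j)) ->
  (forall i j, E j (Psi i) = (i == j)%:R) -> (forall i, D (Psi i) = 0) ->
  (\forall q \near p, (forall i, Psi i q = Psi i p) -> K q = K p) ->
  D K = 0.
Proof.
move=> Pa sPsi sK Dd Ed EPsi DPsi near0.
have [c [X [ac cp sX XE]]] := coordinates Pa p.
have [_ chP _ _] := Pa; have [co cio cK cC ciC] := chP c ac.
have Wp : (cmap c @` cdom c) (cmap c p) by exists p.
have C1 f : smooth_fun f -> C1_at (fun y => f (cinv c y)) (cmap c p).
  by move=> sf; exact: Ck_C1_at cio (sf c ac 1%N) Wp.
have DE f D' : is_derivation p D' -> smooth_fun f -> \sum_a (\row_a D' (X a)) ord0 a *
    'D_(delta_mx 0 a) (fun y => f (cinv c y)) (cmap c p) = D' f.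
  move=> Dd' sf; rewrite (der_coordE Pa Dd' ac cp sX XE sf).
  by apply: eq_bigr => a _; rewrite mxE.
rewrite -(DE K D Dd sK).
apply: (@level_set_tangent _ _ m _ (fun i y => Psi i (cinv c y)) _
    (fun j => \row_a E j (X a))).
- by move=> i; exact: C1.
- exact: C1.
- by move=> i j; rewrite (DE _ _ (Ed j) (sPsi i)).
- by move=> i; rewrite (DE _ _ Dd (sPsi i)).
have H : nbhs (cinv c (cmap c p)) (fun q => (forall i, Psi i q = Psi i p) -> K q = K p).
  by rewrite cK.
have := ciC _ Wp _ H; rewrite /= cK//.
Qed.

End LevelSets.

Section Groupoid.
Context {R : realType}.
Variable G : @pregroupoid R.
Hypothesis lG : lie_groupoid G.
Local Notation mul := Defs.mul.
Local Notation inv := Defs.inv.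

Lemma arr_atlas : smooth_atlas (arr G).
Proof. by have [[ma _] _ _ _ _] := lG; exact: manifold_smooth_atlas. Qed.
Lemma obj_atlas : smooth_atlas (obj G).
Proof. by have [[_ mo] _ _ _ _] := lG; exact: manifold_smooth_atlas. Qed.
Local Notation Ga := arr_atlas.
Local Notation Oa := obj_atlas.
Local Notation GGa := (prod_smooth_atlas Ga Ga).

Lemma smooth_map_src : smooth_map (@src R G).
Proof. by have [_ [[]]] := lG. Qed.
Lemma smooth_map_tgt : smooth_map (@tgt R G).
Proof. by have [_ [_ [] ]] := lG. Qed.
Lemma smooth_map_inv : smooth_map (@Defs.inv R G).
Proof. by have [_ []] := lG. Qed.

Lemma smooth_src f : smooth_fun f -> smooth_fun (fun g : arr G => f (src g)).
Proof. exact: (smooth_pullback Ga Oa smooth_map_src). Qed.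
Lemma smooth_tgt f : smooth_fun f -> smooth_fun (fun g : arr G => f (tgt g)).
Proof. exact: (smooth_pullback Ga Oa smooth_map_tgt). Qed.

Lemma mul_extension (g h : arr G) (f : arr G -> R) : src g = tgt h -> smooth_fun f ->
  exists2 F : prodman (arr G) (arr G) -> R, smooth_fun F &
    \forall q \near ((g, h) : prodman (arr G) (arr G)),
      composable q -> F q = f (mul q.1 q.2).
Proof.
move=> gh sf; have [_ [_ _ _ _ sm] _ _ _] := lG.
have [U [Phi [Uo Up sPhi PhiE]]] := sm (g, h) gh.
have [F sF FE] := smooth_pullback_near GGa Ga Uo sPhi Up sf.
exists F => //; near=> q => cq.
have -> : F q = f (Phi q) by near: q.
by rewrite PhiE//; near: q; exact: open_nbhs_nbhs.
Unshelve. all: by end_near. Qed.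

(** Near (g, h) the composable pairs are the zero set of Z_i (src q.1) - Z_i (tgt q.2), Z_i being
    coordinates on the base. Hence a composable pair (v, w) does not see which smooth extension of a
    function on composable pairs is chosen. *)
Lemma composable_vanish (g h : arr G) (v : tangent g) (w : tangent h)
    (K : prodman (arr G) (arr G) -> R) : src g = tgt h ->
  (forall f, smooth_fun f -> v (fun y => f (src y)) = w (fun y => f (tgt y))) ->
  smooth_fun K ->
  (\forall q \near ((g, h) : prodman (arr G) (arr G)), composable q -> K q = 0) ->
  v (fun y => K (y, h)) + w (fun y => K (g, y)) = 0.
Proof.
move=> gh vw sK K0.
have [c [Z [ac cp sZ ZE]]] := coordinates Oa (src g).
have [d [sd dZ dE]] := coordinate_frame Oa ac cp sZ ZE.
have [_ [[_ sub] _ _ _ _] _ _ _] := lG.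
pose Psi i (q : prodman (arr G) (arr G)) := Z i (src q.1) - Z i (tgt q.2).
have s1 i : smooth_fun (fun q : prodman (arr G) (arr G) => Z i (src q.1)).
  exact: (smooth_fst Ga Ga (smooth_src (sZ i))).
have s2 i : smooth_fun (fun q : prodman (arr G) (arr G) => Z i (tgt q.2)).
  exact: (smooth_snd Ga Ga (smooth_tgt (sZ i))).
have sPsi i : smooth_fun (Psi i) by exact: (smoothB GGa (s1 i) (s2 i)).
(* Lifts of the coordinate fields through the submersion src; the pairs (e_j, 0) are dual to the
   equations Psi_i. *)
have /choice[e eE] : forall j, exists u : tangent g, push (@src R G) u = d j (src g).
  by move=> j; exact: sub.
have D1 := prod_derivation Ga Ga (tangent_derivation v) (tangent_derivation w).
have D2 j := prod_derivation Ga Ga (tangent_derivation (e j)) (tangent_derivation (0 : tangent h)).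
apply: (derivation_level_set GGa sPsi sK D1 D2).
- move=> i j; have dv := tangent_derivation (e j).
  transitivity (e j (fun y => Z i (src y) - Z i (tgt h)) + 0 : R); first by [].
  rewrite addr0 (derB Ga dv); [|exact: smooth_src|exact: smooth_cst].
  rewrite (der_cst dv) subr0 -(pushE (e j) Ga Oa smooth_map_src (sZ i)) eE.
  by rewrite (nbhs_singleton (dZ j i)) eq_sym.
- move=> i; have dv := tangent_derivation v; have dw := tangent_derivation w.
  rewrite /Psi /= (derB Ga dv) ?(derB Ga dw) ?(der_cst dv) ?(der_cst dw).
  + by rewrite subr0 sub0r vw ?subrr.
  + exact: smooth_cst.
  + exact: smooth_tgt.
  + exact: smooth_src.
  + exact: smooth_cst.
have [_ chO _ _] := Oa; have [co _ cK _ _] := chO c ac.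
have src_near (P : obj G -> Prop) : (\forall x \near src g, P x) ->
    \forall q \near ((g, h) : prodman (arr G) (arr G)), P (src q.1).
  move=> HP; have [cs _] := smooth_map_src.
  have : \forall y \near g, P (src y) by exact: (cs g I _ HP).
  by exact: cvg_fst.
have tgt_near (P : obj G -> Prop) : (\forall x \near tgt h, P x) ->
    \forall q \near ((g, h) : prodman (arr G) (arr G)), P (tgt q.2).
  move=> HP; have [cs _] := smooth_map_tgt.
  have : \forall y \near h, P (tgt y) by exact: (cs h I _ HP).
  by exact: cvg_snd.
have good : \forall x \near src g, cdom c x /\ forall i, Z i x = cmap c x ord0 i.
  near=> x; split; first by near: x; exact: open_nbhs_nbhs.
  by near: x; exact: (near_ord _ ZE).
have good' : \forall x \near tgt h, cdom c x /\ forall i, Z i x = cmap c x ord0 i.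
  by rewrite -gh.
near=> q => Pq.
have [cs Zs] : cdom c (src q.1) /\ forall i, Z i (src q.1) = cmap c (src q.1) ord0 i.
  by near: q; exact: (src_near _ good).
have [ct Zt] : cdom c (tgt q.2) /\ forall i, Z i (tgt q.2) = cmap c (tgt q.2) ord0 i.
  by near: q; exact: (tgt_near _ good').
have comp : composable q.
  rewrite /composable /= -(cK _ cs) -(cK _ ct); congr (cinv c _); apply/rowP => i.
  rewrite -Zs -Zt; have := Pq i; rewrite /Psi /= gh subrr => /eqP.
  by rewrite subr_eq0 => /eqP.
have -> : K q = 0 by move: comp; near: q; exact: K0.
by rewrite (nbhs_singleton K0).
Unshelve. all: by end_near. Qed.

(** Tm(v, w) is evaluated on f through a chosen smooth extension of f o m. [composable_vanish] makes
    the choice irrelevant, and linearity and the Leibniz rule follow because sums and products of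
    extensions are extensions. *)
Lemma tangent_mul_exists (g h : arr G) (v : tangent g) (w : tangent h) : src g = tgt h ->
  (forall f, smooth_fun f -> v (fun y => f (src y)) = w (fun y => f (tgt y))) ->
  exists z : tangent (mul g h), tangent_mul v w z.
Proof.
move=> gh vw.
pose isF f (F : prodman (arr G) (arr G) -> R) := smooth_fun F /\
  \forall q \near ((g, h) : prodman (arr G) (arr G)), composable q -> F q = f (mul q.1 q.2).
pose D0 (F : prodman (arr G) (arr G) -> R) := v (fun y => F (y, h)) + w (fun y => F (g, y)).
have D0d := prod_derivation Ga Ga (tangent_derivation v) (tangent_derivation w).
have wd f F F' : isF f F -> isF f F' -> D0 F = D0 F'.
  move=> [sF FE] [sF' FE']; apply/eqP; rewrite -subr_eq0.
  have -> : D0 F - D0 F' = D0 (fun q => F q - F' q) by exact: (esym (derB GGa D0d sF sF')).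
  apply/eqP; apply: (composable_vanish gh vw (smoothB GGa sF sF')).
  by near=> q => cq; rewrite (near FE q)// (near FE' q)// subrr.
pose ext f := the_or (fun=> 0) (isF f).
have extP f : smooth_fun f -> isF f (ext f).
  move=> sf; rewrite /ext /the_or; case: pselect => [H|[]]; first by case: cid.
  by have [F sF FE] := mul_extension gh sf; exists F.
have Dd : is_derivation (mul g h) (fun f => D0 (ext f)).
  split=> [a f f' sf sf'|f f' sf sf'].
    have [e1 e1E] := extP f sf; have [e2 e2E] := extP f' sf'.
    rewrite (wd (fun y => a * f y + f' y) _ (fun q => a * ext f q + ext f' q)).
    - by have [+ _] := D0d; apply.
    - by apply: extP; apply: (smoothD Ga) => //; apply: (smoothM Ga) => //; exact: smooth_cst.
    split; first by apply: (smoothD GGa) => //; apply: (smoothM GGa) => //; exact: smooth_cst.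
    by near=> q => cq; rewrite (near e1E q)// (near e2E q).
  have [e1 e1E] := extP f sf; have [e2 e2E] := extP f' sf'.
  rewrite (wd (fun y => f y * f' y) _ (fun q => ext f q * ext f' q)).
  - have [_ Dm] := D0d; apply: etrans (Dm _ _ e1 e2) _.
    by rewrite -(nbhs_singleton e1E gh) -(nbhs_singleton e2E gh).
  - by apply: extP; exact: (smoothM Ga).
  split; first exact: (smoothM GGa).
  by near=> q => cq; rewrite (near e1E q)// (near e2E q).
exists (mktangent (mul g h) (fun f => D0 (ext f))); split=> // f F sf sF FE.
by rewrite (mktangentE Ga Dd sf); apply: (wd f); [exact: extP | split].
Unshelve. all: by end_near. Qed.

Lemma tangent_mul_unique (g h k : arr G) (v : tangent g) (w : tangent h) (z z' : tangent k) :
  tangent_mul v w z -> tangent_mul v w z' -> z = z'.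
Proof.
move=> [gh _ _ zE] [_ _ _ zE']; apply: tangent_ext => f sf.
have [F sF FE] := mul_extension gh sf.
by rewrite (zE f F)// (zE' f F).
Qed.

End Groupoid.

(** * Courant algebroids and Manin triples *)

Section Bundles.
Context {R : realType}.
Variables (M : @premanifold R) (V : prebundle M).
Hypotheses (Ma : smooth_atlas M) (Vb : vector_bundle V).
Implicit Types s e : section V.

Lemma smooth_sec_sum n (c : 'I_n -> M -> R) (e : 'I_n -> section V) :
  (forall i, smooth_fun (c i)) -> (forall i, smooth_sec (e i)) ->
  smooth_sec (fun x => \sum_i c i x *: e i x).
Proof. by move=> sc se; apply: Vb.2 => p; exists n, e, c; split=> //; exact: nearW. Qed.

Lemma smooth_sec_ext s e : (forall x, s x = e x) -> smooth_sec s -> smooth_sec e.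
Proof. by move=> H; rewrite (functional_extensionality_dep H : s = e). Qed.

Lemma smooth_secD s e : smooth_sec s -> smooth_sec e -> smooth_sec (fun x => s x + e x).
Proof.
move=> ss se; pose t (i : 'I_2) := if i == ord0 then s else e.
apply: (smooth_sec_ext (s := fun x => \sum_(i < 2) 1 *: t i x)).
  by move=> x; rewrite !big_ord_recl big_ord0 /= !scale1r addr0.
apply: (smooth_sec_sum (c := fun=> fun=> 1)) => i; first exact: smooth_cst.
by rewrite /t; case: ifP.
Qed.

Lemma smooth_secZ (c : M -> R) s : smooth_fun c -> smooth_sec s ->
  smooth_sec (fun x => c x *: s x).
Proof.
move=> sc ss; apply: (smooth_sec_ext (s := fun x => \sum_(i < 1) c x *: s x)).
  by move=> x; rewrite big_ord1.
exact: (smooth_sec_sum (c := fun=> c) (e := fun=> s)).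
Qed.

Lemma smooth_sec0 : smooth_sec (fun x => 0 : V x).
Proof.
apply: (smooth_sec_ext (s := fun x => \sum_(i < 0) (0 : R) *: (0 : V x))).
  by move=> x; rewrite big_ord0.
by apply: (smooth_sec_sum (c := fun=> fun=> 0) (e := fun=> fun x => 0 : V x)) => -[].
Qed.

Lemma extend_vector (p : M) (v : V p) : exists2 s, smooth_sec s & s p = v.
Proof.
have [r [e [se eb _]]] := Vb.1 p.
have [_ span] := nbhs_singleton eb.
have : [set: V p] v by [].
rewrite span => -[c ->].
exists (fun x => \sum_i (fun=> c i) x *: e i x) => //.
by apply: smooth_sec_sum => // i; exact: smooth_cst.
Qed.

End Bundles.

Section Courant.
Context {R : realType}.
Variables (M : @premanifold R) (E : precourant M).
Hypotheses (Ma : smooth_atlas M) (EC : courant_algebroid E).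
Implicit Types e s : section E.

(** On isotropic families this is skew-symmetric and tensorial. chi, the Jacobiator of pi and the
    Lie derivative of pi along u^r are all read off from it. *)
Definition courant3 e1 e2 e3 (x : M) : R := pairing (bracket e1 e2 x) (e3 x).
Local Notation Y := courant3.
Local Notation ip e1 e2 := (fun x : M => pairing (e1 x) (e2 x) : R).

Lemma courant_bundle : vector_bundle E.
Proof. by case: EC. Qed.
Lemma pairing_linear x (e : E x) : linear_form (pairing e).
Proof. by have [_ [+ _ _ _] _ _ _] := EC; apply. Qed.
Lemma pairingC x (e e' : E x) : pairing e e' = pairing e' e.
Proof. by have [_ [_ + _ _] _ _ _] := EC; apply. Qed.
Lemma pairing_nondeg x (e : E x) : (forall v, pairing e v = 0) -> e = 0.
Proof. by have [_ [_ _ + _] _ _ _] := EC; apply. Qed.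
Lemma smooth_pairing e e' : smooth_sec e -> smooth_sec e' -> smooth_fun (ip e e').
Proof. by have [_ [_ _ _ +] _ _ _] := EC; apply. Qed.
Lemma anchor_derivation x (e : E x) : is_derivation x (anchor e).
Proof. by have [_ _ [+ _ _] _ _] := EC; apply. Qed.
Lemma anchor_linear x f : smooth_fun f -> linear_form (fun e : E x => anchor e f).
Proof. by have [_ _ [_ + _] _ _] := EC; apply. Qed.
Lemma smooth_bracket e e' : smooth_sec e -> smooth_sec e' -> smooth_sec (bracket e e').
Proof. by have [_ _ _ [+ _ _ _] _] := EC; apply. Qed.

Lemma pairingDr x (e u v : E x) : pairing e (u + v) = pairing e u + pairing e v.
Proof. exact: (linear_formD (pairing_linear e)). Qed.
Lemma pairingZr x a (e u : E x) : pairing e (a *: u) = a * pairing e u.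
Proof. exact: (linear_formZ (pairing_linear e)). Qed.
Lemma pairingBr x (e u v : E x) : pairing e (u - v) = pairing e u - pairing e v.
Proof. exact: (linear_formB (pairing_linear e)). Qed.
Lemma pairing0r x (e : E x) : pairing e 0 = 0.
Proof. exact: (linear_form0 (pairing_linear e)). Qed.
Lemma pairing_sumr x n (e : E x) (u : 'I_n -> E x) :
  pairing e (\sum_i u i) = \sum_i pairing e (u i).
Proof. exact: (linear_form_sum (pairing_linear e)). Qed.
Lemma pairingDl x (e u v : E x) : pairing (u + v) e = pairing u e + pairing v e.
Proof. by rewrite !(pairingC _ e) pairingDr. Qed.
Lemma pairingZl x a (e u : E x) : pairing (a *: u) e = a * pairing u e.
Proof. by rewrite !(pairingC _ e) pairingZr. Qed.
Lemma pairingBl x (e u v : E x) : pairing (u - v) e = pairing u e - pairing v e.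
Proof. by rewrite !(pairingC _ e) pairingBr. Qed.
Lemma pairing0l x (e : E x) : pairing 0 e = 0.
Proof. by rewrite pairingC pairing0r. Qed.
Lemma pairing_suml x n (e : E x) (u : 'I_n -> E x) :
  pairing (\sum_i u i) e = \sum_i pairing (u i) e.
Proof. by rewrite pairingC pairing_sumr; apply: eq_bigr => i _; rewrite pairingC. Qed.

Lemma bracketDl e1 e2 e3 x : smooth_sec e1 -> smooth_sec e2 -> smooth_sec e3 ->
  bracket (fun y => e1 y + e2 y) e3 x = bracket e1 e3 x + bracket e2 e3 x.
Proof.
move=> s1 s2 s3; have [_ _ _ [_ + _ _] _] := EC.
move=> /(_ 1 e1 e2 e3 s1 s2 s3) H.
have -> : (fun y => e1 y + e2 y) = (fun y => 1 *: e1 y + e2 y).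
  by apply: functional_extensionality_dep => y; rewrite scale1r.
by rewrite H scale1r.
Qed.

Lemma courant3_act e1 e2 e3 x : smooth_sec e1 -> smooth_sec e2 -> smooth_sec e3 ->
  anchor (e1 x) (ip e2 e3) = Y e1 e2 e3 x + Y e1 e3 e2 x.
Proof.
move=> s1 s2 s3; have [_ _ _ _ [_ + _ _]] := EC.
move=> /(_ e1 e2 e3 s1 s2 s3) H.
have := congr1 (fun F : M -> R => F x) H; rewrite /= => ->.
by congr (_ + _); rewrite pairingC.
Qed.

Lemma courant3_sym e1 e2 e3 x : smooth_sec e1 -> smooth_sec e2 -> smooth_sec e3 ->
  Y e1 e2 e3 x + Y e2 e1 e3 x = anchor (e3 x) (ip e1 e2).
Proof.
move=> s1 s2 s3; have [_ _ _ _ [_ _ + _]] := EC.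
move=> /(_ e1 e2 e3 s1 s2 s3) H.
have := congr1 (fun F : M -> R => F x) H; rewrite /= => <-.
by rewrite -pairingDl.
Qed.

Lemma anchor_const x (e : E x) (f : M -> R) a : (forall y, f y = a) -> anchor e f = 0.
Proof.
move=> H; have -> : f = (fun=> a) by apply/funext.
exact: (der_cst (anchor_derivation e)).
Qed.

(** A constant pairing kills the anchor term in the invariance of the pairing. *)
Lemma courant3_skew23 e1 e2 e3 x a : smooth_sec e1 -> smooth_sec e2 -> smooth_sec e3 ->
  (forall y, pairing (e2 y) (e3 y) = a) -> Y e1 e2 e3 x = - Y e1 e3 e2 x.
Proof.
move=> s1 s2 s3 H; apply/eqP; rewrite -subr_eq0 opprK -courant3_act//.
by rewrite (anchor_const _ H).
Qed.

Lemma courant3_skew12 e1 e2 e3 x a : smooth_sec e1 -> smooth_sec e2 -> smooth_sec e3 ->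
  (forall y, pairing (e1 y) (e2 y) = a) -> Y e1 e2 e3 x = - Y e2 e1 e3 x.
Proof.
move=> s1 s2 s3 H; apply/eqP; rewrite -subr_eq0 opprK courant3_sym//.
by rewrite (anchor_const _ H).
Qed.

(* Skew-symmetry moves the (pointwise) dependence on the third argument to the
   second one. *)
Lemma courant3_tensor23 s e2 e3 e2' e3' x :
  smooth_sec s -> smooth_sec e2 -> smooth_sec e3 -> smooth_sec e2' -> smooth_sec e3' ->
  (forall y, pairing (e2 y) (e3' y) = 0) -> (forall y, pairing (e2' y) (e3' y) = 0) ->
  e2 x = e2' x -> e3 x = e3' x -> Y s e2 e3 x = Y s e2' e3' x.
Proof.
move=> ss s2 s3 s2' s3' H H' E2 E3.
have -> : Y s e2 e3 x = Y s e2 e3' x by rewrite /Y E3.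
rewrite (courant3_skew23 x ss s2 s3' H) (courant3_skew23 x ss s2' s3' H').
by rewrite /Y E2.
Qed.

(** Pair the Jacobi identity of e_i, e_j, e_k with e_l and move the outer brackets across the
    pairing. The brackets may leave the span of the family, so pairings of two brackets survive
    beside the anchor terms. *)
Lemma courant3_isotropic_jacobi (e : 'I_4 -> section E) x
    (i j k l : 'I_4) : (forall i, smooth_sec (e i)) ->
  (forall i j y, pairing (e i y) (e j y) = 0) ->
  anchor (e i x) (Y (e j) (e k) (e l)) - anchor (e j x) (Y (e i) (e k) (e l))
  + anchor (e k x) (Y (e i) (e j) (e l)) - anchor (e l x) (Y (e i) (e j) (e k))
  - pairing (bracket (e j) (e k) x) (bracket (e i) (e l) x)
  + pairing (bracket (e i) (e k) x) (bracket (e j) (e l) x)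
  - pairing (bracket (e i) (e j) x) (bracket (e k) (e l) x) = 0.
Proof.
move=> se iso.
have sb a b : smooth_sec (bracket (e a) (e b)) by exact: smooth_bracket.
have jac : bracket (e i) (bracket (e j) (e k)) x =
    bracket (bracket (e i) (e j)) (e k) x + bracket (e j) (bracket (e i) (e k)) x.
  have [_ _ _ _ [+ _ _ _]] := EC => /(_ _ _ _ (se i) (se j) (se k)) H.
  by rewrite H.
have {}jac := congr1 (fun v => pairing v (e l x)) jac.
rewrite /= pairingDl in jac.
have H1 a b c : pairing (bracket (e a) (bracket (e b) (e c)) x) (e l x) =
    anchor (e a x) (Y (e b) (e c) (e l)) - pairing (bracket (e b) (e c) x) (bracket (e a) (e l) x).
  have := courant3_act x (se a) (sb b c) (se l).
  by rewrite {2}/Y (pairingC (bracket (e a) (e l) x)) => ->; rewrite addrK.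
(* Here the double bracket sits on the left; the symmetry axiom flips it at the price of an anchor
   term in e_l. *)
have H2 : pairing (bracket (bracket (e i) (e j)) (e k) x) (e l x) =
    anchor (e l x) (Y (e i) (e j) (e k)) - pairing (bracket (e k) (bracket (e i) (e j)) x) (e l x).
  have := courant3_sym x (sb i j) (se k) (se l).
  by move=> <-; rewrite addrK.
move: jac; rewrite H2 !H1 => jac.
set a1 := anchor (e i x) _ in jac *; set a2 := anchor (e j x) _ in jac *.
set a3 := anchor (e k x) _ in jac *; set a4 := anchor (e l x) _ in jac *.
move: jac; set b1 := pairing _ _; set b2 := pairing _ _; set b3 := pairing _ _.
by move=> jac; lra.
Qed.

End Courant.

(** * Smooth families of matrices *)

Section SmoothMatrices.
Context {R : realType}.
Variables (M : @premanifold R).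
Hypothesis Ma : smooth_atlas M.

Lemma smooth_bigsum (I : Type) (s : seq I) (P : pred I) (f : I -> M -> R) :
  (forall i, smooth_fun (f i)) -> smooth_fun (fun x => \sum_(i <- s | P i) f i x).
Proof.
move=> sf; elim: s => [|i s IH].
  by under eq_fun do rewrite big_nil; exact: smooth_cst.
under eq_fun do rewrite big_cons; case: (P i) => //.
exact: (smoothD Ma (sf i) IH).
Qed.

Lemma smooth_bigprod (I : Type) (s : seq I) (P : pred I) (f : I -> M -> R) :
  (forall i, smooth_fun (f i)) -> smooth_fun (fun x => \prod_(i <- s | P i) f i x).
Proof.
move=> sf; elim: s => [|i s IH].
  by under eq_fun do rewrite big_nil; exact: smooth_cst.
under eq_fun do rewrite big_cons; case: (P i) => //.
exact: (smoothM Ma (sf i) IH).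
Qed.

Lemma smooth_det n (A : M -> 'M[R]_n) : (forall i j, smooth_fun (fun x => A x i j)) ->
  smooth_fun (fun x => \det (A x)).
Proof.
move=> sA; apply: smooth_bigsum => s; apply: (smoothM Ma); first exact: smooth_cst.
by apply: smooth_bigprod => i; exact: sA.
Qed.

Lemma smooth_adj n (A : M -> 'M[R]_n) i j : (forall i j, smooth_fun (fun x => A x i j)) ->
  smooth_fun (fun x => (\adj (A x)) i j).
Proof.
move=> sA; have sd : smooth_fun (fun x => \det (row' j (col' i (A x)))).
  apply: smooth_det => a b.
  rewrite (_ : (fun x => _) = (fun x => A x (lift j a) (lift i b))) //.
  by apply/funext => x; rewrite !mxE.
have := smoothM Ma (smooth_cst ((-1) ^+ (j + i))) sd.
by congr smooth_fun; apply/funext => x; rewrite [RHS]mxE.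
Qed.

(** If l A A^T = 0 then the sum of squares of the entries of l A is l A A^T l^T = 0. *)
Lemma row_free_gram p q (A : 'M[R]_(p, q)) : 
  (forall l : 'rV[R]_p, l *m A = 0 -> l = 0) -> A *m A^T \in unitmx.
Proof.
move=> H; rewrite -row_free_unit -kermx_eq0; apply/eqP/row_matrixP => i.
rewrite row0; set l := row i _; suff lA : l *m A = 0 by exact: (H l lA).
have lK : l *m (A *m A^T) = 0 by apply/sub_kermxP; exact: row_sub.
have N0 : (l *m A) *m (l *m A)^T = 0 by rewrite trmx_mul mulmxA -(mulmxA l) lK mul0mx.
apply/rowP => j; rewrite [RHS]mxE.
have := congr1 (fun B : 'M[R]_1 => B ord0 ord0) N0; rewrite /= [LHS]mxE [RHS]mxE => E.
apply/eqP; rewrite -sqrf_eq0.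
have : \sum_j (l *m A) ord0 j ^+ 2 = 0.
  by rewrite -[RHS]E; apply: eq_bigr => k _; rewrite [_^T _ _]mxE -expr2.
move/eqP; rewrite psumr_eq0; last by move=> k _; exact: sqr_ge0.
by move=> /allP /(_ j); rewrite mem_index_enum => /(_ isT).
Qed.

(* Moore-Penrose: N = A^T (A A^T)^-1 *)
Lemma smooth_right_inverse (x0 : M) p q (m : 'I_p -> 'I_q -> M -> R) :
  (forall i j, smooth_fun (m i j)) ->
  (forall l : 'I_p -> R, (forall j, \sum_i l i * m i j x0 = 0) -> forall i, l i = 0) ->
  exists N : 'I_q -> 'I_p -> M -> R, (forall j k, smooth_fun (N j k)) /\
    \forall x \near x0, forall i k, \sum_j m i j x * N j k x = (i == k)%:R.
Proof.
move=> sm free.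
pose A x : 'M[R]_(p, q) := \matrix_(i, j) m i j x.
pose S x := A x *m (A x)^T.
have sS i j : smooth_fun (fun x => S x i j).
  have := smooth_bigsum (index_enum _) predT (fun k => smoothM Ma (sm i k) (sm j k)).
  congr smooth_fun; apply/funext => x; rewrite [RHS]mxE.
  by apply: eq_bigr => k _; rewrite !mxE.
have Sx0 : \det (S x0) != 0.
  rewrite -unitfE -unitmxE; apply: row_free_gram => l lA.
  apply/rowP => i; rewrite mxE; apply: (free (fun i => l ord0 i)) => j.
  have := congr1 (fun B : 'rV[R]_q => B ord0 j) lA; rewrite /= [LHS]mxE [RHS]mxE => E.
  by apply: etrans E; apply: eq_bigr => k _; rewrite mxE.
have sd : smooth_fun (fun x => \det (S x)) by exact: smooth_det.
have [D sD DE] := smooth_inv_near Ma sd Sx0.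
exists (fun j k x => \sum_i m i j x * (D x * (\adj (S x)) i k)); split.
  move=> j k; apply: (@smooth_bigsum _ _ _ (fun i x => m i j x * (D x * (\adj (S x)) i k))) => i.
  exact: (smoothM Ma (sm i j) (smoothM Ma sD (smooth_adj i k sS))).
have d0 : \forall x \near x0, \det (S x) != 0.
  have Uo : open [set x | \det (S x) != 0].
    apply: (@open_comp _ _ (fun x => \det (S x)) [set t | t != 0]); last exact: open_neq.
    by move=> q' _; exact: (smooth_continuous Ma).
  exact: open_nbhs_nbhs.
near=> x => i k.
have -> : \sum_j m i j x * (\sum_a m a j x * (D x * (\adj (S x)) a k)) =
   (S x *m (D x *: \adj (S x))) i k.
  rewrite [RHS]mxE.
  under [in RHS]eq_bigr => a _ do rewrite [S x i a]mxE mulr_suml.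
  rewrite exchange_big /=; apply: eq_bigr => j _; rewrite mulr_sumr.
  by apply: eq_bigr => a _; rewrite !mxE mulrA.
rewrite -scalemxAr mul_mx_adj.
have -> : D x = (\det (S x))^-1 by near: x.
rewrite scale_scalar_mx mulVf ?mxE//.
by near: x.
Unshelve. all: by end_near. Qed.

End SmoothMatrices.

(** * Manin pairs with an isotropic complement *)

Section ManinPair.
Context {R : realType}.
Variables (G : @pregroupoid R) (E : precourant (obj G))
  (iota : forall x : obj G, {linear algebroid G x -> E x}) (C : forall x : obj G, set (E x)).
Arguments C : clear implicits.
Hypotheses (lG : lie_groupoid G) (mp : algebroid_manin_pair iota)
  (cC : isotropic_complement iota C).
Local Notation Oa := (obj_atlas lG).
Implicit Types x : obj G.

Lemma manin_courant : courant_algebroid E.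
Proof. by have [[]] := mp. Qed.
Local Notation EC := manin_courant.
Local Notation EV := (courant_bundle EC).

Lemma iota_isotropic x (u v : algebroid G x) : pairing (iota x u) (iota x v) = 0.
Proof.
have [[_ [_ lag _]] _ _ _ _] := mp; have := lag x; rewrite /lagrangian => W.
have : range (iota x) (iota x u) by exists u.
by rewrite W /=; apply; exists v.
Qed.

Lemma iota_inj x : injective (iota x).
Proof. by have [_ + _ _ _] := mp; apply. Qed.

Lemma smooth_iota (u : section (algebroid G)) :
  smooth_sec u <-> smooth_sec (fun x => iota x (u x)).
Proof. by have [_ _ + _ _] := mp; apply. Qed.

Lemma complement_isotropic x e e' : C x e -> C x e' -> pairing e e' = 0.
Proof. by have [_ _] := cC; apply. Qed.

Lemma subbundle_linear (V : prebundle (obj G)) (W : forall x, set (V x)) x : subbundle W ->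
  [/\ W x 0, forall u v, W x u -> W x v -> W x (u + v) & forall a u, W x u -> W x (a *: u)].
Proof.
move=> sub; have [k [w [_ wb]]] := sub x; have [_ ->] := nbhs_singleton wb.
split.
- by exists (fun=> 0); rewrite big1// => i _; rewrite scale0r.
- move=> _ _ [a ->] [b ->]; exists (fun i => a i + b i).
  by rewrite -big_split; apply: eq_bigr => i _; rewrite scalerDl.
- move=> a _ [b ->]; exists (fun i => a * b i).
  by rewrite scaler_sumr; apply: eq_bigr => i _; rewrite scalerA.
Qed.

Lemma complement0 x : C x 0.
Proof. by have [sub _ _] := cC; have [] := subbundle_linear x sub. Qed.
Lemma complementD x u v : C x u -> C x v -> C x (u + v).
Proof. by have [sub _ _] := cC; have [_ + _] := subbundle_linear x sub; apply. Qed.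
Lemma complementZ x a u : C x u -> C x (a *: u).
Proof. by have [sub _ _] := cC; have [_ _ +] := subbundle_linear x sub; apply. Qed.
Lemma complementN x u : C x u -> C x (- u).
Proof. by rewrite -scaleN1r; exact: complementZ. Qed.
Lemma complementB x u v : C x u -> C x v -> C x (u - v).
Proof. by move=> Cu Cv; apply: complementD => //; exact: complementN. Qed.
Lemma complement_sum x n (a : 'I_n -> R) (u : 'I_n -> E x) :
  (forall i, C x (u i)) -> C x (\sum_i a i *: u i).
Proof.
move=> Cu; elim/big_ind: _ => [|v w|i _]; first exact: complement0.
  exact: complementD.
exact: complementZ.
Qed.

Lemma decomposition x (e : E x) : exists (u : algebroid G x) (c : E x),
  C x c /\ e = iota x u + c.
Proof. by have [_ dec _] := cC; have [[u c] [[Cc ec] _]] := dec x e; exists u, c. Qed.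

Lemma orthogonal_zero x (e : E x) : (forall u, pairing e (iota x u) = 0) ->
  (forall c, C x c -> pairing e c = 0) -> e = 0.
Proof.
move=> eA eC; apply: (pairing_nondeg EC) => f.
have [u [c [Cc ->]]] := decomposition f.
by rewrite (pairingDr EC) eA eC// addr0.
Qed.

Lemma complement_ext x (c c' : E x) : C x c -> C x c' ->
  (forall u, pairing c (iota x u) = pairing c' (iota x u)) -> c = c'.
Proof.
move=> Cc Cc' H; apply/eqP; rewrite -subr_eq0; apply/eqP; apply: orthogonal_zero.
  by move=> u; rewrite (pairingBl EC) H subrr.
by move=> d Cd; apply: complement_isotropic => //; exact: complementB.
Qed.

(** Local frames of A and C are cut off to global sections, and a smooth right inverse of their
    pairing matrix turns the frame of C into one dual to that of A. The c_i lie in C everywhere, but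
    span and duality hold near x0 only. *)
Lemma dual_frame x0 : exists r (u : 'I_r -> section (algebroid G)) (c : 'I_r -> section E),
  [/\ forall i, smooth_sec (u i), forall i, smooth_sec (c i), forall i x, C x (c i x),
      \forall x \near x0, forall v, v = \sum_i pairing (c i x) (iota x v) *: u i x &
      \forall x \near x0, forall i k, pairing (c i x) (iota x (u k x)) = (i == k)%:R].
Proof.
have [[_ [subA _ _]] _ _ _ _] := mp; have [subC _ _] := cC.
have [p [w [sw wb]]] := subA x0; have [q [d [sd db]]] := subC x0.
have [U [Uo Ux] UE] : exists2 U, open U /\ U x0 & forall x, U x ->
    basis_of_set (fun i => w i x) (range (iota x)) /\ basis_of_set (fun i => d i x) (C x).
  by apply: near_openP; near=> x; split; near: x.
have [b [sb b1 b0]] := bump Oa Uo Ux.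
have bout x : ~ U x -> b x = 0 by move=> /b0/nbhs_singleton.
have wr i x : exists v, iota x v = b x *: w i x.
  have [Ux'|Ux'] := pselect (U x); last by exists 0; rewrite linear0 bout// scale0r.
  have [[_ rE] _] := UE x Ux'.
  have : range (iota x) (w i x).
    rewrite rE; exists (fun j => (j == i)%:R).
    rewrite (bigD1 i)//= eqxx scale1r big1 ?addr0// => j /negPf ->.
    by rewrite scale0r.
  by move=> [v _ <-]; exists (b x *: v); rewrite linearZ.
pose u i : section (algebroid G) := fun x => projT1 (cid (wr i x)).
have uE i x : iota x (u i x) = b x *: w i x by exact: (projT2 (cid (wr i x))).
have su i : smooth_sec (u i).
  apply/smooth_iota; apply: (smooth_sec_ext (s := fun x => b x *: w i x)) => [x|].
    by rewrite uE.
  exact: (smooth_secZ EV).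
pose d' j : section E := fun x => b x *: d j x.
have sd' j : smooth_sec (d' j) by exact: (smooth_secZ EV).
have Cd' j x : C x (d' j x).
  have [Ux'|Ux'] := pselect (U x); last first.
    by rewrite /d' bout// scale0r; exact: complement0.
  apply: complementZ; have [_ [_ ->]] := UE x Ux'.
  exists (fun k => (k == j)%:R).
  rewrite (bigD1 j)//= eqxx scale1r big1 ?addr0// => k /negPf ->.
  by rewrite scale0r.
pose m i j x := pairing (iota x (u i x)) (d' j x).
have sm i j : smooth_fun (m i j).
  by apply: (smooth_pairing EC) => //; apply/smooth_iota.
have b1x : b x0 = 1 by exact: nbhs_singleton b1.
(* A relation between the rows is a vector of A orthogonal to A and to C, hence to all of E. *)
have free (l : 'I_p -> R) : (forall j, \sum_i l i * m i j x0 = 0) -> forall i, l i = 0.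
  move=> H; have [[ind _] [_ CE]] := UE x0 Ux; apply: ind.
  have -> : \sum_i l i *: w i x0 = iota x0 (\sum_i l i *: u i x0).
    rewrite linear_sum; apply: eq_bigr => i _.
    by rewrite linearZ /= uE b1x scale1r.
  apply: orthogonal_zero => [v|e]; first exact: iota_isotropic.
  rewrite CE => -[a ->]; rewrite (pairing_sumr EC) big1// => j _.
  rewrite (pairingZr EC); have -> : d j x0 = d' j x0 by rewrite /d' b1x scale1r.
  rewrite linear_sum (pairing_suml EC).
  under eq_bigr => i _ do rewrite linearZ /= (pairingZl EC).
  by rewrite H mulr0.
have [N [sN NE]] := smooth_right_inverse Oa sm free.
pose c i : section E := fun x => \sum_j N j i x *: d' j x.
have cu i k x : pairing (c i x) (iota x (u k x)) = \sum_j m k j x * N j i x.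
  rewrite /c (pairing_suml EC); apply: eq_bigr => j _.
  by rewrite (pairingZl EC) mulrC (pairingC EC).
have dual : \forall x \near x0, forall i k, pairing (c i x) (iota x (u k x)) = (i == k)%:R.
  by apply: filterS NE => x NE i k; rewrite cu NE eq_sym.
exists p, u, c; split=> //.
- by move=> i; exact: (smooth_sec_sum EV).
- by move=> i x; exact: complement_sum.
near=> x => v; apply: iota_inj.
have dx : forall i k, pairing (c i x) (iota x (u k x)) = (i == k)%:R by near: x.
have Ux' : U x by near: x; exact: open_nbhs_nbhs.
have bx : b x = 1 by near: x.
have [[_ rE] _] := UE x Ux'.
have : range (iota x) (iota x v) by exists v.
rewrite rE => -[a aE].
have aE' : iota x v = \sum_i a i *: iota x (u i x).
  by rewrite aE; apply: eq_bigr => i _; rewrite uE bx scale1r.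
rewrite linear_sum [LHS]aE'; apply: eq_bigr => i _; rewrite linearZ /=.
congr (_ *: _); rewrite aE' (pairing_sumr EC) (bigD1 i)//= (pairingZr EC) dx eqxx mulr1.
rewrite big1 ?addr0// => k ki; rewrite (pairingZr EC) dx eq_sym (negPf ki) mulr0//.
Unshelve. all: by end_near. Qed.

End ManinPair.

Section Courant0.
Context {R : realType}.
Variables (M : @premanifold R) (E : precourant M).
Hypotheses (EC : courant_algebroid E).

Lemma bracket0l (e : section E) x : smooth_sec e -> bracket (fun y => 0 : E y) e x = 0.
Proof.
move=> se; have s0 := smooth_sec0 (courant_bundle EC).
have := bracketDl EC x s0 s0 se.
have -> : (fun y => 0 + 0 : E y) = (fun y => 0 : E y).
  by apply: functional_extensionality_dep => y; rewrite addr0.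
by move=> /eqP; rewrite -subr_eq subrr eq_sym => /eqP.
Qed.

End Courant0.

(** * The Lie quasi-bialgebroid of the complement *)

Section Complement.
Context {R : realType}.
Variables (G : @pregroupoid R) (E : precourant (obj G))
  (iota : forall x : obj G, {linear algebroid G x -> E x}) (C : forall x : obj G, set (E x)).
Arguments C : clear implicits.
Hypotheses (lG : lie_groupoid G) (mp : algebroid_manin_pair iota)
  (cC : isotropic_complement iota C).
Local Notation Oa := (obj_atlas lG).
Local Notation EC := (manin_courant mp).
Local Notation EV := (courant_bundle EC).
Local Notation Y := (@courant3 R (obj G) E).
Implicit Types x : obj G.

Lemma extend_complement x (a : dual (algebroid G x)) : exists c : section E,
  [/\ smooth_sec c, forall y, C y (c y) & forall u, pairing (c x) (iota x u) = a u].
Proof.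
have [r [u [c [su sc Cc uE _]]]] := dual_frame lG mp cC x.
exists (fun y => \sum_i a (u i x) *: c i y); split.
- by apply: (smooth_sec_sum EV (c := fun i _ => a (u i x))) => // i; exact: smooth_cst.
- by move=> y; apply: (complement_sum cC (fun i => a (u i x))).
move=> v; rewrite [in RHS](nbhs_singleton uE v) (linear_form_sum (dual_linear a)).
rewrite (pairing_suml EC); apply: eq_bigr => i _.
by rewrite (pairingZl EC) (linear_formZ (dual_linear a)) mulrC.
Qed.

Lemma complement_sectionP x (a : dual (algebroid G x)) :
  [/\ smooth_sec (complement_section iota C a), forall y, C y (complement_section iota C a y) &
      forall u, pairing (complement_section iota C a x) (iota x u) = a u].
Proof.
rewrite /complement_section /the_or; case: pselect => [H|[]]; first by case: cid.
exact: extend_complement.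
Qed.

Lemma complement_iso (c c' : section E) : (forall y, C y (c y)) -> (forall y, C y (c' y)) ->
  forall y, pairing (c y) (c' y) = 0.
Proof. by move=> Cc Cc' y; exact: (complement_isotropic cC). Qed.

(** [courant3_tensor23] replaces the last two arguments; skew-symmetry then moves the first one into
    second place, where it can be replaced too. *)
Lemma courant3_complement (c1 c2 c3 d1 d2 d3 : section E) x :
  smooth_sec c1 -> smooth_sec c2 -> smooth_sec c3 ->
  smooth_sec d1 -> smooth_sec d2 -> smooth_sec d3 ->
  (forall y, C y (c1 y)) -> (forall y, C y (c2 y)) -> (forall y, C y (c3 y)) ->
  (forall y, C y (d1 y)) -> (forall y, C y (d2 y)) -> (forall y, C y (d3 y)) ->
  c1 x = d1 x -> c2 x = d2 x -> c3 x = d3 x -> Y c1 c2 c3 x = Y d1 d2 d3 x.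
Proof.
move=> s1 s2 s3 t1 t2 t3 C1 C2 C3 D1 D2 D3 E1 E2 E3.
have iso := complement_iso.
rewrite (courant3_tensor23 EC s1 s2 s3 t2 t3 (iso _ _ C2 D3) (iso _ _ D2 D3) E2 E3).
rewrite (courant3_skew12 EC x s1 t2 t3 (iso _ _ C1 D2)).
rewrite (courant3_skew12 EC x t1 t2 t3 (iso _ _ D1 D2)).
by rewrite (courant3_tensor23 EC t2 s1 t3 t1 t3 (iso _ _ C1 D3) (iso _ _ D1 D3) E1 erefl).
Qed.

(** Frees chi from the chosen [complement_section]s: any sections of C with the right values at x
    compute it. *)
Lemma triple_chiE x (a1 a2 a3 : dual (algebroid G x)) (c1 c2 c3 : section E) :
  smooth_sec c1 -> smooth_sec c2 -> smooth_sec c3 ->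
  (forall y, C y (c1 y)) -> (forall y, C y (c2 y)) -> (forall y, C y (c3 y)) ->
  (forall u, pairing (c1 x) (iota x u) = a1 u) ->
  (forall u, pairing (c2 x) (iota x u) = a2 u) ->
  (forall u, pairing (c3 x) (iota x u) = a3 u) ->
  triple_chi iota C a1 a2 a3 = Y c1 c2 c3 x.
Proof.
move=> s1 s2 s3 C1 C2 C3 E1 E2 E3.
have [t1 D1 F1] := complement_sectionP a1; have [t2 D2 F2] := complement_sectionP a2.
have [t3 D3 F3] := complement_sectionP a3.
rewrite /triple_chi -/(Y _ _ _ x); apply: courant3_complement => //;
  by apply: (complement_ext mp cC) => // u; rewrite ?E1 ?E2 ?E3 ?F1 ?F2 ?F3.
Qed.

Lemma complement_sectionD x (k : R) (a b : dual (algebroid G x)) :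
  complement_section iota C (k *: a + b) x =
  k *: complement_section iota C a x + complement_section iota C b x.
Proof.
have [_ C1 E1] := complement_sectionP a; have [_ C2 E2] := complement_sectionP b.
have [_ C3 E3] := complement_sectionP (k *: a + b).
apply: (complement_ext mp cC) => //.
  by apply: (complementD cC) => //; exact: (complementZ cC).
by move=> u; rewrite E3 (pairingDl EC) (pairingZl EC) E1 E2.
Qed.

Lemma triple_chi_linear3 x (a b : dual (algebroid G x)) : linear_form (triple_chi iota C a b).
Proof.
move=> k u v; rewrite /triple_chi complement_sectionD.
by rewrite (pairing_linear EC).
Qed.

Lemma triple_chi_skew12 x (a b c : dual (algebroid G x)) :
  triple_chi iota C a b c = - triple_chi iota C b a c.
Proof.
have [s1 C1 _] := complement_sectionP a; have [s2 C2 _] := complement_sectionP b.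
have [s3 C3 _] := complement_sectionP c.
exact: (courant3_skew12 EC x s1 s2 s3 (complement_iso C1 C2)).
Qed.

Lemma triple_chi_skew23 x (a b c : dual (algebroid G x)) :
  triple_chi iota C a b c = - triple_chi iota C a c b.
Proof.
have [s1 C1 _] := complement_sectionP a; have [s2 C2 _] := complement_sectionP b.
have [s3 C3 _] := complement_sectionP c.
exact: (courant3_skew23 EC x s1 s2 s3 (complement_iso C2 C3)).
Qed.

Lemma skew0 (t : R) : t = - t -> t = 0.
Proof. by move=> h; lra. Qed.

Lemma triple_chi_alternating x : alternating3 (@triple_chi R G E iota C x).
Proof.
have l3 := @triple_chi_linear3 x.
have l2 (a c : dual (algebroid G x)) : linear_form (fun b => triple_chi iota C a b c).
  move=> k u v; rewrite (triple_chi_skew23 a (k *: u + v) c) (triple_chi_skew23 a u c).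
  by rewrite (triple_chi_skew23 a v c) (l3 a c k u v); ring.
have l1 (b c : dual (algebroid G x)) : linear_form (fun a => triple_chi iota C a b c).
  move=> k u v; rewrite (triple_chi_skew12 (k *: u + v) b c) (triple_chi_skew12 u b c).
  by rewrite (triple_chi_skew12 v b c) (l2 b c k u v); ring.
split; last split.
- move=> a; split; [exact: l3 | split; last by move=> b; exact: l2].
  by move=> b; apply: skew0; exact: triple_chi_skew23.
- move=> b; split; [by move=> a; exact: l3 | split; last by move=> c; exact: l1].
  move=> a; apply: skew0.
  by rewrite {1}triple_chi_skew23 triple_chi_skew12 opprK triple_chi_skew23.
- move=> c; split; [by move=> a; exact: l2 | split; last by move=> b; exact: l1].
  by move=> a; apply: skew0; exact: triple_chi_skew12.
Qed.

(** [complement_section] is chosen separately at each point, so smoothness is not visible on the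
    definition. Near x0 the sections sum_i a(u_i) d_i represent [a] at all points at once. *)
Lemma triple_chi_wedge3 : is_wedge3_section (triple_chi iota C).
Proof.
split; first exact: triple_chi_alternating.
move=> a b c sa sb sc; apply: (smooth_fun_local Oa) => x0.
have [r [u [d [su sd Cd uE _]]]] := dual_frame lG mp cC x0.
pose S (a : forall x, dual (algebroid G x)) : section E :=
  fun x => \sum_i a x (u i x) *: d i x.
have sS (a' : forall x, dual (algebroid G x)) : smooth_dual_sec a' -> smooth_sec (S a').
  move=> sa'; apply: (smooth_sec_sum EV (c := fun i x => a' x (u i x))) => // i.
  by apply: sa'; exact: su.
have CS (a' : forall x, dual (algebroid G x)) y : C y (S a' y).
  exact: (complement_sum cC (fun i => a' y (u i y)) (fun i => Cd i y)).
exists (Y (S a) (S b) (S c)).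
  apply: (smooth_pairing EC); last exact: sS.
  by apply: (smooth_bracket EC); exact: sS.
apply: filterS uE => x uE.
have SE (a' : forall x, dual (algebroid G x)) v : pairing (S a' x) (iota x v) = a' x v.
  rewrite [in RHS](uE v) (linear_form_sum (dual_linear (a' x))).
  rewrite (pairing_suml EC); apply: eq_bigr => i _.
  by rewrite (pairingZl EC) (linear_formZ (dual_linear (a' x))) mulrC.
by apply: triple_chiE => //; exact: sS.
Qed.

Lemma dstar_funP x f (xi : E x) : smooth_fun f -> C x xi ->
  pairing xi (iota x (dstar_fun iota C f x)) = anchor xi f.
Proof.
move=> sf; move: xi; rewrite /dstar_fun /the_or; case: pselect => [H|[]]; first by case: cid.
have [r [u [d [su sd Cd uE _]]]] := dual_frame lG mp cC x.
exists (\sum_i anchor (d i x) f *: u i x) => xi Cxi.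
have al := anchor_linear EC (x := x) sf.
have xiE : xi = \sum_i pairing xi (iota x (u i x)) *: d i x.
  apply: (complement_ext mp cC) => //.
    exact: (complement_sum cC _ (fun i => Cd i x)).
  move=> v; rewrite [in LHS](nbhs_singleton uE v) linear_sum (pairing_sumr EC) (pairing_suml EC).
  by apply: eq_bigr => i _; rewrite linearZ /= (pairingZr EC) (pairingZl EC) mulrC.
rewrite [in RHS]xiE (linear_form_sum al) linear_sum (pairing_sumr EC).
by apply: eq_bigr => i _; rewrite linearZ /= (pairingZr EC) (linear_formZ al) mulrC.
Qed.

(** Invariance and symmetry of the bracket collapse the three terms of d_* u into one, which is
    tensorial in the sections of C. This is the term produced by the Lie derivative of pi. *)
Lemma dstar_secE (u : section (algebroid G)) x (a1 a2 : dual (algebroid G x)) (c1 c2 : section E) :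
  smooth_sec u -> smooth_sec c1 -> smooth_sec c2 ->
  (forall y, C y (c1 y)) -> (forall y, C y (c2 y)) ->
  (forall v, pairing (c1 x) (iota x v) = a1 v) ->
  (forall v, pairing (c2 x) (iota x v) = a2 v) ->
  dstar_sec iota C u a1 a2 = - Y (fun y => iota y (u y)) c1 c2 x.
Proof.
move=> su s1 s2 C1 C2 E1 E2.
have [t1 D1 F1] := complement_sectionP a1; have [t2 D2 F2] := complement_sectionP a2.
have siu : smooth_sec (fun y => iota y (u y)) by exact/(smooth_iota mp).
have -> : Y (fun y => iota y (u y)) c1 c2 x =
    Y (fun y => iota y (u y)) (complement_section iota C a1) (complement_section iota C a2) x.
  apply: (courant3_tensor23 EC) => //; try exact: complement_iso.
    by apply: (complement_ext mp cC) => // v; rewrite E1 F1.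
  by apply: (complement_ext mp cC) => // v; rewrite E2 F2.
rewrite /dstar_sec; set e1 := complement_section iota C a1; set e2 := complement_section iota C a2.
have H1 := courant3_sym EC x siu t1 t2; have H2 := courant3_act EC x t1 siu t2.
have -> : (fun y => pairing (e2 y) (iota y (u y))) = (fun y => pairing (iota y (u y)) (e2 y)).
  by apply/funext => y; rewrite (pairingC EC).
have -> : (fun y => pairing (e1 y) (iota y (u y))) = (fun y => pairing (iota y (u y)) (e1 y)).
  by apply/funext => y; rewrite (pairingC EC).
by rewrite -/(Y e1 e2 (fun y => iota y (u y)) x) -H1 H2; ring.
Qed.

End Complement.

(** * The induced bivector field *)

Section TangentMul.
Context {R : realType}.
Variable G : @pregroupoid R.
Hypothesis lG : lie_groupoid G.
Local Notation Ga := (arr_atlas lG).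

Lemma tangent_mul_linear (g h k : arr G) (a : R) (v v' : tangent g) (w w' : tangent h)
    (z z' : tangent k) : tangent_mul v w z -> tangent_mul v' w' z' ->
  tangent_mul (a *: v + v') (a *: w + w') (a *: z + z').
Proof.
move=> [gh kE vw zE] [_ _ vw' zE']; split=> // f; last move=> F.
  by move=> sf; rewrite !tangent_addE !tangent_scaleE vw// vw'.
by move=> sf sF FE; rewrite !tangent_addE !tangent_scaleE (zE f F)// (zE' f F)//; ring.
Qed.

Lemma mul_unitl (g : arr G) : Defs.mul (Defs.unit (tgt g)) g = g.
Proof. by case: lG => _ _ _ [_ _ ->]. Qed.

Lemma mul_unitr (g : arr G) : Defs.mul g (Defs.unit (src g)) = g.
Proof. by case: lG => _ _ _ [_ -> _]. Qed.

Lemma src_unit (x : obj G) : src (Defs.unit x) = x.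
Proof. by case: lG => _ _ [-> _ _ _]. Qed.

Lemma tgt_unit (x : obj G) : tgt (Defs.unit x) = x.
Proof. by case: lG => _ _ [_ -> _ _]. Qed.

Lemma inv_unit (x : obj G) : Defs.inv (Defs.unit x) = Defs.unit x.
Proof.
have [_ _ _ [_ _ m1] [_ ti mi _]] := lG.
rewrite -[LHS]m1 ti src_unit -[in RHS](tgt_unit x) -mi; congr Defs.mul.
Qed.

Lemma algebroid_src (x : obj G) (u : algebroid G x) f : smooth_fun f ->
  aval u (fun g => f (src g)) = 0.
Proof. by move=> sf; have := asboolW (avalP u); exact. Qed.

Lemma right_invP (g : arr G) (u : algebroid G (tgt g)) :
  tangent_mul (aval u) (0 : tangent g) (right_inv u).
Proof.
rewrite /right_inv /the_or; case: pselect => [H|[]]; first by case: cid.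
have [z zP] : exists z : tangent (Defs.mul (Defs.unit (tgt g)) g),
  tangent_mul (aval u) (0 : tangent g) z.
  apply: tangent_mul_exists => //; first exact: src_unit.
  by move=> f sf; rewrite algebroid_src// tangent0E.
by move: z zP; rewrite mul_unitl => z zP; exists z.
Qed.

Lemma left_invP (g : arr G) (v : algebroid G (src g)) :
  tangent_mul (0 : tangent g) (push (@Defs.inv R G) (aval v)) (left_inv v).
Proof.
rewrite /left_inv /the_or; case: pselect => [H|[]]; first by case: cid.
have [z zP] : exists z : tangent (Defs.mul g (Defs.inv (Defs.unit (src g)))),
    tangent_mul (0 : tangent g) (push (@Defs.inv R G) (aval v)) z.
  apply: tangent_mul_exists => //; first by rewrite inv_unit tgt_unit.
  move=> f sf; rewrite tangent0E pushE; try exact: Ga.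
  - have [_ _ _ _ [_ ti _ _]] := lG.
    by under eq_fun do rewrite ti; rewrite algebroid_src.
  - exact: smooth_map_inv.
  - exact: smooth_tgt.
have e : Defs.mul g (Defs.inv (Defs.unit (src g))) = g by rewrite inv_unit mul_unitr.
by move: z zP; rewrite e => z zP; exists z.
Qed.

Lemma push_linear (g : arr G) (a : R) (v w : tangent g) :
  push (@Defs.inv R G) (a *: v + w) = a *: push (@Defs.inv R G) v + push (@Defs.inv R G) w.
Proof.
have si := smooth_map_inv lG.
by apply: tangent_ext => f sf; rewrite !tangent_addE !tangent_scaleE !(pushE _ Ga Ga si sf)
  tangent_addE tangent_scaleE.
Qed.

Lemma right_inv_linear (g : arr G) (a : R) (u v : algebroid G (tgt g)) :
  right_inv (a *: u + v) = a *: right_inv u + right_inv v.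
Proof.
apply: (tangent_mul_unique lG (right_invP _)).
have := tangent_mul_linear a (right_invP u) (right_invP v).
by rewrite scaler0 addr0.
Qed.

Lemma left_inv_linear (g : arr G) (a : R) (u v : algebroid G (src g)) :
  left_inv (a *: u + v) = a *: left_inv u + left_inv v.
Proof.
apply: (tangent_mul_unique lG (left_invP _)).
have := tangent_mul_linear a (left_invP u) (left_invP v).
by rewrite scaler0 addr0 -push_linear.
Qed.

Lemma right_inv0 (g : arr G) : right_inv (0 : algebroid G (tgt g)) = 0.
Proof.
have := right_inv_linear (-1) (0 : algebroid G (tgt g)) 0.
by rewrite scaler0 addr0 scaleN1r addNr.
Qed.

Lemma left_inv0 (g : arr G) : left_inv (0 : algebroid G (src g)) = 0.
Proof.
have := left_inv_linear (-1) (0 : algebroid G (src g)) 0.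
by rewrite scaler0 addr0 scaleN1r addNr.
Qed.

Lemma right_pullE (g : arr G) (al : cotangent g) u : right_pull al u = al (right_inv u).
Proof.
rewrite mkdualE// => a v w; rewrite right_inv_linear.
exact: (dual_linear al).
Qed.

Lemma left_pullE (g : arr G) (al : cotangent g) u : left_pull al u = al (left_inv u).
Proof.
rewrite mkdualE// => a v w; rewrite left_inv_linear.
exact: (dual_linear al).
Qed.

End TangentMul.

Local Notation bracket_of V := (section V -> section V -> section V).
Local Notation anchor_relation G E :=
  (courant_relation (TTstar (arr G)) (prod_bundle E E)
     (fun g : arr G => (tgt g, src g) : prodman (obj G) (obj G))).

(** * The relation R fibre by fibre *)

Section Relation.
Context {R : realType}.
Variables (G : @pregroupoid R) (E : precourant (obj G))
  (iota : forall x : obj G, {linear algebroid G x -> E x})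
  (B : bracket_of (prod_bundle E (opp_courant E)))
  (B' : bracket_of (prod_bundle (standard_courant (arr G)) (opp_courant (prod_courant B))))
  (Rel : anchor_relation G E).
Arguments Rel : clear implicits.

Definition anchor_graph (g : arr G) : prodman (arr G) (prodman (obj G) (obj G)) :=
  (g, (tgt g, src g)).

(* [B'] is the bracket of P witnessing that [Rel] is a Courant morphism. *)
Record action_morphism : Prop := ActionMorphism {
  am_groupoid : lie_groupoid G;
  am_pair : algebroid_manin_pair iota;
  am_product : product_bracket B;
  am_product' : product_bracket B';
  am_bundle : subbundle_along (psi := anchor_graph) (V := prod_courant B') Rel;
  am_lagrangian : forall g, lagrangian (E := prod_courant B') (x := anchor_graph g) (Rel g);
  am_anchor : forall g e1 e2, Rel g (e1, e2) ->
    forall f : prodman (obj G) (obj G) -> R, smooth_fun f ->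
      anchor (e2 : prod_courant B (tgt g, src g)) f = e1.1 (fun y => f (tgt y, src y));
  am_bracket : forall s s' : section (prod_courant B'), smooth_sec s -> smooth_sec s' ->
    (forall g, Rel g (s (anchor_graph g))) -> (forall g, Rel g (s' (anchor_graph g))) ->
    forall g, Rel g (bracket s s' (anchor_graph g));
  am_tangent : forall g (e1 : TTstar (arr G) g) (e2 : E (tgt g) * E (src g)),
    Rel g (e1, e2) -> e1.2 = 0 -> range (iota (tgt g)) e2.1 /\ range (iota (src g)) e2.2;
  am_unique : forall g (e1 e1' : TTstar (arr G) g) (u : algebroid G (tgt g))
    (v : algebroid G (src g)), e1.2 = 0 -> e1'.2 = 0 ->
    Rel g (e1, (iota _ u, iota _ v)) -> Rel g (e1', (iota _ u, iota _ v)) -> e1 = e1';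
  am_closed : vb_closed (H := pair_groupoid (obj G)) (W := prod_bundle E E)
    (TTstar_groupoid G) (pair_vb_groupoid E) Rel;
  am_action : forall (g : arr G) (u : algebroid G (tgt g)) (v : algebroid G (src g)),
    Rel g ((right_inv u + left_inv v, 0), (iota (tgt g) u, iota (src g) v)) }.

End Relation.

Lemma action_morphism_intro (R : realType) (G : @pregroupoid R)
  (E : precourant (obj G))
  (iota : forall x : obj G, {linear algebroid G x -> E x})
  (B : bracket_of (prod_bundle E (opp_courant E))) (Rel : anchor_relation G E) :
  lie_groupoid G ->
  algebroid_manin_pair iota ->
  product_bracket B ->
  multiplicative_manin_morphism
    (G := G) (H := pair_groupoid (obj G))
    (E := standard_courant (arr G)) (@tangent_part R (arr G)) (TTstar_groupoid G)
    (F := prod_courant B)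
    (fun p : prodman (obj G) (obj G) => range (iota p.1) `*` range (iota p.2))
    (pair_vb_groupoid E)
    Rel ->
  (forall (g : arr G) (u : algebroid G (tgt g)) (v : algebroid G (src g)),
     Rel g ((right_inv u + left_inv v, 0), (iota (tgt g) u, iota (src g) v))) ->
  exists B', @action_morphism R G E iota B B' Rel.
Proof.
move=> lG mp PB [_ [[_ [B' [PB' [sub lag anc brk]]]] man] vb] act.
exists B'; split=> // [g e1 e2 He1 e10|g e1 e1' u v e0 e0' H1 H2].
  by have [h _] := man g; exact: (h e1 e2).
have [_ h] := man g.
have [|e [_ eq]] := h (iota _ u, iota _ v); first by split; [exists u | exists v].
by rewrite -(eq e1 (conj e0 H1)) -(eq e1' (conj e0' H2)).
Qed.

Lemma sum_middle (R : realType) (U V W : lmodType R) k (l : 'I_k -> R) (w : 'I_k -> (U * V) * W) :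
  (\sum_i l i *: w i).1.2 = \sum_i l i *: (w i).1.2.
Proof.
have D : {morph (fun e : (U * V) * W => e.1.2) : x y / x + y >-> x + y} by [].
by rewrite (big_morph _ D (erefl : (0 : (U * V) * W).1.2 = 0)).
Qed.

Section Fibrewise.
Context {R : realType}.
Variables (G : @pregroupoid R) (E : precourant (obj G))
  (iota : forall x : obj G, {linear algebroid G x -> E x})
  (B : bracket_of (prod_bundle E (opp_courant E)))
  (B' : bracket_of (prod_bundle (standard_courant (arr G)) (opp_courant (prod_courant B))))
  (Rel : anchor_relation G E)
  (C : forall x : obj G, set (E x)).
Arguments Rel : clear implicits.
Arguments C : clear implicits.
Hypotheses (am : action_morphism iota B' Rel) (cC : isotropic_complement iota C).
Local Notation lG := (am_groupoid am).
Local Notation mp := (am_pair am).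
Local Notation Ga := (arr_atlas lG).
Local Notation EC := (manin_courant mp).
Local Notation P := (prod_courant B').
Implicit Types (g : arr G).

(** In P the factor E over the target carries the opposite pairing; the one over the source is
    reversed twice. *)
Lemma prod_pairingE g (X X' : tangent g) (al al' : cotangent g) (a a' : E (tgt g)) (b b' : E
  (src g)) :
  pairing (((X, al), (a, b)) : P (anchor_graph g)) ((X', al'), (a', b')) =
  al X' + al' X - pairing a a' + pairing b b'.
Proof. by rewrite /= opprD opprK addrA. Qed.

Lemma relP g (X : tangent g) (al : cotangent g) (a : E (tgt g)) (b : E (src g)) :
  Rel g ((X, al), (a, b)) <->
  forall X' al' a' b', Rel g ((X', al'), (a', b')) ->
    al X' + al' X - pairing a a' + pairing b b' = 0.
Proof.
have -> : Rel g ((X, al), (a, b)) = (forall e' : P (anchor_graph g), Rel g e' ->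
    pairing (((X, al), (a, b)) : P (anchor_graph g)) e' = 0).
  by rewrite {1}(am_lagrangian am g).
split=> [h X' al' a' b' /h|h [[X' al'] [a' b']] /h]; first by rewrite prod_pairingE.
by rewrite prod_pairingE.
Qed.

Lemma rel_pairing g (X X' : tangent g) (al al' : cotangent g) (a a' : E (tgt g)) (b b' : E (src
  g)) :
  Rel g ((X, al), (a, b)) -> Rel g ((X', al'), (a', b')) ->
  al X' + al' X - pairing a a' + pairing b b' = 0.
Proof. by move=> /relP h /h. Qed.

Lemma rel_linear g (k : R) (X X' : tangent g) (al al' : cotangent g) (a a' : E (tgt g))
    (b b' : E (src g)) :
  Rel g ((X, al), (a, b)) -> Rel g ((X', al'), (a', b')) ->
  Rel g ((k *: X + X', k *: al + al'), (k *: a + a', k *: b + b')).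
Proof.
move=> /relP h /relP h'; apply/relP => Z ga c d H.
rewrite (pairingDl EC) (pairingZl EC) (pairingDl EC) (pairingZl EC).
rewrite (dual_linear ga).
have -> : (k *: al + al') Z = k * al Z + al' Z by [].
have := h _ _ _ _ H; have := h' _ _ _ _ H.
by move=> E1 E2; rewrite -[RHS](addr0 0) -{1}(mulr0 k) -{1}E2 -E1; ring.
Qed.

Lemma rel_action g u v : Rel g ((right_inv u + left_inv v, 0), (iota (tgt g) u, iota (src g) v)).
Proof. exact: (am_action am). Qed.

Lemma rel_right g u : Rel g ((right_inv u, 0), (iota (tgt g) u, 0)).
Proof. by have := rel_action u (0 : algebroid G (src g)); rewrite (left_inv0 lG) addr0 linear0. Qed.

Lemma rel_left g v : Rel g ((left_inv v, 0), (0, iota (src g) v)).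
Proof. by have := rel_action (0 : algebroid G (tgt g)) v; rewrite (right_inv0 lG) add0r linear0.
  Qed.

(** The Manin morphism property puts the E-components in A x A and makes the vector unique for given
    components; the hypothesis on the action names that vector. *)
Lemma rel_tangent g (X : tangent g) a b : Rel g ((X, 0), (a, b)) ->
  exists u v, [/\ a = iota (tgt g) u, b = iota (src g) v & X = right_inv u + left_inv v].
Proof.
move=> H; have [[u _ uE] [v _ vE]] := am_tangent am H erefl.
exists u, v; split; rewrite ?uE ?vE//.
have H' := rel_action u v; rewrite uE vE in H' *.
by have := am_unique am (e1 := (X, 0)) (e1' := (right_inv u + left_inv v, 0)) (u := u) (v := v)
  erefl erefl; rewrite uE vE => /(_ H H')[].
Qed.

(** The only possible C-components of an element of R with covector [al]. The sign in [leftC] comes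
    from the pairing of P: orthogonality to i(v)^l, which is related to (0, v), reads al(i(v)^l) +
    <b, v> = 0. *)
Definition rightC g (al : cotangent g) : section E := complement_section iota C (right_pull al).
Definition leftC g (al : cotangent g) : section E := complement_section iota C (- left_pull al).

Lemma rightCE g (al : cotangent g) u : pairing (rightC al (tgt g)) (iota (tgt g) u) =
  al (right_inv u).
Proof. by have [_ _ ->] := complement_sectionP lG mp cC (right_pull al);
  rewrite (right_pullE lG). Qed.

Lemma leftCE g (al : cotangent g) v : pairing (leftC al (src g)) (iota (src g) v) =
  - (al (left_inv v) : R).
Proof.
have [_ _ ->] := complement_sectionP lG mp cC (- left_pull al).
by rewrite -(left_pullE lG).
Qed.

Lemma rightC_in g (al : cotangent g) y : C y (rightC al y).
Proof. by have [_ h _] := complement_sectionP lG mp cC (right_pull al). Qed.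

Lemma leftC_in g (al : cotangent g) y : C y (leftC al y).
Proof. by have [_ h _] := complement_sectionP lG mp cC (- left_pull al). Qed.

Lemma rel_complement g (X : tangent g) al a b : C (tgt g) a -> C (src g) b ->
  Rel g ((X, al), (a, b)) -> a = rightC al (tgt g) /\ b = leftC al (src g).
Proof.
move=> Ca Cb H; split; apply: (complement_ext mp cC) => //; try exact: rightC_in;
  try exact: leftC_in.
  move=> u; rewrite rightCE.
  by have := rel_pairing H (rel_right u); rewrite (pairing0r EC) /= addr0 addr0 => /eqP;
    rewrite subr_eq0 => /eqP.
move=> v; rewrite leftCE.
have := rel_pairing H (rel_left v); rewrite (pairing0r EC) subr0 /= addr0.
by move=> /eqP; rewrite addrC addr_eq0 => /eqP.
Qed.

(* X solves a linear system indexed by a basis of Rel; a linear relation between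
   its rows is an element of Rel with covector part 0, so the right-hand sides
   satisfy the same relation. *)
Lemma rel_exists g (al : cotangent g) :
  exists X, Rel g ((X, al), (rightC al (tgt g), leftC al (src g))).
Proof.
have [k [w [_ /nbhs_singleton[_ wE]]]] := am_bundle am g.
have [x [d [_ _ _ /nbhs_singleton dE]]] := frame Ga g.
pose n := Defs.dim (arr G).
pose W i : P (anchor_graph g) := w i (anchor_graph g).
have relE (X : tangent g) (a : E (tgt g)) (b : E (src g)) : (forall i, ((W i).1.2 X : R) =
    - (al (W i).1.1 : R) + pairing a (W i).2.1 - pairing b (W i).2.2) -> Rel g ((X, al), (a, b)).
  move=> h; apply/relP => X' al' a' b'; rewrite wE => -[c E'].
  rewrite -prod_pairingE.
  have [PC _] := am_product' am.
  rewrite E' (pairing_sumr PC); apply: big1 => i _; rewrite (pairingZr PC).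
  rewrite -/(W i); move: (h i); case: (W i) => [[Xi ali] [ai bi]] hi.
  by rewrite prod_pairingE; rewrite /= in hi; rewrite hi; ring.
pose A : 'M[R]_(n, k) := \matrix_(a, i) (W i).1.2 (d a g).
pose r : 'rV[R]_k := \row_i (- (al (W i).1.1 : R) + pairing (rightC al (tgt g)) (W i).2.1 -
   pairing (leftC al (src g)) (W i).2.2).
have /submxP[D rD] : (r <= A)%MS.
  rewrite submxE; apply/eqP/rowP => j; rewrite mxE [RHS]mxE.
  pose l i := cokermx A i j.
  have Wl : Rel g (\sum_i l i *: W i) by rewrite wE; exists l.
  have W0 : (\sum_i l i *: W i).1.2 = 0.
    rewrite [LHS](@sum_middle _ (tangent g) (cotangent g) (E (tgt g) * E (src g))%type _ l W).
    apply: dual_ext => v; rewrite (dE v) (linear_form_sum (dual_linear _)) big1// => a _.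
    rewrite (linear_formZ (dual_linear _)) dual_sumE.
    have := mulmx_coker A => /matrixP/(_ a j); rewrite !mxE => e.
    rewrite (_ : \sum_i _ = 0) ?mulr0//; transitivity (\sum_i A a i * l i); last exact: e.
    by apply: eq_bigr => i _; rewrite [A a i]mxE mulrC.
  have [PC _] := am_product' am.
  have rE : \sum_i r ord0 i * l i = - pairing (((0, al),
      (rightC al (tgt g), leftC al (src g))) : P (anchor_graph g)) (\sum_i l i *: W i).
    rewrite (pairing_sumr PC) -sumrN; apply: eq_bigr => i _; rewrite (pairingZr PC) mxE.
    case: (W i) => [[Xi ali] [ai bi]].
    by rewrite prod_pairingE /= (linear_form0 (dual_linear _)); ring.
  rewrite rE; move: Wl W0; case: (\sum_i _) => [[X be] [a b]] Wl be0.
  move: Wl; rewrite [be]be0 => /rel_tangent[u [v [-> -> ->]]].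
  rewrite prod_pairingE rightCE leftCE (linear_form0 (dual_linear _)).
  by rewrite (linear_formD (dual_linear _)); ring.
exists (\sum_a D ord0 a *: d a g); apply: relE => i.
rewrite (linear_form_sum (dual_linear _)); move/rowP: rD => /(_ i); rewrite !mxE => ->.
by apply: eq_bigr => a _; rewrite (linear_formZ (dual_linear _)) mxE.
Qed.

Definition sharp g (al : cotangent g) : tangent g :=
  the_or 0 (fun X => Rel g ((X, al), (rightC al (tgt g), leftC al (src g)))).

Lemma sharpP g (al : cotangent g) : Rel g ((sharp al, al), (rightC al (tgt g), leftC al (src g))).
Proof.
rewrite /sharp /the_or; case: pselect => [H|[]]; first by case: cid.
exact: rel_exists.
Qed.

Lemma sharp_unique g (X : tangent g) al a b : C (tgt g) a -> C (src g) b ->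
  Rel g ((X, al), (a, b)) -> X = sharp al.
Proof.
move=> Ca Cb H; have [aE bE] := rel_complement Ca Cb H.
have := rel_linear (-1) (sharpP al) H.
rewrite aE bE !scaleN1r !addNr => /rel_tangent[u [v [/esym uE /esym vE]]].
have -> : u = 0 by apply: (iota_inj mp); rewrite uE linear0.
have -> : v = 0 by apply: (iota_inj mp); rewrite vE linear0.
by rewrite (right_inv0 lG) (left_inv0 lG) addr0 addrC => /eqP; rewrite subr_eq0 => /eqP.
Qed.

Lemma sharp_linear g k (al be : cotangent g) : sharp (k *: al + be) = k *: sharp al + sharp be.
Proof.
symmetry; apply: sharp_unique (rel_linear k (sharpP al) (sharpP be)).
  by apply: (complementD cC); [apply: (complementZ cC)|]; exact: rightC_in.
by apply: (complementD cC); [apply: (complementZ cC)|]; exact: leftC_in.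
Qed.

(** Isotropy of R, where isotropy of C removes the E-terms of the pairing. *)
Lemma sharp_skew g (al be : cotangent g) : (be (sharp al) : R) = - (al (sharp be) : R).
Proof.
have := rel_pairing (sharpP al) (sharpP be).
rewrite !(complement_isotropic cC) ?subr0 ?addr0; last first.
- exact: rightC_in.
- exact: rightC_in.
- exact: leftC_in.
- exact: leftC_in.
by move=> /eqP; rewrite addrC addr_eq0 => /eqP.
Qed.

Definition sharp_bivector : bivector_field (arr G) := fun g al be => be (sharp al).

Lemma sharp_bivector_alternating g : alternating2 (@sharp_bivector g).
Proof.
split; first by move=> al k be be'.
split=> [al|be k al al'].
  by apply: skew0; exact: sharp_skew.
by rewrite /sharp_bivector sharp_linear; exact: (dual_linear be k (sharp al) (sharp al')).
Qed.

Lemma sharp_graph : graph_is_composition Rel C sharp_bivector.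
Proof.
move=> g X al; split=> [XE|[[a b] [/= Ca Cb H]] be].
  exists (rightC al (tgt g), leftC al (src g)); split; [exact: rightC_in | exact: leftC_in |].
  rewrite (_ : X = sharp al); first exact: sharpP.
  by apply: tangent_ext => f sf; have := XE (diff1 f g); rewrite /sharp_bivector !diff1E.
by rewrite (sharp_unique Ca Cb H).
Qed.

End Fibrewise.

Section ProdSection.
Context {R : realType}.
Variables (M N : @premanifold R) (V : prebundle M) (W : prebundle N).
Lemma smooth_sec_pair (e : section V) (h : section W) : smooth_sec e -> smooth_sec h ->
  smooth_sec (fun p => (e p.1, h p.2) : prod_bundle V W p).
Proof.
move=> se sh p; exists 1%N, (fun=> e), (fun=> h), (fun=> fun=> 1), (fun=> fun=> 1).
have s1 : smooth_fun (fun _ : prodman M N => 1 : R) by exact: smooth_cst.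
split=> //; apply: (@filterE _ (nbhs p) (nbhs_filter p)) => q.
by rewrite !big_ord1 !scale1r.
Qed.

End ProdSection.

Lemma sum_pair (R : realType) (U V : lmodType R) n (f : 'I_n -> U * V) :
  \sum_i f i = (\sum_i (f i).1, \sum_i (f i).2).
Proof.
have m1 : {morph (fun e : U * V => e.1) : x y / x + y >-> x + y} by [].
have m2 : {morph (fun e : U * V => e.2) : x y / x + y >-> x + y} by [].
rewrite [LHS]surjective_pairing (big_morph _ m1 (erefl : (0 : U * V).1 = 0)).
by rewrite (big_morph _ m2 (erefl : (0 : U * V).2 = 0)).
Qed.

Lemma sum_pair2 (R : realType) (T U V : lmodType R) m n (a : 'I_m -> R) (b : 'I_n -> R)
    (u : 'I_m -> U) (v : 'I_n -> V) :
  ((0, (\sum_i a i *: u i, \sum_i b i *: v i)) : T * (U * V)) =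
  \sum_i a i *: (0, (u i, 0)) + \sum_i b i *: (0, (0, v i)).
Proof.
rewrite !sum_pair /=.
have z (W : lmodType R) k (c : 'I_k -> R) : \sum_i c i *: (0 : W) = 0.
  by apply: big1 => i _; rewrite scaler0.
by rewrite !z; congr (_, (_, _)); rewrite /= ?addr0 ?add0r.
Qed.

(** * Smooth sections of the product Courant algebroid P *)

Section PSections.
Context {R : realType}.
Variables (G : @pregroupoid R) (E : precourant (obj G))
  (iota : forall x : obj G, {linear algebroid G x -> E x})
  (B : bracket_of (prod_bundle E (opp_courant E)))
  (B' : bracket_of (prod_bundle (standard_courant (arr G)) (opp_courant (prod_courant B))))
  (Rel : anchor_relation G E)
  (C : forall x : obj G, set (E x)).
Arguments Rel : clear implicits.
Arguments C : clear implicits.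
Hypotheses (am : action_morphism iota B' Rel) (cC : isotropic_complement iota C).
Local Notation lG := (am_groupoid am).
Local Notation mp := (am_pair am).
Local Notation Ga := (arr_atlas lG).
Local Notation Oa := (obj_atlas lG).
Local Notation OOa := (prod_smooth_atlas Oa Oa).
Local Notation Pa := (prod_smooth_atlas Ga OOa).
Local Notation EC := (manin_courant mp).
Local Notation EV := (courant_bundle EC).
Local Notation P := (prod_courant B').
Local Notation PC := (am_product' am).1.
Local Notation PV := (courant_bundle PC).
Implicit Types (g : arr G) (e h : section E) (t : section (TTstar (arr G))).

(** The sections on which the bracket of P is known explicitly, namely componentwise; all others are
    compared with these. *)
Definition pullback_sec t e h : section P := fun q => (t q.1, (e q.2.1, h q.2.2)).

Lemma smooth_pullback_sec t e h : smooth_sec t -> smooth_sec e -> smooth_sec h ->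
  smooth_sec (pullback_sec t e h).
Proof.
move=> st se sh; apply: (smooth_sec_pair (V := TTstar (arr G)) (W := prod_bundle E (opp_courant E))
  (e := t) (h := fun q => (e q.1, h q.2)) st).
exact: (smooth_sec_pair (V := E) (W := opp_courant E) se sh).
Qed.

Lemma bracket_pullback_sec t e h t' e' h' : smooth_sec t -> smooth_sec e -> smooth_sec h ->
  smooth_sec t' -> smooth_sec e' -> smooth_sec h' ->
  bracket (pullback_sec t e h) (pullback_sec t' e' h') =
  pullback_sec (dorfman t t') (bracket e e') (bracket h h').
Proof.
move=> st se sh st' se' sh'.
have [_ b1] := am_product' am; have [_ b2] := am_product am.
have s2 := smooth_sec_pair (V := E) (W := opp_courant E) se sh.
have s2' := smooth_sec_pair (V := E) (W := opp_courant E) se' sh'.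
etransitivity; first exact: (b1 t t' (fun q => (e q.1, h q.2)) (fun q => (e' q.1, h' q.2))).
apply: functional_extensionality_dep => q; congr pair.
exact: (congr1 (fun s => s q.2) (b2 e e' h h' se se' sh sh')).
Qed.

Lemma smooth_TT (X : vfield (arr G)) (al : covfield (arr G)) : smooth_vf X -> smooth_cov al ->
  smooth_sec (fun g => (X g, al g) : TTstar (arr G) g).
Proof. by []. Qed.

Lemma smooth_map_anchor_graph : smooth_map (anchor_graph (G := G)).
Proof.
apply: (smooth_map_pair (phi := fun g => g)); first exact: (smooth_map_id Ga).
by apply: smooth_map_pair; [exact: (smooth_map_tgt lG) | exact: (smooth_map_src lG)].
Qed.

Lemma smooth_pairing_graph (s s' : section P) : smooth_sec s -> smooth_sec s' ->
  smooth_fun (fun g => pairing (s (anchor_graph g)) (s' (anchor_graph g))).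
Proof.
move=> ss ss'; have := smooth_pairing PC ss ss'.
exact: (smooth_pullback Ga Pa smooth_map_anchor_graph).
Qed.

Lemma smooth_TT0 : smooth_sec (fun g => (0, 0) : TTstar (arr G) g).
Proof. by split; [exact: smooth_vf0 | exact: smooth_cov0]. Qed.

Lemma smooth_E0 : smooth_sec (fun x => 0 : E x).
Proof. exact: (smooth_sec0 EV). Qed.

(** Every covector occurs in R by [rel_exists], so the covector parts of a frame of R span the
    cotangent space; a smooth right inverse of their matrix on a tangent frame recovers v f from
    their values on v. *)
Lemma rel_coframe g0 : exists k (w : 'I_k -> section P),
  [/\ forall i, smooth_sec (w i),
      \forall g \near g0, forall i, Rel g (w i (anchor_graph g)) &
      forall f : arr G -> R, smooth_fun f -> exists c : 'I_k -> arr G -> R,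
        (forall i, smooth_fun (c i)) /\
        \forall g \near g0, forall v : tangent g,
          v f = \sum_i c i g * ((w i (anchor_graph g)).1.2 v : R)].
Proof.
have [k [w [sw wE]]] := am_bundle am g0.
have [x [d [sx sd dx dE]]] := frame Ga g0.
pose m a i g : R := pairing (w i (anchor_graph g))
  (pullback_sec (fun g => (d a g, 0)) (fun=> 0) (fun=> 0) (anchor_graph g)).
have mE a i g : m a i g = (w i (anchor_graph g)).1.2 (d a g).
  rewrite /m /pullback_sec; case: (w i _) => [[X al] [e h]].
  by rewrite (@prod_pairingE _ G E B B' g) (pairing0r EC) (pairing0r EC) subr0 !addr0.
have sm a i : smooth_fun (m a i).
  apply: smooth_pairing_graph => //; apply: smooth_pullback_sec; try exact: smooth_E0.
  by apply: smooth_TT => //; exact: smooth_cov0.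
have [l lm a|N [sN NE]] := smooth_right_inverse Ga (x0 := g0) sm.
  have lX (al : cotangent g0) : al (\sum_a l a *: d a g0) = 0.
    have [X H] := rel_exists am cC al; have := nbhs_singleton wE => -[_ wE0].
    move: H; rewrite wE0 => -[c] /(congr1 (fun e : P (anchor_graph g0) => e.1.2)).
    rewrite (@sum_middle _ (tangent g0) (cotangent g0) (E (tgt g0) * E (src g0))%type _ c
      (fun i => w i (anchor_graph g0))) /= => ->.
    rewrite dual_sumE big1// => i _; rewrite (linear_form_sum (dual_linear _)).
    transitivity (c i * \sum_a l a * m a i g0); last by rewrite lm mulr0.
    by rewrite mulr_sumr; apply: eq_bigr => b _; rewrite (linear_formZ (dual_linear _)) mE mulrCA.
  have := lX (diff1 (x a) g0); rewrite diff1E tangent_sumE.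
  rewrite (eq_bigr (fun b => l b * (b == a)%:R)) => [|b _].
    by rewrite (bigD1 a)//= eqxx mulr1 big1 ?addr0// => b /negPf->; rewrite mulr0.
  by rewrite tangent_scaleE (nbhs_singleton (dx b a)).
exists k, w; split=> //.
  apply: filterS wE => g [_ ->] i; exists (fun j => (j == i)%:R).
  by rewrite (bigD1 i)//= eqxx scale1r big1 ?addr0// => j /negPf->; rewrite scale0r.
move=> f sf; exists (fun i g => \sum_b N i b g * d b g f); split.
  move=> i; apply: (smooth_sum Ga) => b; apply: (smoothM Ga) => //.
  exact: sd.
apply: filterS2 dE NE => g dE NE v.
rewrite {1}(dE v) tangent_sumE.
under [in RHS]eq_bigr => i _ do rewrite {1}(dE v) (linear_form_sum (dual_linear _)) mulr_sumr.
rewrite exchange_big; apply: eq_bigr => a _; rewrite tangent_scaleE.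
under eq_bigr => i _ do rewrite (linear_formZ (dual_linear _)) -mE mulrCA.
rewrite -mulr_sumr; congr (_ * _).
under eq_bigr => i _ do rewrite mulr_suml.
rewrite exchange_big /= (bigD1 a)//= [X in _ = _ + X]big1 ?addr0 => [|b ba].
  rewrite (eq_bigr (fun i => d a g f * (m a i g * N i a g))) => [|i _]; last by ring.
  by rewrite -mulr_sumr NE eqxx mulr1.
rewrite (eq_bigr (fun i => d b g f * (m a i g * N i b g))) => [|i _]; last by ring.
by rewrite -mulr_sumr NE eq_sym (negPf ba) mulr0.
Qed.

(* Pairing with a frame w_i of Rel gives (covector part of w_i)(X) = - <s, w_i>. *)
Lemma smooth_rel_field (X : vfield (arr G)) :
  (forall g0, exists2 s : section P, smooth_sec s & \forall g \near g0,
    exists al (e : E (tgt g)) (h : E (src g)), s (anchor_graph g) =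
      ((0, al), (e, h)) /\ Rel g ((X g, al), (e, h))) ->
  smooth_vf X.
Proof.
move=> H f sf; apply: (smooth_fun_local Ga) => g0.
have [s ss sE] := H g0; have [k [w [sw wR wf]]] := rel_coframe g0.
have [c [sc cE]] := wf f sf.
exists (fun g => \sum_i c i g * - pairing (s (anchor_graph g)) (w i (anchor_graph g))).
  apply: (smooth_sum Ga) => i; apply: (smoothM Ga) => //; apply: (smoothN Ga).
  exact: smooth_pairing_graph.
near=> g; have cEg : forall v : tangent g, v f = \sum_i c i g * ((w i (anchor_graph g)).1.2 v : R).
  by near: g.
rewrite cEg; apply: eq_bigr => i _; congr (_ * _).
have [al [e [h [-> He]]]] : exists al (e : E (tgt g)) (h : E (src g)), s (anchor_graph g) =
  ((0, al), (e, h)) /\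
    Rel g ((X g, al), (e, h)) by near: g.
have : Rel g (w i (anchor_graph g)) by move: i; near: g.
case: (w i _) => [[Y be] [e' h']] Hw.
have h0 := rel_pairing am He Hw.
rewrite (@prod_pairingE _ G E B B' g) (linear_form0 (dual_linear be)) /=.
by apply/eqP; rewrite -subr_eq0; apply/eqP; rewrite -[RHS]h0; ring.
Unshelve. all: by end_near. Qed.

(** The vector u^r is related to (u, 0), which is smooth; smoothness thus comes from R, not from the
    multiplication. *)
Lemma smooth_right_vf (u : section (algebroid G)) : smooth_sec u -> smooth_vf (right_vf u).
Proof.
move=> su; apply: smooth_rel_field => g0.
exists (pullback_sec (fun=> (0, 0)) (fun x => iota x (u x)) (fun=> 0)).
  apply: smooth_pullback_sec; [exact: smooth_TT0 | exact/(smooth_iota mp) | exact: smooth_E0].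
apply: filterE => g; exists 0, (iota _ (u (tgt g))), 0; split=> //.
exact: (rel_right am).
Qed.

Lemma smooth_left_vf (v : section (algebroid G)) : smooth_sec v ->
  smooth_vf (fun g => left_inv (v (src g))).
Proof.
move=> sv; apply: smooth_rel_field => g0.
exists (pullback_sec (fun=> (0, 0)) (fun=> 0) (fun x => iota x (v x))).
  apply: smooth_pullback_sec; [exact: smooth_TT0 | exact: smooth_E0 | exact/(smooth_iota mp)].
apply: filterE => g; exists 0, 0, (iota _ (v (src g))); split=> //.
exact: (rel_left am).
Qed.

Definition fibre_section (k : section P) : Prop :=
  [/\ smooth_sec k, forall q, (k q).1 = 0, forall q, C q.2.1 (k q).2.1 &
      forall q, C q.2.2 (k q).2.2].

Definition fibre_pair (a c : arr G -> section E) : section P := fun q =>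
  (0, (a q.1 q.2.1, c q.1 q.2.2)).

(** Sections of C with a parameter in G: jointly smooth over the base of P, also without target
    component, and smooth over M for a frozen parameter, which gives pull-back sections. *)
Definition complement_family (a c : arr G -> section E) : Prop :=
  [/\ smooth_sec (fibre_pair a c), smooth_sec (fibre_pair (fun _ _ => 0) c),
      forall g, smooth_sec (a g), forall g, smooth_sec (c g) &
      forall g x, C x (a g x) /\ C x (c g x)].

(* The frames of A and C used here are valid near g0 only; the formula is still
   correct elsewhere because al vanishes there. *)
Lemma complement_lift g0 : exists V : set (arr G), [/\ open V, V g0 &
  forall al : covfield (arr G), smooth_cov al -> (forall g, ~ V g -> al g = 0) ->
  exists a c, complement_family a c /\
    forall g, a g (tgt g) = rightC iota C (al g) (tgt g) /\
      c g (src g) = leftC iota C (al g) (src g)].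
Proof.
have [r1 [u [c [su sc Cc uE _]]]] := dual_frame lG mp cC (tgt g0).
have [r2 [v [d [sv sd Cd vE _]]]] := dual_frame lG mp cC (src g0).
have [V [oV Vg0] HV] : exists2 V : set (arr G), open V /\ V g0 & forall g, V g ->
   (forall w, w = \sum_i pairing (c i (tgt g)) (iota (tgt g) w) *: u i (tgt g)) /\
   (forall w, w = \sum_i pairing (d i (src g)) (iota (src g) w) *: v i (src g)).
  apply: near_openP; apply: filterI.
    by have [ct _] := smooth_map_tgt lG; exact: (ct g0 I _ uE).
  by have [ct _] := smooth_map_src lG; exact: (ct g0 I _ vE).
exists V; split=> // al sal al0.
pose a i g : R := al g (right_inv (u i (tgt g))).
pose b i g : R := - (al g (left_inv (v i (src g))) : R).
have sa i : smooth_fun (a i) by apply: sal; exact: (smooth_right_vf (su i)).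
have sb i : smooth_fun (b i).
  by apply: (smoothN Ga); apply: sal; exact: (smooth_left_vf (sv i)).
have Kr : smooth_sec ((fun q => \sum_i a i q.1 *: pullback_sec (fun=> (0,
  0)) (c i) (fun=> 0) q) : section P).
  apply: (smooth_sec_sum PV (c := fun i q => a i q.1)) => i.
    exact: (smooth_fst Ga OOa (sa i)).
  by apply: smooth_pullback_sec; [exact: smooth_TT0 | exact: sc | exact: smooth_E0].
have Kl : smooth_sec ((fun q => \sum_i b i q.1 *: pullback_sec (fun=> (0,
  0)) (fun=> 0) (d i) q) : section P).
  apply: (smooth_sec_sum PV (c := fun i q => b i q.1)) => i.
    exact: (smooth_fst Ga OOa (sb i)).
  by apply: smooth_pullback_sec; [exact: smooth_TT0 | exact: smooth_E0 | exact: sd].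
exists (fun g x => \sum_i a i g *: c i x), (fun g x => \sum_i b i g *: d i x).
split; first split.
- apply: (smooth_sec_ext _ (smooth_secD PV Kr Kl)) => q; symmetry.
  exact: (@sum_pair2 _ (tangent q.1 * cotangent q.1)%type (E q.2.1) (E q.2.2)).
- apply: (smooth_sec_ext _ Kl) => q; symmetry.
  have := @sum_pair2 _ (tangent q.1 * cotangent q.1)%type (E q.2.1) (E q.2.2) 0 r2 (fun=> 0)
    (fun i => b i q.1) (fun=> 0) (fun i => d i q.2.2).
  by rewrite !big_ord0 add0r.
- move=> g; apply: (smooth_sec_sum EV (c := fun i _ => a i g)) => // i; exact: smooth_cst.
- move=> g; apply: (smooth_sec_sum EV (c := fun i _ => b i g)) => // i; exact: smooth_cst.
- move=> g x; split; first exact: (complement_sum cC _ (fun i => Cc i x)).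
  exact: (complement_sum cC _ (fun i => Cd i x)).
move=> g; split.
  apply: (complement_ext mp cC); first exact: (complement_sum cC _ (fun i => Cc i (tgt g))).
    exact: (rightC_in am cC).
  move=> w; rewrite (rightCE am cC) (pairing_suml EC).
  have [Vg|/al0 Vg] := pselect (V g).
    rewrite -(right_pullE lG) [in RHS]((HV g Vg).1 w) (linear_form_sum (dual_linear _)).
    apply: eq_bigr => i _.
    by rewrite (linear_formZ (dual_linear _)) (right_pullE lG) (pairingZl EC) mulrC.
  by rewrite [al g]Vg big1// => i _; rewrite /a Vg (pairingZl EC) mul0r.
apply: (complement_ext mp cC); first exact: (complement_sum cC _ (fun i => Cd i (src g))).
  exact: (leftC_in am cC).
move=> w; rewrite (leftCE am cC) (pairing_suml EC).
have [Vg|/al0 Vg] := pselect (V g).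
  rewrite -(left_pullE lG) [in RHS]((HV g Vg).2 w) (linear_form_sum (dual_linear _)) -sumrN.
  apply: eq_bigr => i _; rewrite (linear_formZ (dual_linear _)) (left_pullE lG) (pairingZl EC).
  by rewrite /b mulrC mulrN.
by rewrite [al g]Vg oppr0 big1// => i _; rewrite /b Vg (pairingZl EC) oppr0 mul0r.
Qed.

Lemma fibre_pairP a c : complement_family a c -> fibre_section (fibre_pair a c).
Proof. by case=> sk _ _ _ Cac; split=> // q; case: (Cac q.1 q.2.1); case: (Cac q.1 q.2.2). Qed.

Lemma fibre_sectionE (k : section P) q : fibre_section k -> k q = (0, (k q).2).
Proof. by case=> _ k1 _ _; rewrite -(k1 q) -surjective_pairing. Qed.

Lemma smooth_sharp (al : covfield (arr G)) : smooth_cov al ->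
  smooth_vf (fun g => sharp iota Rel C (al g)).
Proof.
move=> sal; apply: smooth_rel_field => g0.
have [V [oV Vg0 HV]] := complement_lift g0.
have [b [sb b1 b0]] := bump Ga oV Vg0.
(* The field b al vanishes outside V, as [complement_lift] requires, and agrees with al near g0. *)
have sbal := smooth_covZ Ga sb sal.
have [|a [c [fac acE]]] := HV (fun g => b g *: al g) sbal.
  by move=> g Vg; rewrite (nbhs_singleton (b0 g Vg)) scale0r.
pose k := fibre_pair a c; have fk : fibre_section k := fibre_pairP fac.
have kE g : k (anchor_graph g) = (0, (rightC iota C (b g *: al g) (tgt g),
    leftC iota C (b g *: al g) (src g))).
  by rewrite /k /fibre_pair /= (acE g).1 (acE g).2.
exists (fun q => pullback_sec (fun g => (0, b g *: al g)) (fun=> 0) (fun=> 0) q + k q).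
  apply: (smooth_secD PV); last by case: fk.
  apply: smooth_pullback_sec; try exact: smooth_E0.
  by apply: smooth_TT => //; exact: smooth_vf0.
apply: filterS b1 => g b1; rewrite kE b1 scale1r.
exists (al g), (rightC iota C (al g) (tgt g)), (leftC iota C (al g) (src g)).
split; last exact: (sharpP am cC).
rewrite /pullback_sec /= b1 scale1r; congr ((_, _), (_, _)); rewrite /= ?addr0 ?add0r//.
Qed.

Lemma smooth_sharp_bivector : is_bivector_field (sharp_bivector iota Rel C).
Proof.
split; first exact: (sharp_bivector_alternating am cC).
by move=> al be sal sbe; apply: sbe; exact: smooth_sharp.
Qed.

(** This is s_F once [k] takes the values forced by dF on the graph. Leaving [k] free allows its
    replacement by a pull-back with the same value at one point. *)
Definition sharp_section (F : arr G -> R) (k : section P) : section P := fun q =>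
  pullback_sec (fun g => (sharp iota Rel C (diff1 F g), diff1 F g)) (fun=> 0) (fun=> 0) q + k q.

Lemma sharp_sectionE F k g : fibre_section k ->
  k (anchor_graph g) = (0, (rightC iota C (diff1 F g) (tgt g), leftC iota C (diff1 F g) (src g))) ->
  sharp_section F k (anchor_graph g) = ((sharp iota Rel C (diff1 F g), diff1 F g),
     (rightC iota C (diff1 F g) (tgt g), leftC iota C (diff1 F g) (src g))).
Proof.
move=> fk kE; rewrite /sharp_section kE /pullback_sec.
by congr ((_, _), (_, _)); rewrite /= ?addr0 ?add0r.
Qed.

Lemma smooth_sharp_section F k : smooth_fun F -> fibre_section k -> smooth_sec (sharp_section F k).
Proof.
move=> sF [sk _ _ _]; apply: (smooth_secD PV) => //.
apply: smooth_pullback_sec; try exact: smooth_E0.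
by apply: smooth_TT; [apply: smooth_sharp|]; exact: smooth_cov_diff1.
Qed.

(** The function is cut off, not its differential: the covector field then vanishes outside V and
    remains exact. *)
Lemma sharp_family_lift g0 : exists2 b : arr G -> R, smooth_fun b /\ (\forall g \near g0, b g = 1) &
  forall f, smooth_fun f -> exists a c, complement_family a c /\
    forall g, a g (tgt g) = rightC iota C (diff1 (fun y => b y * f y) g) (tgt g) /\
      c g (src g) = leftC iota C (diff1 (fun y => b y * f y) g) (src g).
Proof.
have [V [oV Vg0 HV]] := complement_lift g0.
have [b [sb b1 b0]] := bump Ga oV Vg0; exists b => // f sf.
have sbf := smoothM Ga sb sf.
apply: HV; first exact: smooth_cov_diff1.
move=> g Vg; apply: dual_ext => v; rewrite diff1E.
rewrite (der_local Ga (tangent_derivation v) sbf (smooth_cst 0)).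
  exact: (der_cst (tangent_derivation v)).
by apply: filterS (b0 g Vg) => y ->; rewrite mul0r.
Qed.

Lemma sharp_section_lift g0 : exists2 b : arr G -> R, smooth_fun b /\ (\forall g \near g0, b g =
  1) &
  forall f, smooth_fun f -> exists2 k : section P, fibre_section k &
    forall g, k (anchor_graph g) = (0, (rightC iota C (diff1 (fun y => b y * f y) g) (tgt g),
      leftC iota C (diff1 (fun y => b y * f y) g) (src g))).
Proof.
have [b Hb lift] := sharp_family_lift g0; exists b => // f /lift[a [c [fac acE]]].
exists (fibre_pair a c); first exact: fibre_pairP.
by move=> g; rewrite /fibre_pair /= (acE g).1 (acE g).2.
Qed.

End PSections.

(** * The quasi-Poisson identities *)

Section Dorfman.
Context {R : realType}.
Variables (M : @premanifold R).
Hypothesis Ma : smooth_atlas M.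
Implicit Types (X Y : vfield M).

(** L_X dh = d(X h), and the term i_Y d(df) vanishes. *)
Lemma dorfman_exact X Y (f h : M -> R) (x : M) : smooth_vf X -> smooth_vf Y ->
  smooth_fun f -> smooth_fun h ->
  dorfman (fun y => (X y, diff1 f y)) (fun y => (Y y, diff1 h y)) x =
  (lie X Y x, diff1 (fun y => X y h) x).
Proof.
move=> sX sY sf sh; rewrite /dorfman; congr (_, _); rewrite [in RHS]/diff1; congr mkdual.
apply/funext => w; have [sW Ww] := extend_vfP Ma w.
rewrite !diff1E !(lieE Ma)//.
rewrite (_ : (fun y => diff1 h y (extend_vf w y)) = (fun y => extend_vf w y h)); last first.
  by apply/funext => y; rewrite diff1E.
rewrite (_ : (fun y => diff1 f y (extend_vf w y)) = (fun y => extend_vf w y f)); last first.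
  by apply/funext => y; rewrite diff1E.
rewrite (_ : (fun y => diff1 f y (Y y)) = (fun y => Y y f)); last first.
  by apply/funext => y; rewrite diff1E.
rewrite Ww; ring.
Qed.

Lemma courant3_exact X Y Z (f h k : M -> R) (x : M) : smooth_vf X -> smooth_vf Y ->
  smooth_fun f -> smooth_fun h -> smooth_fun k ->
  courant3 (E := standard_courant M) (fun y => (X y, diff1 f y)) (fun y => (Y y, diff1 h y))
    (fun y => (Z y, diff1 k y)) x =
  Z x (fun y => X y h) + X x (fun y => Y y k) - Y x (fun y => X y k).
Proof.
move=> sX sY sf sh sk.
by rewrite /courant3 [bracket _ _ _](dorfman_exact x sX sY sf sh) /= !diff1E (lieE Ma)// addrA.
Qed.

End Dorfman.

(** * Brackets of the lifted sections and the Jacobiator of pi *)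

Section CourantTensor.
Context {R : realType}.
Variables (G : @pregroupoid R) (E : precourant (obj G))
  (iota : forall x : obj G, {linear algebroid G x -> E x})
  (B : bracket_of (prod_bundle E (opp_courant E)))
  (B' : bracket_of (prod_bundle (standard_courant (arr G)) (opp_courant (prod_courant B))))
  (Rel : anchor_relation G E)
  (C : forall x : obj G, set (E x)).
Arguments Rel : clear implicits.
Arguments C : clear implicits.
Hypotheses (am : action_morphism iota B' Rel) (cC : isotropic_complement iota C).
Local Notation lG := (am_groupoid am).
Local Notation mp := (am_pair am).
Local Notation Ga := (arr_atlas lG).
Local Notation P := (prod_courant B').
Local Notation PC := (am_product' am).1.
Implicit Types (g : arr G) (e h : section E) (t : section (TTstar (arr G))).


Definition tau (F : arr G -> R) : section (TTstar (arr G)) :=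
  fun g => (sharp iota Rel C (diff1 F g), diff1 F g).

Local Notation hs := (sharp_section (B := B) (B' := B') iota Rel C).

(** Skew-symmetry of pi cancels the TG-terms and isotropy of C kills the others. This holds over the
    whole base of P and not just on the graph, as tensoriality requires. *)
Lemma sharp_section_iso F H (k l : section P) : fibre_section (B' := B') C k ->
  fibre_section (B' := B') C l ->
  forall q, pairing (hs F k q) (hs H l q) = 0.
Proof.
move=> fk fl q.
have [_ _ Ck Ck'] := fk; have [_ _ Cl Cl'] := fl.
rewrite /sharp_section (fibre_sectionE q fk) (fibre_sectionE q fl) /=.
rewrite !add0r (complement_isotropic cC (Ck q) (Cl q)) (complement_isotropic cC (Ck' q) (Cl' q)).
rewrite !addr0 oppr0 addr0 !oppr0 addr0.
by rewrite (sharp_skew am cC (diff1 F q.1) (diff1 H q.1)) addrN.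
Qed.

Lemma courant3_sharp F1 F2 F3 (k1 k2 k3 l1 l2 l3 : section P) q :
  smooth_fun F1 -> smooth_fun F2 -> smooth_fun F3 ->
  fibre_section (B' := B') C k1 -> fibre_section (B' := B') C k2 -> fibre_section (B' := B') C k3 ->
  fibre_section (B' := B') C l1 -> fibre_section (B' := B') C l2 -> fibre_section (B' := B') C l3 ->
  k1 q = l1 q -> k2 q = l2 q -> k3 q = l3 q ->
  courant3 (E := P) (hs F1 k1) (hs F2 k2) (hs F3 k3) q =
  courant3 (E := P) (hs F1 l1) (hs F2 l2) (hs F3 l3) q.
Proof.
move=> s1 s2 s3 fk1 fk2 fk3 fl1 fl2 fl3 e1 e2 e3.
have t F k : smooth_fun F -> fibre_section (B' := B') C k -> smooth_sec (hs F k).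
  exact: smooth_sharp_section am cC F k.
have ev F k l : k q = l q -> hs F k q = hs F l q by rewrite /sharp_section => ->.
have iso := sharp_section_iso.
rewrite (courant3_tensor23 PC (t _ _ s1 fk1) (t _ _ s2 fk2) (t _ _ s3 fk3) (t _ _ s2 fl2)
  (t _ _ s3 fl3) (iso _ _ _ _ fk2 fl3) (iso _ _ _ _ fl2 fl3) (ev F2 _ _ e2) (ev F3 _ _ e3)).
rewrite (courant3_skew12 PC q (t _ _ s1 fk1) (t _ _ s2 fl2) (t _ _ s3 fl3) (iso _ _ _ _ fk1 fl2)).
rewrite (courant3_skew12 PC q (t _ _ s1 fl1) (t _ _ s2 fl2) (t _ _ s3 fl3) (iso _ _ _ _ fl1 fl2)).
by rewrite (courant3_tensor23 PC (t _ _ s2 fl2) (t _ _ s1 fk1) (t _ _ s3 fl3) (t _ _ s1 fl1)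
  (t _ _ s3 fl3) (iso _ _ _ _ fk1 fl3) (iso _ _ _ _ fl1 fl3) (ev F1 _ _ e1) erefl).
Qed.

Lemma courant3_pullback_sec t1 t2 t3 e1 e2 e3 h1 h2 h3 q :
  smooth_sec t1 -> smooth_sec t2 -> smooth_sec e1 -> smooth_sec e2 ->
  smooth_sec h1 -> smooth_sec h2 ->
  courant3 (E := P) (pullback_sec B' t1 e1 h1) (pullback_sec B' t2 e2 h2) (pullback_sec B' t3 e3
    h3) q =
  courant3 (E := standard_courant (arr G)) t1 t2 t3 q.1 - courant3 e1 e2 e3 q.2.1 +
  courant3 h1 h2 h3 q.2.2.
Proof.
move=> st1 st2 se1 se2 sh1 sh2; rewrite {1}/courant3 (bracket_pullback_sec am)//.
by rewrite /pullback_sec /courant3 /= opprD opprK addrA.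
Qed.

Lemma rel_courant3 (s1 s2 s3 : section P) : smooth_sec s1 -> smooth_sec s2 ->
  (forall g, Rel g (s1 (anchor_graph g))) -> (forall g, Rel g (s2 (anchor_graph g))) ->
  forall g, Rel g (s3 (anchor_graph g)) -> courant3 (E := P) s1 s2 s3 (anchor_graph g) = 0.
Proof.
move=> ss1 ss2 r1 r2 g r3; have := am_bracket am ss1 ss2 r1 r2 g; rewrite /courant3.
case: (bracket s1 s2 _) => [[X al] [e h]]; case: (s3 _) r3 => [[X' al'] [e' h']] r3 r.
by rewrite (@prod_pairingE _ G E B B' g); exact: (rel_pairing am r r3).
Qed.

(** Has the C-components forced by [al] at the single point [anchor_graph g], and is a pull-back. *)
Definition point_fibre g (al : cotangent g) : section P :=
  pullback_sec B' (fun=> (0, 0)) (rightC iota C al) (leftC iota C al).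

Lemma point_fibreP g (al : cotangent g) : fibre_section (B' := B') C (point_fibre al).
Proof.
have [sr Cr _] := complement_sectionP lG mp cC (right_pull al).
have [sl Cl _] := complement_sectionP lG mp cC (- left_pull al).
split=> //.
exact: (smooth_pullback_sec B' (smooth_TT0 G) sr sl).
Qed.

Lemma sharp_point F g (al : cotangent g) :
  hs F (point_fibre al) = pullback_sec B' (tau F) (rightC iota C al) (leftC iota C al).
Proof.
apply: functional_extensionality_dep => q; rewrite /sharp_section /point_fibre /pullback_sec.
by congr ((_, _), (_, _)); rewrite /= ?addr0 ?add0r.
Qed.

Definition sharp_lift (F : arr G -> R) (k : section P) : Prop :=
  fibre_section (B' := B') C k /\
  forall g, k (anchor_graph g) =
    (0, (rightC iota C (diff1 F g) (tgt g), leftC iota C (diff1 F g) (src g))).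

Lemma rel_sharp_lift F k g : sharp_lift F k -> Rel g (hs F k (anchor_graph g)).
Proof. by case=> fk kE; rewrite (sharp_sectionE Rel fk (kE g)); exact: (sharpP am cC). Qed.

Lemma smooth_rightC g (al : cotangent g) : smooth_sec (rightC iota C al).
Proof. by have [] := complement_sectionP lG mp cC (right_pull al). Qed.

Lemma smooth_leftC g (al : cotangent g) : smooth_sec (leftC iota C al).
Proof. by have [] := complement_sectionP lG mp cC (- left_pull al). Qed.

(** [leftC] represents minus the transpose, and three signs make one. *)
Lemma chi_leftC g (a1 a2 a3 : cotangent g) :
  courant3 (leftC iota C a1) (leftC iota C a2) (leftC iota C a3) (src g) =
  - triple_chi iota C (left_pull a1) (left_pull a2) (left_pull a3).
Proof.
have [c1 [c2 c3]] := triple_chi_alternating lG mp cC (src g).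
rewrite -[LHS]/(triple_chi iota C (- left_pull a1) (- left_pull a2) (- left_pull a3)).
have h3 := linear_formN ((c1 (- left_pull a1)).1 (- left_pull a2)) (left_pull a3).
have h2 := linear_formN ((c1 (- left_pull a1)).2.2 (left_pull a3)) (left_pull a2).
have h1 := linear_formN ((c2 (left_pull a2)).2.2 (left_pull a3)) (left_pull a1).
by rewrite h3 [X in - X]h2 h1 opprK.
Qed.

Lemma smooth_tau F : smooth_fun F -> smooth_sec (tau F).
Proof. by move=> sF; split; [apply: (smooth_sharp am cC)|]; exact: smooth_cov_diff1. Qed.

(** Freezing the C-components at g makes the bracket componentwise. Both copies of chi appear with a
    minus: over the target from the opposite pairing, over the source from the three signs in
    [leftC]. *)
Lemma courant3_tau F1 F2 F3 (k1 k2 k3 : section P) g :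
  smooth_fun F1 -> smooth_fun F2 -> smooth_fun F3 ->
  fibre_section (B' := B') C k1 -> fibre_section (B' := B') C k2 -> fibre_section (B' := B') C k3 ->
  forall a1 a2 a3 : cotangent g,
  k1 (anchor_graph g) = (0, (rightC iota C a1 (tgt g), leftC iota C a1 (src g))) ->
  k2 (anchor_graph g) = (0, (rightC iota C a2 (tgt g), leftC iota C a2 (src g))) ->
  k3 (anchor_graph g) = (0, (rightC iota C a3 (tgt g), leftC iota C a3 (src g))) ->
  courant3 (E := P) (hs F1 k1) (hs F2 k2) (hs F3 k3) (anchor_graph g) =
  courant3 (E := standard_courant (arr G)) (tau F1) (tau F2) (tau F3) g
  - triple_chi iota C (right_pull a1) (right_pull a2) (right_pull a3)
  - triple_chi iota C (left_pull a1) (left_pull a2) (left_pull a3).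
Proof.
move=> s1 s2 s3 f1 f2 f3 a1 a2 a3 e1 e2 e3.
rewrite (courant3_sharp s1 s2 s3 f1 f2 f3 (point_fibreP a1) (point_fibreP a2) (point_fibreP a3))//.
rewrite !sharp_point courant3_pullback_sec ?chi_leftC //; try exact: smooth_tau;
  try exact: smooth_rightC;
  exact: smooth_leftC.
Qed.

Definition pbracket (F H : arr G -> R) : arr G -> R := fun g => sharp iota Rel C (diff1 F g) H.

Lemma smooth_pbracket F H : smooth_fun F -> smooth_fun H -> smooth_fun (pbracket F H).
Proof. by move=> sF sH; apply: (smooth_sharp am cC) => //; exact: smooth_cov_diff1. Qed.

Lemma diff1_near F F' g0 : smooth_fun F -> smooth_fun F' -> (\forall g \near g0, F g = F' g) ->
  \forall g \near g0, diff1 F g = diff1 F' g.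
Proof.
move=> sF sF' /near_openP[U [oU Ug0] UE].
apply: filterS (open_nbhs_nbhs (conj oU Ug0)) => g Ug; apply: dual_ext => v; rewrite !diff1E.
apply: (der_local Ga (tangent_derivation v)) => //.
by apply: filterS (open_nbhs_nbhs (conj oU Ug)) => y /UE.
Qed.

Lemma pbracket_near F F' H H' g0 : smooth_fun F -> smooth_fun F' -> smooth_fun H -> smooth_fun H' ->
  (\forall g \near g0, F g = F' g) -> (\forall g \near g0, H g = H' g) ->
  \forall g \near g0, pbracket F H g = pbracket F' H' g.
Proof.
move=> sF sF' sH sH' FE HE; apply: filterS2 (diff1_near sF sF' FE) (diff1_near sH sH' HE) => g
  FE' HE'.
by rewrite /pbracket FE' -(diff1E H) HE' diff1E.
Qed.

Lemma courant3_tauE F1 F2 F3 g : smooth_fun F1 -> smooth_fun F2 -> smooth_fun F3 ->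
  courant3 (E := standard_courant (arr G)) (tau F1) (tau F2) (tau F3) g =
  pbracket F3 (pbracket F1 F2) g + pbracket F1 (pbracket F2 F3) g - pbracket F2 (pbracket F1 F3) g.
Proof.
move=> s1 s2 s3; have sm F : smooth_fun F -> smooth_vf (fun g => sharp iota Rel C (diff1 F g)).
  by move=> sF; apply: (smooth_sharp am cC); exact: smooth_cov_diff1.
exact: (courant3_exact Ga _ _ (sm _ s1) (sm _ s2) s1 s2 s3).
Qed.

Lemma sharp_jacobi F1 F2 F3 g : smooth_fun F1 -> smooth_fun F2 -> smooth_fun F3 ->
  pbracket F3 (pbracket F1 F2) g + pbracket F1 (pbracket F2 F3) g - pbracket F2 (pbracket F1 F3) g =
  triple_chi iota C (right_pull (diff1 F1 g)) (right_pull (diff1 F2 g)) (right_pull (diff1 F3 g)) +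
  triple_chi iota C (left_pull (diff1 F1 g)) (left_pull (diff1 F2 g)) (left_pull (diff1 F3 g)).
Proof.
move=> s1 s2 s3; have [b [sb b1] lift] := sharp_section_lift am cC g.
have [k1 f1 e1] := lift _ s1; have [k2 f2 e2] := lift _ s2; have [k3 f3 e3] := lift _ s3.
have sbF F : smooth_fun F -> smooth_fun (fun y => b y * F y) by move=> sF;
  exact: (smoothM Ga sb sF).
have nE F : \forall y \near g, F y = b y * F y by apply: filterS b1 => y ->; rewrite mul1r.
have dE F : smooth_fun F -> diff1 F g = diff1 (fun y => b y * F y) g.
  by move=> sF; exact: (nbhs_singleton (diff1_near sF (sbF _ sF) (nE F))).
(* Both sides of the identity only depend on germs at g, so each F may be replaced by b F. *)
have pE F H K : smooth_fun F -> smooth_fun H -> smooth_fun K ->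
    pbracket F (pbracket H K) g =
    pbracket (fun y => b y * F y) (pbracket (fun y => b y * H y) (fun y => b y * K y)) g.
  move=> sF sH sK; have h := pbracket_near sH (sbF _ sH) sK (sbF _ sK) (nE H) (nE K).
  exact: (nbhs_singleton (pbracket_near sF (sbF _ sF) (smooth_pbracket sH sK)
    (smooth_pbracket (sbF _ sH) (sbF _ sK)) (nE F) h)).
rewrite (pE F3 F1 F2)// (pE F1 F2 F3)// (pE F2 F1 F3)// (dE F1)// (dE F2)// (dE F3)//.
have := courant3_tau (sbF _ s1) (sbF _ s2) (sbF _ s3) f1 f2 f3 (e1 g) (e2 g) (e3 g).
have rs F k : fibre_section (B' := B') C k -> (forall g, k (anchor_graph g) =
    (0, (rightC iota C (diff1 F g) (tgt g), leftC iota C (diff1 F g) (src g)))) ->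
    forall g, Rel g (hs F k (anchor_graph g)).
  by move=> fk ek g'; exact: (rel_sharp_lift g' (conj fk ek)).
rewrite (rel_courant3 (smooth_sharp_section am cC (sbF _ s1) f1)
  (smooth_sharp_section am cC (sbF _ s2) f2) (rs _ _ f1 e1) (rs _ _ f2 e2) (rs _ _ f3 e3 g)).
rewrite (courant3_tauE g (sbF _ s1) (sbF _ s2) (sbF _ s3)) => h.
by apply/eqP; rewrite -subr_eq0 opprD addrA -h.
Qed.

End CourantTensor.

(** * Alternating sums over permutations *)

Section AlternatingSums.
Context {R : realType}.

(* Decompose s into transpositions. *)
Lemma alternating_perm n (X : Type) (h : ('I_n -> X) -> R) (f : 'I_n -> X) (s : {perm 'I_n}) :
  (forall f x y, x != y -> h (fun k => f (tperm x y k)) = - h f) ->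
  (-1) ^+ s * h (fun k => f (s k)) = h f.
Proof.
move=> ht; have [ts -> dts] := prod_tpermP s.
elim: ts f dts => [|t ts IH] f /= => [_|/andP[t12 dts]].
  rewrite big_nil odd_perm1 mul1r; congr h.
  by apply/funext => k; rewrite perm1.
rewrite big_cons odd_permM odd_tperm.
have -> : (fun k => f ((tperm t.1 t.2 * \prod_(t0 <- ts) tperm t0.1 t0.2)%g k)) =
    (fun k => (fun j => f ((\prod_(t0 <- ts) tperm t0.1 t0.2)%g j)) (tperm t.1 t.2 k)).
  by apply/funext => k; rewrite permM.
rewrite (ht (fun j => f ((\prod_(t0 <- ts) tperm t0.1 t0.2)%g j)) _ _ t12).
by rewrite t12 signr_addb expr1 mulN1r mulrNN -[RHS](IH f dts).
Qed.

Lemma sum_tperm n (x y : 'I_n) (h : ('I_n -> 'I_n) -> R) : x != y ->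
  \sum_(s : {perm 'I_n}) (-1) ^+ s * h (fun k => s (tperm x y k)) =
  - \sum_(s : {perm 'I_n}) (-1) ^+ s * h s.
Proof.
move=> xy; rewrite [in RHS](reindex_inj (mulgI (tperm x y))) -sumrN; apply: eq_bigr => s _.
rewrite odd_permM odd_tperm xy signr_addb expr1 mulN1r mulNr opprK; congr (_ * h _).
by apply/funext => k; rewrite permM.
Qed.

(** The sum in [schouten_comp] as a function of its summand; the swap lemmas express every reindexed
    summand through the same sum. *)
Definition altsum3 (a : 'I_3 -> 'I_3 -> 'I_3 -> R) : R :=
  \sum_(s : {perm 'I_3}) (-1) ^+ s * a (s (inord 0)) (s (inord 1)) (s (inord 2)).

Definition altsum4 (a : 'I_4 -> 'I_4 -> 'I_4 -> 'I_4 -> R) : R :=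
  \sum_(s : {perm 'I_4})
    (-1) ^+ s * a (s (inord 0)) (s (inord 1)) (s (inord 2)) (s (inord 3)).

Lemma inord_neq n i j : (i <= n)%N -> (j <= n)%N -> i != j -> inord i != inord j :> 'I_n.+1.
Proof. by move=> li lj ij; apply/eqP => /(congr1 val); rewrite !val_insubd !ltnS li lj;
  exact/eqP. Qed.

Ltac tperm_inord := rewrite ?tpermL ?tpermR ?tpermD //; try exact: inord_neq.

Lemma altsum3_swap12 a : altsum3 (fun i j k => a j i k) = - altsum3 a.
Proof.
rewrite /altsum3 -(@sum_tperm 3 (inord 0) (inord 1)
  (fun s => a (s (inord 0)) (s (inord 1)) (s (inord 2)))); last exact: inord_neq.
by apply: eq_bigr => s _; tperm_inord.
Qed.

Lemma altsum3_swap23 a : altsum3 (fun i j k => a i k j) = - altsum3 a.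
Proof.
rewrite /altsum3 -(@sum_tperm 3 (inord 1) (inord 2)
  (fun s => a (s (inord 0)) (s (inord 1)) (s (inord 2)))); last exact: inord_neq.
by apply: eq_bigr => s _; tperm_inord.
Qed.

Lemma altsum4_swap12 a : altsum4 (fun i j k l => a j i k l) = - altsum4 a.
Proof.
rewrite /altsum4 -(@sum_tperm 4 (inord 0) (inord 1)
  (fun s => a (s (inord 0)) (s (inord 1)) (s (inord 2)) (s (inord 3)))); last exact: inord_neq.
by apply: eq_bigr => s _; tperm_inord.
Qed.

Lemma altsum4_swap23 a : altsum4 (fun i j k l => a i k j l) = - altsum4 a.
Proof.
rewrite /altsum4 -(@sum_tperm 4 (inord 1) (inord 2)
  (fun s => a (s (inord 0)) (s (inord 1)) (s (inord 2)) (s (inord 3)))); last exact: inord_neq.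
by apply: eq_bigr => s _; tperm_inord.
Qed.

Lemma altsum4_swap34 a : altsum4 (fun i j k l => a i j l k) = - altsum4 a.
Proof.
rewrite /altsum4 -(@sum_tperm 4 (inord 2) (inord 3)
  (fun s => a (s (inord 0)) (s (inord 1)) (s (inord 2)) (s (inord 3)))); last exact: inord_neq.
by apply: eq_bigr => s _; tperm_inord.
Qed.

Lemma altsum3D a b : altsum3 (fun i j k => a i j k + b i j k) = altsum3 a + altsum3 b.
Proof. by rewrite /altsum3 -big_split; apply: eq_bigr => s _; rewrite mulrDr. Qed.

Lemma altsum4D a b : altsum4 (fun i j k l => a i j k l + b i j k l) = altsum4 a + altsum4 b.
Proof. by rewrite /altsum4 -big_split; apply: eq_bigr => s _; rewrite mulrDr. Qed.

Lemma altsum4N a : altsum4 (fun i j k l => - a i j k l) = - altsum4 a.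
Proof. by rewrite /altsum4 -sumrN; apply: eq_bigr => s _; rewrite mulrN. Qed.

Lemma I3_cases (x : 'I_3) : [\/ x = inord 0, x = inord 1 | x = inord 2].
Proof.
case: x => -[|[|[|x]]] hx //; [apply: Or31|apply: Or32|apply: Or33];
  by apply/val_inj; rewrite /= inordK.
Qed.

Lemma altsum3_alternating (X : Type) (T : X -> X -> X -> R) (f : 'I_3 -> X) :
  (forall a b c, T a b c = - T b a c) -> (forall a b c, T a b c = - T a c b) ->
  altsum3 (fun i j k => T (f i) (f j) (f k)) = 6%:R * T (f (inord 0)) (f (inord 1)) (f (inord 2)).
Proof.
move=> T12 T23; pose h (f : 'I_3 -> X) := T (f (inord 0)) (f (inord 1)) (f (inord 2)).
have T13 a b c : T a b c = - T c b a by rewrite T12 T23 opprK T12.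
have ht (f' : 'I_3 -> X) x y : x != y -> h (fun k => f' (tperm x y k)) = - h f'.
  by case: (I3_cases x) (I3_cases y) => -> [] -> // xy; rewrite /h; tperm_inord;
    rewrite ?eqxx in xy * => //; rewrite // ?[LHS]T12 // ?[LHS]T23 // ?[LHS]T13.
rewrite /altsum3 (eq_bigr (fun _ => h f)) => [|s _]; last exact: (alternating_perm f s ht).
by rewrite sumr_const card_Sn -[_ *+ _]mulr_natl.
Qed.

End AlternatingSums.

(** * The Schouten square of pi and the integration conditions *)

Section QuasiPoisson.
Context {R : realType}.
Variables (G : @pregroupoid R) (E : precourant (obj G))
  (iota : forall x : obj G, {linear algebroid G x -> E x})
  (B : bracket_of (prod_bundle E (opp_courant E)))
  (B' : bracket_of (prod_bundle (standard_courant (arr G)) (opp_courant (prod_courant B))))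
  (Rel : anchor_relation G E)
  (C : forall x : obj G, set (E x)).
Arguments Rel : clear implicits.
Arguments C : clear implicits.
Hypotheses (am : action_morphism iota B' Rel) (cC : isotropic_complement iota C).
Local Notation lG := (am_groupoid am).
Local Notation mp := (am_pair am).
Local Notation Ga := (arr_atlas lG).
Local Notation Oa := (obj_atlas lG).
Local Notation EC := (manin_courant mp).
Local Notation P := (prod_courant B').
Local Notation PC := (am_product' am).1.
Implicit Types (g : arr G) (e h : section E) (t : section (TTstar (arr G))).


Local Notation hs := (sharp_section (B := B) (B' := B') iota Rel C).
Local Notation chi := (triple_chi iota C).
Local Notation rp := right_pull.
Local Notation lp := left_pull.
Local Notation pb := (pbracket iota Rel C).
Local Notation pi := (sharp_bivector iota Rel C).

Lemma pbracketC F H g : smooth_fun F -> smooth_fun H -> pb F H g = - pb H F g.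
Proof.
move=> sF sH; have := sharp_skew am cC (diff1 F g) (diff1 H g).
by rewrite !diff1E.
Qed.

Lemma of_bivectorE F g : of_bivector pi F g = pb (F 0%N) (F 1%N) g.
Proof. by rewrite /of_bivector /sharp_bivector diff1E. Qed.

(** With S the alternating sum of {{F_i, F_j}, F_k}, the Schouten bracket is -S, since each
    composition contributes S/2. Alternating the Jacobi identity counts S three times on one side
    and each chi term six times, with a minus, on the other: S = -2 (chi^r + i(chi)^l). *)
Lemma half_schouten (F : nat -> arr G -> R) g : (forall i, smooth_fun (F i)) ->
  2^-1 * schouten 1 1 (of_bivector pi) (of_bivector pi) F g =
  of_trivector (right_trivector chi) F g + of_trivector (left_trivector chi) F g.
Proof.
move=> sF; pose A (i j k : 'I_3) := pb (pb (F i) (F j)) (F k) g.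
have sp i j : smooth_fun (pb (F i) (F j)) by exact: (smooth_pbracket am cC).
pose Tr (a b c : arr G -> R) := chi (rp (diff1 a g)) (rp (diff1 b g)) (rp (diff1 c g)).
pose Tl (a b c : arr G -> R) := chi (lp (diff1 a g)) (lp (diff1 b g)) (lp (diff1 c g)).
have compE : schouten_comp 1 1 (of_bivector pi) (of_bivector pi) F g = 2^-1 * altsum3 A.
  rewrite /schouten_comp /altsum3 (_ : (2`! * 1`!)%:R = 2 :> R) //; congr (_ * _).
  apply: eq_bigr => s _; congr (_ * _); rewrite of_bivectorE /A.
  by rewrite /= addn0; congr (pb _ _ g); apply/funext => y; rewrite of_bivectorE.
have cyc : altsum3 (fun i j k => A i j k + (A j k i + A k i j)) = 3%:R * altsum3 A.
  rewrite !altsum3D (altsum3_swap12 (fun i j k => A i k j)) (altsum3_swap23 A).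
  by rewrite (altsum3_swap23 (fun i j k => A j i k)) (altsum3_swap12 A); ring.
have jac : altsum3 (fun i j k => A i j k + (A j k i + A k i j)) =
    altsum3 (fun i j k => - (Tr (F i) (F j) (F k)) + - (Tl (F i) (F j) (F k))).
  rewrite /altsum3; apply: eq_bigr => s _; congr (_ * _).
  set i := s _; set j := s _; set k := s _.
  have := sharp_jacobi am cC g (sF i) (sF j) (sF k).
  rewrite -/(Tr (F i) (F j) (F k)) -/(Tl (F i) (F j) (F k)) /A.
  rewrite (pbracketC g (sF k) (sp i j)) (pbracketC g (sF i) (sp j k)) (pbracketC g (sF j) (sp i k)).
  have -> : pb (F k) (F i) = fun y => - pb (F i) (F k) y.
    by apply/funext => y; exact: pbracketC.
  rewrite (pbracketC g (smoothN Ga (sp i k)) (sF j)).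
  rewrite (pbracketC g (sp i k) (sF j)).
  have -> : pb (F j) (fun y => - pb (F i) (F k) y) g = - pb (F j) (pb (F i) (F k)) g.
    exact: (derN (tangent_derivation _) (sp i k)).
  by move=> h; rewrite -opprD -h; ring.
have Tsum (T : (arr G -> R) -> (arr G -> R) -> (arr G -> R) -> R) :
    (forall a b c, T a b c = - T b a c) -> (forall a b c, T a b c = - T a c b) ->
    altsum3 (fun i j k => - T (F i) (F j) (F k)) = - (6%:R * T (F 0%N) (F 1%N) (F 2%N)).
  move=> T12 T23.
  have -> : altsum3 (fun i j k => - T (F i) (F j) (F k)) =
    - altsum3 (fun i j k => T (F i) (F j) (F k)).
    by rewrite /altsum3 -sumrN; apply: eq_bigr => s _; rewrite mulrN.
  congr (- _); rewrite (altsum3_alternating (fun i : 'I_3 => F i) T12 T23).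
  by congr (_ * T (F _) (F _) (F _)); rewrite inordK.
have hr := Tsum Tr (fun a b' c => triple_chi_skew12 lG mp cC _ _ _)
  (fun a b' c => triple_chi_skew23 lG mp cC _ _ _).
have hl := Tsum Tl (fun a b' c => triple_chi_skew12 lG mp cC _ _ _)
  (fun a b' c => triple_chi_skew23 lG mp cC _ _ _).
move: jac; rewrite cyc altsum3D hr hl.
move=> h; rewrite /schouten compE -[of_trivector _ F g]/(Tr (F 0%N) (F 1%N) (F 2%N)).
rewrite -[of_trivector (left_trivector _) F g]/(Tl (F 0%N) (F 1%N) (F 2%N)) /=.
by rewrite expr1; lra.
Qed.

Lemma right_action_bivector (u : section (algebroid G)) (f h : arr G -> R) g : smooth_sec u ->
  smooth_fun f -> smooth_fun h ->
  lie_derivative_bivector (right_vf u) pi f h g =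
  - right_bivector (dstar_sec iota C u) (diff1 f g) (diff1 h g).
Proof.
move=> su sf sh; have [b [sb b1] lift] := sharp_section_lift am cC g.
have [k1 f1 e1] := lift _ sf; have [k2 f2 e2] := lift _ sh.
have sX := smooth_right_vf am cC su.
pose f' y := b y * f y; pose h' y := b y * h y.
have sf' : smooth_fun f' := smoothM Ga sb sf; have sh' : smooth_fun h' := smoothM Ga sb sh.
have nf : \forall y \near g, f y = f' y by apply: filterS b1 => y; rewrite /f' => ->; rewrite mul1r.
have nh : \forall y \near g, h y = h' y by apply: filterS b1 => y; rewrite /h' => ->; rewrite mul1r.
have sXf F : smooth_fun F -> smooth_fun (fun y => right_vf u y F) by exact: sX.
have nX F F' : smooth_fun F -> smooth_fun F' -> (\forall y \near g, F y = F' y) ->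
    \forall y \near g, right_vf u y F = right_vf u y F'.
  move=> sF sF' FE; apply: filterS (diff1_near am sF sF' FE) => y e.
  by rewrite -(diff1E F) e diff1E.
(* Functions cut off and terms reordered by skew-symmetry, to match what [courant3_exact] yields
   below. *)
have -> : lie_derivative_bivector (right_vf u) pi f h g =
    right_vf u g (pb f' h') + pb h' (fun y => right_vf u y f') g - pb f' (fun y => right_vf u y
      h') g.
  have -> : lie_derivative_bivector (right_vf u) pi f h g =
     right_vf u g (pb f h) - pb (fun y => right_vf u y f) h g - pb f (fun y => right_vf u y h) g.
    rewrite /lie_derivative_bivector /sharp_bivector !diff1E; congr (right_vf u g _ - _ - _).
    by apply/funext => y; rewrite diff1E.
  rewrite (pbracketC g (sXf _ sf) sh) opprK.
  have sp F H : smooth_fun F -> smooth_fun H ->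
    smooth_fun (pb F H) by exact: (smooth_pbracket am cC).
  rewrite (der_local Ga (tangent_derivation _) (sp _ _ sf sh) (sp _ _ sf' sh')
    (pbracket_near C am sf sf' sh sh' nf nh)).
  rewrite (nbhs_singleton (pbracket_near C am sh sh' (sXf _ sf) (sXf _ sf') nh (nX _ _ sf sf' nf))).
  by rewrite (nbhs_singleton (pbracket_near C am sf sf' (sXf _ sh) (sXf _ sh') nf (nX _ _ sh sh'
    nh))).
have siu : smooth_sec (fun x => iota x (u x)) by exact/(smooth_iota mp).
(* The zero covector field is written as the differential of 0 so that [courant3_exact] applies. *)
pose t : section (TTstar (arr G)) := fun y => (right_vf u y, diff1 (fun=> 0) y).
have st : smooth_sec t by split=> //; apply: smooth_cov_diff1; exact: smooth_cst.
have d0 y : diff1 (fun _ : arr G => 0) y = 0.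
  by apply: dual_ext => v; rewrite diff1E (der_cst (tangent_derivation v)).
pose s : section P := pullback_sec B' t (fun x => iota x (u x)) (fun=> 0).
have ss : smooth_sec s := smooth_pullback_sec B' st siu (smooth_E0 am).
have rs g' : Rel g' (s (anchor_graph g')).
  by rewrite /s /pullback_sec /t /= d0; exact: (rel_right am).
have rlift F k : fibre_section (B' := B') C k -> (forall g, k (anchor_graph g) =
    (0, (rightC iota C (diff1 F g) (tgt g), leftC iota C (diff1 F g) (src g)))) ->
    forall g, Rel g (hs F k (anchor_graph g)).
  by move=> fk ek g'; exact: (rel_sharp_lift am cC g' (conj fk ek)).
have p1 := point_fibreP am cC (diff1 f' g).
have p2 := point_fibreP am cC (diff1 h' g).
have sm := smooth_sharp_section am cC.
have := rel_courant3 am ss (sm _ _ sf' f1) rs (rlift _ _ f1 e1) (rlift _ _ f2 e2 g).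
rewrite (courant3_tensor23 PC ss (sm _ _ sf' f1) (sm _ _ sh' f2) (sm _ _ sf' p1) (sm _ _ sh' p2)
  (sharp_section_iso am cC _ _ f1 p2) (sharp_section_iso am cC _ _ p1 p2)); first last.
- by rewrite /sharp_section e2.
- by rewrite /sharp_section e1.
have sr := smooth_rightC am cC; have sl := smooth_leftC am cC.
rewrite !sharp_point (courant3_pullback_sec am _ _ _ _ st (smooth_tau am cC sf') siu (sr _ _)
  (smooth_E0 am) (sl _ _)).
rewrite [X in _ + X](_ : _ = 0) ?addr0; last first.
  by rewrite /courant3 (bracket0l EC)// (pairing0l EC).
have sP F : smooth_fun F -> smooth_vf (fun g => sharp iota Rel C (diff1 F g)).
  by move=> sF; apply: (smooth_sharp am cC); exact: smooth_cov_diff1.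
rewrite (courant3_exact Ga _ _ sX (sP _ sf') (smooth_cst 0) sf' sh').
rewrite /right_bivector (nbhs_singleton (diff1_near am sf sf' nf)) (nbhs_singleton (diff1_near
  am sh sh' nh)).
rewrite (dstar_secE lG mp cC (c1 := rightC iota C (diff1 f' g)) (c2 := rightC iota C (diff1 h' g)));
  try exact: sr; try exact: (rightC_in am cC); first last.
- by move=> w; rewrite (rightCE am cC) (right_pullE lG).
- by move=> w; rewrite (rightCE am cC) (right_pullE lG).
- exact: su.
by rewrite opprK => /eqP; rewrite subr_eq0 => /eqP <-; rewrite /pbracket; ring.
Qed.

(** By skew-symmetry the left side is minus the derivative of t^* f along pi^# be. Tangency of R to
    the graph turns this derivative into the anchor of [rightC be] applied to f, that is <rightC be,
    d_* f>. *)
Lemma tgt_bivector f (g : arr G) (be : cotangent g) : smooth_fun f ->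
  pi (diff1 (fun y => f (tgt y)) g) be = - (be (right_vf (dstar_fun iota C f) g) : R).
Proof.
move=> sf; rewrite /sharp_bivector (sharp_skew am cC) diff1E; congr (- _).
have := am_anchor am (sharpP am cC be) (smooth_fst Oa Oa sf) => /= <-.
rewrite (anchor_const EC (leftC iota C be (src g)) (a := f (tgt g)))// addr0.
rewrite -(dstar_funP lG mp cC sf (rightC_in am cC be (tgt g))).
exact: (rightCE am cC).
Qed.

Lemma sharp_integrates : integrates pi (dstar_fun iota C) (dstar_sec iota C).
Proof.
split=> [u su f h sf sh g|f sf g be]; first exact: right_action_bivector.
exact: tgt_bivector.
Qed.

End QuasiPoisson.

(** Lets [[e1, e2]] be computed against a test section e3: after rotation e3 is the first argument,
    where [pullback_courant3] applies. *)
Lemma courant3_rotate (R : realType) (M : @premanifold R) (E : precourant M) (e1 e2 e3 : section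
  E) x :
  courant_algebroid E -> smooth_sec e1 -> smooth_sec e2 -> smooth_sec e3 ->
  courant3 e1 e2 e3 x = anchor (e1 x) (fun y => pairing (e2 y) (e3 y)) -
    anchor (e2 x) (fun y => pairing (e1 y) (e3 y)) + courant3 e3 e1 e2 x.
Proof.
move=> EC s1 s2 s3.
by rewrite (courant3_act EC x s1 s2 s3) -(courant3_sym EC x s1 s3 s2); ring.
Qed.

(** * Brackets of families and removal of the target component *)

Section Jacobi.
Context {R : realType}.
Variables (G : @pregroupoid R) (E : precourant (obj G))
  (iota : forall x : obj G, {linear algebroid G x -> E x})
  (B : bracket_of (prod_bundle E (opp_courant E)))
  (B' : bracket_of (prod_bundle (standard_courant (arr G)) (opp_courant (prod_courant B))))
  (Rel : anchor_relation G E)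
  (C : forall x : obj G, set (E x)).
Arguments Rel : clear implicits.
Arguments C : clear implicits.
Hypotheses (am : action_morphism iota B' Rel) (cC : isotropic_complement iota C).
Local Notation lG := (am_groupoid am).
Local Notation mp := (am_pair am).
Local Notation Ga := (arr_atlas lG).
Local Notation EC := (manin_courant mp).
Local Notation EV := (courant_bundle EC).
Local Notation P := (prod_courant B').
Local Notation PC := (am_product' am).1.
Implicit Types (g : arr G) (e h : section E) (t : section (TTstar (arr G))).


Local Notation hs := (sharp_section (B := B) (B' := B') iota Rel C).
Local Notation pb := (pbracket iota Rel C).
Local Notation YT := (courant3 (E := standard_courant (arr G))).
Local Notation YP := (courant3 (E := P)).
Local Notation tau := (tau iota Rel C).
Implicit Types (a c : arr G -> section E) (F : arr G -> R).

Definition family_section F a c : section P := hs F (fibre_pair B' a c).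
Local Notation S := family_section.

Lemma complement_family0 a c : complement_family B' C a c ->
  complement_family B' C (fun _ _ => 0) c.
Proof.
case=> _ sk _ sc Cac; split=> // g; first exact: (smooth_E0 am).
by move=> x; split; [exact: (complement0 cC) | case: (Cac g x)].
Qed.

Lemma family_fibre a c g : complement_family B' C a c ->
  fibre_section (B' := B') C (pullback_sec B' (fun=> (0, 0)) (a g) (c g)).
Proof.
case=> _ _ sa sc Cac; split=> [|//|q|q]; [|by case: (Cac g q.2.1)|by case: (Cac g q.2.2)].
exact: (smooth_pullback_sec B' (smooth_TT0 G) (sa g) (sc g)).
Qed.

Lemma family_point F a c g :
  hs F (pullback_sec B' (fun=> (0, 0)) (a g) (c g)) = pullback_sec B' (tau F) (a g) (c g).
Proof.
apply: functional_extensionality_dep => q; rewrite /sharp_section /pullback_sec.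
by congr ((_, _), (_, _)); rewrite /= ?addr0 ?add0r.
Qed.

Lemma family_sectionE F a c q : S F a c q = (tau F q.1, (a q.1 q.2.1, c q.1 q.2.2)).
Proof.
rewrite /family_section /sharp_section /pullback_sec /fibre_pair.
by congr ((_, _), (_, _)); rewrite /= ?addr0 ?add0r.
Qed.

Lemma smooth_family F a c : smooth_fun F -> complement_family B' C a c -> smooth_sec (S F a c).
Proof. by move=> sF fam; apply: (smooth_sharp_section am cC) => //; exact: fibre_pairP. Qed.

Lemma family_iso F1 a1 c1 F2 a2 c2 q : complement_family B' C a1 c1 ->
  complement_family B' C a2 c2 ->
  pairing (S F1 a1 c1 q) (S F2 a2 c2 q) = 0.
Proof. by move=> f1 f2; apply: (sharp_section_iso am cC); exact: fibre_pairP. Qed.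

(** The parameter of the families is frozen at [q.1]. The formula is for every q, since the Jacobi
    identity differentiates this function off the graph. *)
Lemma family_courant3 F1 a1 c1 F2 a2 c2 F3 a3 c3 q :
  smooth_fun F1 -> smooth_fun F2 -> smooth_fun F3 ->
  complement_family B' C a1 c1 -> complement_family B' C a2 c2 -> complement_family B' C a3 c3 ->
  YP (S F1 a1 c1) (S F2 a2 c2) (S F3 a3 c3) q = YT (tau F1) (tau F2) (tau F3) q.1 -
    courant3 (a1 q.1) (a2 q.1) (a3 q.1) q.2.1 + courant3 (c1 q.1) (c2 q.1) (c3 q.1) q.2.2.
Proof.
move=> s1 s2 s3 f1 f2 f3.
rewrite /family_section (courant3_sharp am cC s1 s2 s3 (fibre_pairP f1) (fibre_pairP f2)
  (fibre_pairP f3)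
  (family_fibre q.1 f1) (family_fibre q.1 f2) (family_fibre q.1 f3))//.
have [_ _ sa1 sc1 _] := f1; have [_ _ sa2 sc2 _] := f2.
by rewrite !family_point (courant3_pullback_sec am _ _ _ _ (smooth_tau am cC s1) (smooth_tau am
  cC s2)
  (sa1 _) (sa2 _) (sc1 _) (sc2 _)).
Qed.

Lemma pullback_courant3 t e h F1 a1 c1 F2 a2 c2 q :
  smooth_sec t -> smooth_sec e -> smooth_sec h -> smooth_fun F1 -> smooth_fun F2 ->
  complement_family B' C a1 c1 -> complement_family B' C a2 c2 ->
  YP (pullback_sec B' t e h) (S F1 a1 c1) (S F2 a2 c2) q = YT t (tau F1) (tau F2) q.1 -
    courant3 e (a1 q.1) (a2 q.1) q.2.1 + courant3 h (c1 q.1) (c2 q.1) q.2.2.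
Proof.
move=> st se sh s1 s2 f1 f2.
have [_ _ sa1 sc1 _] := f1; have [_ _ sa2 sc2 _] := f2.
have sm := smooth_sharp_section am cC.
have p1 := family_fibre q.1 f1; have p2 := family_fibre q.1 f2.
rewrite (courant3_tensor23 PC (smooth_pullback_sec B' st se sh) (smooth_family s1 f1)
  (smooth_family s2 f2) (sm _ _ s1 p1) (sm _ _ s2 p2)
  (sharp_section_iso am cC _ _ (fibre_pairP f1) p2) (sharp_section_iso am cC _ _ p1 p2))//.
by rewrite !family_point (courant3_pullback_sec am _ _ _ _ st (smooth_tau am cC s1) se (sa1 _)
  sh (sc1 _)).
Qed.

Lemma smooth_sharp_diff1 F : smooth_fun F -> smooth_vf (fun g => sharp iota Rel C (diff1 F g)).
Proof. by move=> sF; apply: (smooth_sharp am cC); exact: smooth_cov_diff1. Qed.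

Lemma courant3_vf (X : vfield (arr G)) F1 F2 g : smooth_vf X -> smooth_fun F1 -> smooth_fun F2 ->
  YT (fun y => (X y, 0)) (tau F1) (tau F2) g =
  sharp iota Rel C (diff1 F2 g) (fun y => X y F1) + X g (pb F1 F2) -
  sharp iota Rel C (diff1 F1 g) (fun y => X y F2).
Proof.
move=> sX s1 s2.
have -> : (fun y => (X y, 0)) = (fun y => (X y, diff1 (fun=> 0) y)) :> section (TTstar (arr G)).
  apply: functional_extensionality_dep => y; congr pair; apply: dual_ext => v.
  by rewrite diff1E (der_cst (tangent_derivation v)).
exact: (courant3_exact Ga _ _ sX (smooth_sharp_diff1 s1) (smooth_cst 0) s1 s2).
Qed.

Lemma courant3_TT0 F1 F2 g : smooth_fun F1 -> smooth_fun F2 ->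
  YT (fun=> (0, 0)) (tau F1) (tau F2) g = 0.
Proof.
move=> s1 s2; rewrite (courant3_vf g (smooth_vf0 (M := arr G)) s1 s2) tangent0E.
have z (F : arr G -> R) : (fun y => (0 : tangent y) F) = fun=> 0 by [].
by rewrite !z !(der_cst (tangent_derivation _)) subr0 addr0.
Qed.

Lemma family_anchor F a c q (f : prodman (arr G) (prodman (obj G) (obj G)) -> R) :
  anchor (S F a c q) f = sharp iota Rel C (diff1 F q.1) (fun g => f (g, q.2)) +
    (anchor (a q.1 q.2.1) (fun x => f (q.1, (x, q.2.2))) +
     anchor (c q.1 q.2.2) (fun y => f (q.1, (q.2.1, y)))).
Proof. by rewrite family_sectionE. Qed.

Lemma P_pairingE q (u v : P q) :
  pairing u v = (u.1.2 v.1.1 : R) + v.1.2 u.1.1 - pairing u.2.1 v.2.1 + @pairing _ _ E _ u.2.2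
    v.2.2.
Proof.
by case: u => [[X al] [e h]]; case: v => [[X' al'] [e' h']]; rewrite /= opprD opprK addrA.
Qed.

Section Pair.
Variables (F1 F2 : arr G -> R) (a1 c1 a2 c2 : arr G -> section E).
Hypotheses (s1 : smooth_fun F1) (s2 : smooth_fun F2)
  (f1 : complement_family B' C a1 c1) (f2 : complement_family B' C a2 c2).
Implicit Types q : prodman (arr G) (prodman (obj G) (obj G)).
Let S1 := S F1 a1 c1.
Let S2 := S F2 a2 c2.

(** Rotation moves the test section e to the front; orthogonality of e to both families makes the
    anchor terms vanish. *)
Lemma bracket_tgt e q : smooth_sec e ->
  (forall g x, pairing (a1 g x) (e x) = 0) -> (forall g x, pairing (a2 g x) (e x) = 0) ->
  pairing (bracket S1 S2 q).2.1 (e q.2.1) = courant3 e (a1 q.1) (a2 q.1) q.2.1.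
Proof.
move=> se e1 e2; pose s := pullback_sec B' (fun=> (0, 0)) e (fun=> 0).
have ss : smooth_sec s := smooth_pullback_sec B' (smooth_TT0 G) se (smooth_E0 am).
have := courant3_rotate q PC (smooth_family s1 f1) (smooth_family s2 f2) ss.
have z F a c : (forall g x, pairing (a g x) (e x) = 0) -> forall p, pairing (S F a c p) (s p) = 0.
  move=> h p; rewrite P_pairingE family_sectionE /s /pullback_sec /= h (pairing0r EC).
  by rewrite (linear_form0 (dual_linear _)) !addr0 subr0.
rewrite (anchor_const PC _ (z _ _ _ e2)) (anchor_const PC _ (z _ _ _ e1)).
rewrite (pullback_courant3 q (smooth_TT0 G) se (smooth_E0 am) s1 s2 f1 f2) (courant3_TT0 _ s1 s2).
have [_ _ _ sc1 _] := f1.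
rewrite {1 3}/courant3 (bracket0l EC)// (pairing0l EC) P_pairingE /s /pullback_sec /=.
rewrite (linear_form0 (dual_linear _)) (pairing0r EC) !addr0 !add0r ?subr0 ?sub0r.
by rewrite oppr0 add0r => /oppr_inj.
Qed.

(** For a test section without target component nothing on the right involves a1 or a2;
    [bracket_drop] rests on this. *)
Lemma bracket_src t h (s : section P) q : smooth_sec t -> smooth_sec h ->
  s = pullback_sec B' t (fun=> 0) h ->
  pairing (bracket S1 S2 q) (s q) =
  sharp iota Rel C (diff1 F1 q.1) (fun g => pairing (S2 (g, q.2)) (s (g, q.2))) -
  sharp iota Rel C (diff1 F2 q.1) (fun g => pairing (S1 (g, q.2)) (s (g, q.2))) +
  anchor (c1 q.1 q.2.2) (fun y => pairing (S2 (q.1, (q.2.1, y))) (s (q.1, (q.2.1, y)))) -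
  anchor (c2 q.1 q.2.2) (fun y => pairing (S1 (q.1, (q.2.1, y))) (s (q.1, (q.2.1, y)))) +
  YT t (tau F1) (tau F2) q.1 + courant3 h (c1 q.1) (c2 q.1) q.2.2.
Proof.
move=> st sh sE; have ss : smooth_sec s by rewrite sE;
  exact: (smooth_pullback_sec B' st (smooth_E0 am) sh).
have := courant3_rotate q PC (smooth_family s1 f1) (smooth_family s2 f2) ss.
have pc := pullback_courant3 q st (smooth_E0 am) sh s1 s2 f1 f2.
rewrite -sE in pc; rewrite pc.
have [_ _ sa1 _ _] := f1.
rewrite [in X in _ = _ + X]/courant3 (bracket0l EC)// (pairing0l EC) subr0.
(* The pairing does not involve the target component, so it is constant in x. *)
have w F a c (e : E q.2.1) : anchor e (fun x => pairing (S F a c (q.1, (x, q.2.2))) (s (q.1, (x,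
  q.2.2)))) = 0.
  apply: (anchor_const EC e (a := pairing (S F a c q) (s q))) => x.
  by rewrite !P_pairingE !family_sectionE sE /pullback_sec /= !(pairing0r EC).
rewrite (family_anchor F1) (family_anchor F2) /S1 /S2 !w !add0r -/S1 -/S2 => e.
rewrite -[LHS]/(YP S1 S2 s q) e /courant3; lazy beta; ring.
Qed.

(** Tested on a vector field X of G: the pairings with S1 and S2 are X F1 and X F2, constant along
    M, and the remaining terms combine to X {F1, F2}. *)
Lemma bracket_cov q : (bracket S1 S2 q).1.2 = diff1 (pb F1 F2) q.1.
Proof.
apply: dual_ext => v; rewrite diff1E.
have [X sX XE] := extend_tangent Ga v.
pose s := pullback_sec B' (fun y => (X y, 0)) (fun=> 0) (fun=> 0).
have := bracket_src q (smooth_TT sX (smooth_cov0 (M := arr G))) (smooth_E0 am) (erefl s).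
have z F a c p : pairing (S F a c p) (s p) = X p.1 F.
  rewrite P_pairingE family_sectionE /s /pullback_sec /= !(pairing0r EC) subr0 !addr0.
  exact: diff1E.
rewrite (courant3_vf _ sX s1 s2).
rewrite (anchor_const EC (c1 q.1 q.2.2) (a := X q.1 F2)) => [|y]; last exact: z.
rewrite (anchor_const EC (c2 q.1 q.2.2) (a := X q.1 F1)) => [|y]; last exact: z.
rewrite (_ : (fun g => pairing (S2 (g, q.2)) (s (g, q.2))) = fun g => X g F2); last first.
  by apply/funext => g; exact: z.
rewrite (_ : (fun g => pairing (S1 (g, q.2)) (s (g, q.2))) = fun g => X g F1); last first.
  by apply/funext => g; exact: z.
have [_ _ _ sc1 _] := f1.
rewrite P_pairingE {1}/courant3 (bracket0l EC)// (pairing0l EC) /s /pullback_sec /= !(pairing0r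
  EC) XE.
by rewrite subr0 !addr0 => ->; rewrite -XE; ring.
Qed.

End Pair.

(* The component over the target only differentiates functions that do not depend
   on the target. *)
Lemma bracket_drop F1 F2 a1 c1 a2 c2 q : smooth_fun F1 -> smooth_fun F2 ->
  complement_family B' C a1 c1 -> complement_family B' C a2 c2 ->
  (bracket (S F1 a1 c1) (S F2 a2 c2) q).1 =
    (bracket (S F1 (fun _ _ => 0) c1) (S F2 (fun _ _ => 0) c2) q).1 /\
  (bracket (S F1 a1 c1) (S F2 a2 c2) q).2.2 =
    (bracket (S F1 (fun _ _ => 0) c1) (S F2 (fun _ _ => 0) c2) q).2.2.
Proof.
move=> s1 s2 f1 f2.
have eqs t h : smooth_sec t -> smooth_sec h ->
    pairing (bracket (S F1 a1 c1) (S F2 a2 c2) q) (pullback_sec B' t (fun=> 0) h q) =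
    pairing (bracket (S F1 (fun _ _ => 0) c1) (S F2 (fun _ _ => 0) c2) q) (pullback_sec B' t
      (fun=> 0) h q).
  move=> st sh; set s := pullback_sec B' t (fun=> 0) h.
  rewrite (bracket_src s1 s2 f1 f2 q st sh (erefl s)).
  rewrite (bracket_src s1 s2 (complement_family0 f1) (complement_family0 f2) q st sh (erefl s)).
  have d F a c p : pairing (S F a c p) (s p) = pairing (S F (fun _ _ => 0) c p) (s p).
    by rewrite !P_pairingE !family_sectionE /s /pullback_sec /= !(pairing0r EC).
  have dG F a c : (fun g => pairing (S F a c (g, q.2)) (s (g, q.2))) =
      (fun g => pairing (S F (fun _ _ => 0) c (g, q.2)) (s (g, q.2))).
    by apply/funext => g; exact: d.
  have dO F a c : (fun y => pairing (S F a c (q.1, (q.2.1, y))) (s (q.1, (q.2.1, y)))) =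
      (fun y => pairing (S F (fun _ _ => 0) c (q.1, (q.2.1, y))) (s (q.1, (q.2.1, y)))).
    by apply/funext => y; exact: d.
  by rewrite (dG F1 a1) (dG F2 a2) (dO F1 a1) (dO F2 a2).
move: eqs; case: (bracket _ _ q) => [[X al] [e h]]; case: (bracket _ _ q) => [[X' al'] [e' h']] eqs.
split=> /=; last first.
  apply/eqP; rewrite -subr_eq0; apply/eqP; apply: (pairing_nondeg EC) => v.
  have [k sk <-] := extend_vector EV v.
  have := eqs (fun=> (0, 0)) k (smooth_TT0 G) sk.
  rewrite !P_pairingE /pullback_sec /= !(pairing0r EC) !(linear_form0 (dual_linear _)).
  by rewrite !addr0 !subr0 !add0r (pairingBl EC) => ->; rewrite subrr.
congr (_, _).
  apply: tangent_ext => f sf.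
  have := eqs (fun y => (0, diff1 f y)) (fun=> 0) (smooth_TT (smooth_vf0 (M := arr G))
    (smooth_cov_diff1 sf)) (smooth_E0 am).
  by rewrite !P_pairingE /pullback_sec /= !(pairing0r EC) !(linear_form0 (dual_linear _)) !addr0
    !subr0 !add0r !diff1E.
apply: dual_ext => v; have [Y sY <-] := extend_tangent Ga v.
have := eqs (fun y => (Y y, 0)) (fun=> 0) (smooth_TT sY (smooth_cov0 (M := arr G))) (smooth_E0 am).
by rewrite !P_pairingE /pullback_sec /= !(pairing0r EC) !addr0 !subr0.
Qed.

End Jacobi.

(** * The Jacobi identity for four truncated sections *)

Section Lifted.
Context {R : realType}.
Variables (G : @pregroupoid R) (E : precourant (obj G))
  (iota : forall x : obj G, {linear algebroid G x -> E x})
  (B : bracket_of (prod_bundle E (opp_courant E)))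
  (B' : bracket_of (prod_bundle (standard_courant (arr G)) (opp_courant (prod_courant B))))
  (Rel : anchor_relation G E)
  (C : forall x : obj G, set (E x)).
Arguments Rel : clear implicits.
Arguments C : clear implicits.
Hypotheses (am : action_morphism iota B' Rel) (cC : isotropic_complement iota C).
Local Notation lG := (am_groupoid am).
Local Notation mp := (am_pair am).
Local Notation Ga := (arr_atlas lG).
Local Notation Oa := (obj_atlas lG).
Local Notation OOa := (prod_smooth_atlas Oa Oa).
Local Notation Pa := (prod_smooth_atlas Ga OOa).
Local Notation EC := (manin_courant mp).
Local Notation EV := (courant_bundle EC).
Local Notation P := (prod_courant B').
Local Notation PC := (am_product' am).1.
Implicit Types (g : arr G) (e h : section E) (t : section (TTstar (arr G))).


Local Notation chi := (triple_chi iota C).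
Local Notation rp := right_pull.
Local Notation pb := (pbracket iota Rel C).
Local Notation YP := (courant3 (E := P)).

Definition right_chi (F1 F2 F3 : arr G -> R) (g : arr G) : R :=
  chi (rp (diff1 F1 g)) (rp (diff1 F2 g)) (rp (diff1 F3 g)).

Section Four.
Variables (F : 'I_4 -> arr G -> R) (a c : 'I_4 -> arr G -> section E).
Hypotheses (sF : forall i, smooth_fun (F i)) (fam : forall i, complement_family B' C (a i) (c i))
  (lift : forall i g, a i g (tgt g) = rightC iota C (diff1 (F i) g) (tgt g) /\
     c i g (src g) = leftC iota C (diff1 (F i) g) (src g)).
Implicit Types (i j k l : 'I_4).
Local Notation S i := (family_section iota B' Rel C (F i) (a i) (c i)).
Local Notation S0 i := (family_section iota B' Rel C (F i) (fun _ _ => 0) (c i)).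

Let fam0 i := complement_family0 am cC (fam i).

Lemma rel_family i g : Rel g (S i (anchor_graph g)).
Proof.
by rewrite family_sectionE (lift i g).1 (lift i g).2; exact: (sharpP am cC).
Qed.

Lemma rel_family_bracket i j g : Rel g (bracket (S i) (S j) (anchor_graph g)).
Proof.
apply: (am_bracket am); try exact: (smooth_family am cC (sF _) (fam _));
  by move=> g'; exact: rel_family.
Qed.

Lemma right_family i g u : pairing (a i g (tgt g)) (iota (tgt g) u) = rp (diff1 (F i) g) u.
Proof. by rewrite (lift i g).1 (rightCE am cC) (right_pullE lG). Qed.

(** For the full sections of R the form vanishes on the graph; truncation removes exactly its target
    term, which is -chi^r. *)
Lemma family_courant3_chi i j k g : YP (S0 i) (S0 j) (S0 k) (anchor_graph g) =
  right_chi (F i) (F j) (F k) g.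
Proof.
rewrite (family_courant3 am cC _ (sF i) (sF j) (sF k) (fam0 i) (fam0 j) (fam0 k)).
rewrite [X in _ - X](_ : _ = 0) ?subr0; last by rewrite /courant3 (pairing0r EC).
have r x : forall g, Rel g (S x (anchor_graph g)) := rel_family x.
have := rel_courant3 am (smooth_family am cC (sF i) (fam i)) (smooth_family am cC (sF j) (fam j))
  (r i) (r j) (r k g).
rewrite (family_courant3 am cC _ (sF i) (sF j) (sF k) (fam i) (fam j) (fam k)) /=.
have [_ _ sa1 _ C1] := fam i; have [_ _ sa2 _ C2] := fam j; have [_ _ sa3 _ C3] := fam k.
rewrite -(triple_chiE lG mp cC (sa1 g) (sa2 g) (sa3 g) (fun y => (C1 g y).1) (fun y => (C2 g y).1)
  (fun y => (C3 g y).1) (@right_family i g) (@right_family j g) (@right_family k g)) => h.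
by apply/eqP; rewrite -subr_eq0; apply/eqP; rewrite -[RHS]h /right_chi; ring.
Qed.

Lemma smooth_family_courant3 i j k : smooth_fun (YP (S0 i) (S0 j) (S0 k)).
Proof.
apply: (smooth_pairing PC); last exact: (smooth_family am cC (sF _) (fam0 _)).
by apply: (smooth_bracket PC); exact: (smooth_family am cC (sF _) (fam0 _)).
Qed.

Lemma smooth_right_chi_family i j k : smooth_fun (right_chi (F i) (F j) (F k)).
Proof.
have := smooth_pullback Ga Pa (smooth_map_anchor_graph am) (smooth_family_courant3 i j k).
rewrite (_ : (fun q => _) = right_chi (F i) (F j) (F k))//.
by apply/funext => g; exact: family_courant3_chi.
Qed.

(* The form is constant along the target factor since s'' has no component there. *)
Lemma family_courant3_tgt i j k g x x' y :
  YP (S0 i) (S0 j) (S0 k) (g, (x, y)) = YP (S0 i) (S0 j) (S0 k) (g, (x', y)).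
Proof.
rewrite !(family_courant3 am cC _ (sF i) (sF j) (sF k) (fam0 i) (fam0 j) (fam0 k)) /=.
by congr (_ - _ + _); rewrite /courant3 !(pairing0r EC).
Qed.

(** The function differentiated is constant along the target, so the truncated section acts on it
    like the full one, whose anchor is tangent to the graph; [graph_rule] then gives the derivative
    of the restriction along pi^#. *)
Lemma family_act i j k l g : anchor (S0 i (anchor_graph g)) (YP (S0 j) (S0 k) (S0 l)) =
  sharp iota Rel C (diff1 (F i) g) (right_chi (F j) (F k) (F l)).
Proof.
set f := YP _ _ _; have sf : smooth_fun f := smooth_family_courant3 j k l.
have fx x x' y g' : f (g', (x, y)) = f (g', (x', y)) by exact: family_courant3_tgt.
have anc0 (e : E (tgt g)) : anchor e (fun x => f (g, (x, src g))) = 0.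
  by apply: (anchor_const EC e (a := f (g, (tgt g, src g)))) => x.
have -> : right_chi (F j) (F k) (F l) = fun y => f (anchor_graph y).
  by apply/funext => y; rewrite -family_courant3_chi.
have sm : smooth_map (fun g : arr G => (tgt g, src g) : prodman (obj G) (obj G)).
  exact: (smooth_map_pair (smooth_map_tgt lG) (smooth_map_src lG)).
rewrite [RHS](graph_rule Ga OOa _ sm sf) family_anchor /= anc0 add0r; congr (_ + _).
have := rel_family i g; rewrite family_sectionE => r.
by rewrite -(am_anchor am r (smooth_slice2 Ga OOa g sf)) /= anc0 add0r.
Qed.

Lemma family_bracket_rightC i j g (be : cotangent g) :
  pairing (bracket (S i) (S j) (anchor_graph g)).2.1 (rightC iota C be (tgt g)) =
  chi (rp (diff1 (F i) g)) (rp (diff1 (F j) g)) (rp be).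
Proof.
have [_ _ sai _ Ci] := fam i; have [_ _ saj _ Cj] := fam j.
have sr := smooth_rightC am cC be; have Cr := rightC_in am cC be.
rewrite (bracket_tgt am cC (sF i) (sF j) (fam i) (fam j) (anchor_graph g) sr); first last.
- by move=> y x; apply: (complement_isotropic cC) => //; exact: (Cj y x).1.
- by move=> y x; apply: (complement_isotropic cC) => //; exact: (Ci y x).1.
rewrite -(triple_chiE lG mp cC (a1 := rp be) sr (sai g) (saj g) Cr (fun y => (Ci g y).1) (fun y
  => (Cj g y).1)
  _ (@right_family i g) (@right_family j g)).
  by rewrite (triple_chi_skew12 lG mp cC) (triple_chi_skew23 lG mp cC) opprK.
by move=> u; rewrite (rightCE am cC) (right_pullE lG).
Qed.

(** The bracket lies in R with covector part d{F_i, F_j}, and an element of R has its target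
    component fixed modulo A by its covector. *)
Lemma family_bracket_decomposition i j g : exists u,
  (bracket (S i) (S j) (anchor_graph g)).2.1 =
  iota (tgt g) u + rightC iota C (diff1 (pb (F i) (F j)) g) (tgt g).
Proof.
have [u [x [Cx e]]] := decomposition cC (bracket (S i) (S j) (anchor_graph g)).2.1.
exists u; rewrite [LHS]e; congr (_ + _); apply: (complement_ext mp cC) => //.
  exact: (rightC_in am cC).
move=> w; rewrite (rightCE am cC).
have := bracket_cov am cC (sF i) (sF j) (fam i) (fam j) (anchor_graph g).
have := rel_family_bracket i j g; move: e.
case: (bracket _ _ _) => [[X al] [b d]] /= -> r <-.
have := rel_pairing am r (rel_right am w).
rewrite (pairingDl EC) (iota_isotropic mp) (pairing0r EC) add0r /= !addr0 => /eqP.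
by rewrite subr_eq0 => /eqP.
Qed.

(** The full brackets lie in the isotropic R, so the pairing of the truncated ones equals the
    pairing of the target components of the full ones. In the splitting A + C only the two mixed
    terms survive, and these are values of chi. *)
Lemma family_bracket_pairing i j k l g :
  pairing (bracket (S0 i) (S0 j) (anchor_graph g)) (bracket (S0 k) (S0 l) (anchor_graph g)) =
  right_chi (F i) (F j) (pb (F k) (F l)) g + right_chi (F k) (F l) (pb (F i) (F j)) g.
Proof.
have t0 i' j' : (bracket (S0 i') (S0 j') (anchor_graph g)).2.1 = 0.
  apply: (pairing_nondeg EC) => v; have [e se <-] := extend_vector EV v.
  rewrite (bracket_tgt am cC (sF _) (sF _) (fam0 _) (fam0 _) (anchor_graph g) se).
  - by rewrite /courant3 (pairing0r EC).
  - by move=> *; exact: (pairing0l EC).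
  - by move=> *; exact: (pairing0l EC).
have [d1 d2] := bracket_drop am cC (anchor_graph g) (sF i) (sF j) (fam i) (fam j).
have [d3 d4] := bracket_drop am cC (anchor_graph g) (sF k) (sF l) (fam k) (fam l).
have := family_bracket_rightC i j (diff1 (pb (F k) (F l)) g).
have := family_bracket_rightC k l (diff1 (pb (F i) (F j)) g).
have [u ue] := family_bracket_decomposition i j g;
  have [v ve] := family_bracket_decomposition k l g.
have r0 : pairing (bracket (S i) (S j) (anchor_graph g)) (bracket (S k) (S l) (anchor_graph g)) = 0.
  have := rel_family_bracket i j g; have := rel_family_bracket k l g.
  case: (bracket (S i) (S j) _) => [[X al] [b d]];
    case: (bracket (S k) (S l) _) => [[X' al'] [b' d']].
  by move=> r r'; have := rel_pairing am r' r; rewrite prod_pairingE.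
rewrite P_pairingE -d1 -d2 -d3 -d4 !t0 (pairing0r EC) subr0.
move: r0; rewrite P_pairingE ue ve !(pairingDl EC) !(pairingDr EC) !(iota_isotropic mp).
rewrite !(complement_isotropic cC (rightC_in am cC _ _) (rightC_in am cC _ _)) !add0r !addr0 =>
  r0 h1 h2.
rewrite /right_chi -h1 -h2 (pairingC EC (iota _ v)).
by apply/eqP; rewrite -subr_eq0; apply/eqP; rewrite -[RHS]r0; ring.
Qed.

Lemma family_identity i j k l g :
  pb (F i) (right_chi (F j) (F k) (F l)) g - pb (F j) (right_chi (F i) (F k) (F l)) g +
  pb (F k) (right_chi (F i) (F j) (F l)) g - pb (F l) (right_chi (F i) (F j) (F k)) g -
  (right_chi (F j) (F k) (pb (F i) (F l)) g + right_chi (F i) (F l) (pb (F j) (F k)) g) +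
  (right_chi (F i) (F k) (pb (F j) (F l)) g + right_chi (F j) (F l) (pb (F i) (F k)) g) -
  (right_chi (F i) (F j) (pb (F k) (F l)) g + right_chi (F k) (F l) (pb (F i) (F j)) g) = 0.
Proof.
have := courant3_isotropic_jacobi PC (e := fun i => S0 i) (anchor_graph g) i j k l
  (fun i => smooth_family am cC (sF i) (fam0 i)) (fun i j q => family_iso am cC _ _ q (fam0 i)
    (fam0 j)).
by rewrite !family_act !family_bracket_pairing.
Qed.

End Four.

End Lifted.

(** * The Schouten bracket of pi and chi^r *)

Section ChiInvariance.
Context {R : realType}.
Variables (G : @pregroupoid R) (E : precourant (obj G))
  (iota : forall x : obj G, {linear algebroid G x -> E x})
  (B : bracket_of (prod_bundle E (opp_courant E)))
  (B' : bracket_of (prod_bundle (standard_courant (arr G)) (opp_courant (prod_courant B))))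
  (Rel : anchor_relation G E)
  (C : forall x : obj G, set (E x)).
Arguments Rel : clear implicits.
Arguments C : clear implicits.
Hypotheses (am : action_morphism iota B' Rel) (cC : isotropic_complement iota C).
Local Notation lG := (am_groupoid am).
Local Notation mp := (am_pair am).
Local Notation Ga := (arr_atlas lG).
Implicit Types (g : arr G) (e h : section E) (t : section (TTstar (arr G))).


Local Notation chi := (triple_chi iota C).
Local Notation pb := (pbracket iota Rel C).
Local Notation pi := (sharp_bivector iota Rel C).
Local Notation Tchi := (right_chi iota C).

Lemma right_chi_near F1 F2 F3 H1 H2 H3 g : smooth_fun F1 -> smooth_fun F2 -> smooth_fun F3 ->
  smooth_fun H1 -> smooth_fun H2 -> smooth_fun H3 ->
  (\forall y \near g, F1 y = H1 y) -> (\forall y \near g, F2 y = H2 y) ->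
  (\forall y \near g, F3 y = H3 y) -> \forall y \near g, Tchi F1 F2 F3 y = Tchi H1 H2 H3 y.
Proof.
move=> s1 s2 s3 t1 t2 t3 e1 e2 e3.
apply: filterS3 (diff1_near am s1 t1 e1) (diff1_near am s2 t2 e2) (diff1_near am s3 t3 e3) => y.
by rewrite /right_chi => -> -> ->.
Qed.

Section Family.
Variable F : 'I_4 -> arr G -> R.
Hypothesis sF : forall i, smooth_fun (F i).
Implicit Types (i j k l : 'I_4).

Lemma family_lift g : exists2 F' : 'I_4 -> arr G -> R,
  (forall i, smooth_fun (F' i)) /\ (forall i, \forall y \near g, F i y = F' i y) &
  exists a c : 'I_4 -> arr G -> section E, (forall i, complement_family B' C (a i) (c i)) /\
  forall i y, a i y (tgt y) = rightC iota C (diff1 (F' i) y) (tgt y) /\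
     c i y (src y) = leftC iota C (diff1 (F' i) y) (src y).
Proof.
have [b [sb b1] lift] := sharp_family_lift am cC g.
exists (fun i y => b y * F i y); first split.
- by move=> i; exact: (smoothM Ga).
- by move=> i; apply: filterS b1 => y ->; rewrite mul1r.
have L i := lift _ (sF i).
exists (fun i => projT1 (cid (L i))), (fun i => projT1 (cid (projT2 (cid (L i))))).
by split=> i; case: (projT2 (cid (projT2 (cid (L i))))).
Qed.

Lemma smooth_right_chi i j k : smooth_fun (Tchi (F i) (F j) (F k)).
Proof.
apply: (smooth_fun_local Ga) => g; have [F' [sF' FE] [a [c [fam lift]]]] := family_lift g.
exists (Tchi (F' i) (F' j) (F' k)); last exact: right_chi_near.
exact: (smooth_right_chi_family am cC sF' fam lift).
Qed.

End Family.

Lemma right_chi_identity (F : 'I_4 -> arr G ->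
  R) (i j k l : 'I_4) g : (forall i, smooth_fun (F i)) ->
  pb (F i) (Tchi (F j) (F k) (F l)) g - pb (F j) (Tchi (F i) (F k) (F l)) g +
  pb (F k) (Tchi (F i) (F j) (F l)) g - pb (F l) (Tchi (F i) (F j) (F k)) g -
  (Tchi (F j) (F k) (pb (F i) (F l)) g + Tchi (F i) (F l) (pb (F j) (F k)) g) +
  (Tchi (F i) (F k) (pb (F j) (F l)) g + Tchi (F j) (F l) (pb (F i) (F k)) g) -
  (Tchi (F i) (F j) (pb (F k) (F l)) g + Tchi (F k) (F l) (pb (F i) (F j)) g) = 0.
Proof.
move=> sF; have [F' [sF' FE] [a [c [fam lift]]]] := family_lift sF g.
have p x y : \forall q \near g, pb (F x) (F y) q = pb (F' x) (F' y) q.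
  exact: (pbracket_near C am).
have sp H x y : (forall i, smooth_fun (H i)) -> smooth_fun (pb (H x) (H y)).
  by move=> sH; exact: (smooth_pbracket am cC).
have e1 x y z w : pb (F x) (Tchi (F y) (F z) (F w)) g = pb (F' x) (Tchi (F' y) (F' z) (F' w)) g.
  apply: (nbhs_singleton (pbracket_near C am (sF x) (sF' x) (smooth_right_chi sF y z w)
    (smooth_right_chi sF' y z w) (FE x) _)).
  exact: right_chi_near.
have e2 x y z w : Tchi (F x) (F y) (pb (F z) (F w)) g = Tchi (F' x) (F' y) (pb (F' z) (F' w)) g.
  have h := right_chi_near (sF x) (sF y) (sp _ F z w sF) (sF' x) (sF' y) (sp _ F' z w sF')
    (FE x) (FE y) (p z w).
  exact: (nbhs_singleton h).
by rewrite !e1 !e2; exact: (family_identity am cC sF' fam lift).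
Qed.

(** Let S1 and S2 be the alternating sums of {chi^r(F_i, F_j, F_k), F_l} and chi^r({F_i, F_j}, F_k,
    F_l). Alternating the four-function identity gives 4 S1 - 6 S2 = 0, and the Schouten bracket is
    S1/6 - S2/4. *)
Lemma schouten_right_chi (F : nat -> arr G -> R) g : (forall i, smooth_fun (F i)) ->
  schouten 1 2 (of_bivector pi) (of_trivector (right_trivector chi)) F g = 0.
Proof.
move=> sF; pose A1 (i j k l : 'I_4) := pb (Tchi (F i) (F j) (F k)) (F l) g.
pose A2 (i j k l : 'I_4) := Tchi (pb (F i) (F j)) (F k) (F l) g.
have c12 : schouten_comp 1 2 (of_bivector pi) (of_trivector (right_trivector chi)) F g =
  6^-1 * altsum4 A1.
  rewrite /schouten_comp /altsum4 (_ : (3`! * 1`!)%:R = 6 :> R) //; congr (_ * _).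
  by apply: eq_bigr => s _; congr (_ * _); rewrite of_bivectorE.
have c21 : schouten_comp 2 1 (of_trivector (right_trivector chi)) (of_bivector pi) F g =
  4^-1 * altsum4 A2.
  rewrite /schouten_comp /altsum4 (_ : (2`! * 2`!)%:R = 4 :> R) //; congr (_ * _).
  apply: eq_bigr => s _; congr (_ * _); rewrite /of_trivector /A2 /right_chi.
  rewrite (_ : pb (F (s (inord 0))) (F (s (inord 1))) =
    of_bivector pi (fun k => F (s (inord k))))//.
  by apply/funext => y; rewrite of_bivectorE.
have rot x (a b c : dual (algebroid G x)) : chi a b c = chi c a b.
  by rewrite (triple_chi_skew23 lG mp cC) (triple_chi_skew12 lG mp cC) opprK.
have T (i j k l : 'I_4) : Tchi (F i) (F j) (pb (F k) (F l)) g = A2 k l i j.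
  by rewrite /A2 /right_chi rot.
have sp (i j k : 'I_4) : smooth_fun (Tchi (F i) (F j) (F k)).
  exact: (smooth_right_chi (F := fun i : 'I_4 => F i)).
pose J i j k l := - A1 j k l i + (A1 i k l j + (- A1 i j l k + (A1 i j k l +
  - (A2 i l j k + (A2 j k i l + (- A2 j l i k + (- A2 i k j l + (A2 k l i j + A2 i j k l)))))))).
have : altsum4 J = 0.
  rewrite /altsum4 big1// => s _; set i := s _; set j := s _; set k := s _; set l := s _.
  have := right_chi_identity i j k l g (F := fun i : 'I_4 => F i) (fun i => sF i).
  rewrite !T (pbracketC am cC g (sF i) (sp j k l)) (pbracketC am cC g (sF j) (sp i k l)).
  rewrite (pbracketC am cC g (sF k) (sp i j l)) (pbracketC am cC g (sF l) (sp i j k)).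
  move=> h; rewrite (_ : J i j k l = 0) ?mulr0// -[RHS]h /J /A1; ring.
have S34 (a : 'I_4 -> 'I_4 -> 'I_4 -> 'I_4 -> R) : altsum4 (fun i j k l => a i j l k) =
  - altsum4 a := altsum4_swap34 a.
have iklj (a : 'I_4 -> 'I_4 -> 'I_4 -> 'I_4 -> R) : altsum4 (fun i j k l => a i k l j) = altsum4 a.
  by rewrite (altsum4_swap23 (fun i j k l => a i j l k)) S34 opprK.
have jkli (a : 'I_4 -> 'I_4 -> 'I_4 -> 'I_4 -> R) : altsum4 (fun i j k l => a j k l i) =
  - altsum4 a.
  by rewrite (altsum4_swap12 (fun i j k l => a i k l j)) iklj.
have iljk (a : 'I_4 -> 'I_4 -> 'I_4 -> 'I_4 -> R) : altsum4 (fun i j k l => a i l j k) = altsum4 a.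
  by rewrite (altsum4_swap34 (fun i j k l => a i k j l)) altsum4_swap23 opprK.
have jkil (a : 'I_4 -> 'I_4 -> 'I_4 -> 'I_4 -> R) : altsum4 (fun i j k l => a j k i l) = altsum4 a.
  by rewrite (altsum4_swap12 (fun i j k l => a i k j l)) altsum4_swap23 opprK.
have jlik (a : 'I_4 -> 'I_4 -> 'I_4 -> 'I_4 -> R) : altsum4 (fun i j k l => a j l i k) =
  - altsum4 a.
  by rewrite (altsum4_swap34 (fun i j k l => a j k i l)) jkil.
have klij (a : 'I_4 -> 'I_4 -> 'I_4 -> 'I_4 -> R) : altsum4 (fun i j k l => a k l i j) = altsum4 a.
  by rewrite (altsum4_swap23 (fun i j k l => a j l i k)) jlik opprK.
rewrite /J !(altsum4D, altsum4N).
rewrite (jkli A1) (iklj A1) (S34 A1) (iljk A2) (jkil A2) (jlik A2) (altsum4_swap23 A2) (klij A2)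
  => h.
rewrite /schouten c12 c21 /= sqrrN expr1n mul1r.
move: h; move: (altsum4 A1) (altsum4 A2) => S1 S2 h; lra.
Qed.

End ChiInvariance.

(** * Multiplicativity *)

Section Transport.
Context {R : realType}.
Variable M : @premanifold R.

(** Composability only gives an equation between [src g] and [tgt h], so elements of E have to be
    moved between the fibres over equal points. *)
Definition transport (V : prebundle M) (x y : M) (e : x =
  y) (v : V x) : V y := eq_rect x (fun z => V z : Type) v y e.

Lemma pair_mul_transport (V : prebundle M) (x y z x' y' z' : M) (ex : x = x') (ey : y = y')
    (ez : z = z') (e1 : V x) (e2 : V y) (e3 : V z) :
  @pair_mul R M V (x, y) (y', z) (x', z') (e1, e2) (transport ey e2, e3)
    (transport ex e1, transport ez e3).
Proof. by case: _ / ex; case: _ / ey; case: _ / ez; exact: PairMul. Qed.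

Lemma transport0 (V : prebundle M) (x y : M) (e : x = y) : transport e (0 : V x) = 0.
Proof. by case: _ / e. Qed.

Lemma transport_pairing (E : precourant M) (x y : M) (e : x = y) (u v : E x) :
  pairing (transport e u) (transport e v) = pairing u v.
Proof. by case: _ / e. Qed.

Lemma transport_anchor (E : precourant M) (x y : M) (e : x = y) (u : E x) f :
  anchor (transport e u) f = anchor u f.
Proof. by case: _ / e. Qed.

Lemma transport_in (V : prebundle M) (W : forall x, set (V x)) (x y : M) (e : x = y) (u : V x) :
  W x u -> W y (transport e u).
Proof. by case: _ / e. Qed.

Lemma transport_map (V W : prebundle M) (f : forall x, V x -> W x) (x y : M) (e : x = y) (u : V x) :
  f y (transport e u) = transport e (f x u).
Proof. by case: _ / e. Qed.

Lemma transport_surj (V : prebundle M) (x y : M) (e : x = y) (v : V y) : exists u, v =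
  transport e u.
Proof. by move: v; case: _ / e => v; exists v. Qed.

End Transport.

Section Multiplicative.
Context {R : realType}.
Variables (G : @pregroupoid R) (E : precourant (obj G))
  (iota : forall x : obj G, {linear algebroid G x -> E x})
  (B : bracket_of (prod_bundle E (opp_courant E)))
  (B' : bracket_of (prod_bundle (standard_courant (arr G)) (opp_courant (prod_courant B))))
  (Rel : anchor_relation G E)
  (C : forall x : obj G, set (E x)).
Arguments Rel : clear implicits.
Arguments C : clear implicits.
Hypotheses (am : action_morphism iota B' Rel) (cC : isotropic_complement iota C).
Local Notation lG := (am_groupoid am).
Local Notation mp := (am_pair am).
Local Notation Oa := (obj_atlas lG).
Local Notation EC := (manin_courant mp).


Local Notation pi := (sharp_bivector iota Rel C).

Lemma rel_mul (g h : arr G) (gh : src g = tgt h) (al : cotangent g) (be : cotangent h)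
    (ga : cotangent (Defs.mul g h)) (X : tangent g) (Y : tangent h) (Z : tangent (Defs.mul g h))
    (e1 : E (tgt g)) (e2 : E (src g)) (e3 : E (src h))
    (et : tgt g = tgt (Defs.mul g h)) (es : src h = src (Defs.mul g h)) :
  tangent_mul X Y Z -> cotangent_mul al be ga ->
  Rel g ((X, al), (e1, e2)) -> Rel h ((Y, be), (transport gh e2, e3)) ->
  Rel (Defs.mul g h) ((Z, ga), (transport et e1, transport es e3)).
Proof.
move=> tm cm r1 r2; have [mulC _] := am_closed am.
exact: (mulC g h (Defs.mul g h) (X, al) (Y, be) (Z, ga) (e1, e2) (transport gh e2, e3)
  (transport et e1, transport es e3) (conj tm cm) (pair_mul_transport et gh es e1 e2 e3) r1 r2).
Qed.

Lemma rel_src (g : arr G) X al e1 e2 (f : obj G -> R) : Rel g ((X, al), (e1, e2)) -> smooth_fun f ->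
  X (fun y => f (src y)) = anchor e2 f.
Proof.
move=> r sf; have := am_anchor am r (smooth_snd Oa Oa sf) => /= <-.
by rewrite (anchor_const EC e1 (a := f (src g)))// add0r.
Qed.

Lemma rel_tgt (g : arr G) X al e1 e2 (f : obj G -> R) : Rel g ((X, al), (e1, e2)) -> smooth_fun f ->
  X (fun y => f (tgt y)) = anchor e1 f.
Proof.
move=> r sf; have := am_anchor am r (smooth_fst Oa Oa sf) => /= <-.
by rewrite (anchor_const EC e2 (a := f (tgt g)))// addr0.
Qed.

(* (i(v)^l)_g . (v^r)_h is related to (0, 0), hence vanishes. *)
Lemma cotangent_mul_middle (g h : arr G) (gh : src g = tgt h) (al : cotangent g) (be : cotangent h)
    (ga : cotangent (Defs.mul g h)) (v : algebroid G (src g)) : cotangent_mul al be ga ->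
  (al (left_inv v) : R) + be (right_inv (transport gh v)) = 0.
Proof.
move=> [_ _ gaE]; have [_ _ [_ _ sm tm] _ _] := lG.
have l := rel_left am v; have r := rel_right am (transport gh v).
have [Z ZE] : exists Z : tangent (Defs.mul g h),
  tangent_mul (left_inv v) (right_inv (transport gh v)) Z.
  apply: (tangent_mul_exists lG) => // f sf.
  by rewrite (rel_src l sf) (rel_tgt r sf) (transport_map (fun x => iota x)) transport_anchor.
rewrite -(gaE _ _ _ ZE).
rewrite (transport_map (fun x => iota x)) in r.
have c0 : cotangent_mul (0 : cotangent g) (0 : cotangent h) (0 : cotangent (Defs.mul g h)).
  by split=> // *; rewrite /= addr0.
have := rel_mul (esym (tm g h gh)) (esym (sm g h gh)) ZE c0 l r.
rewrite !transport0 => /(rel_tangent am)[u [w [/esym uE /esym wE ->]]].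
have -> : u = 0 by apply: (iota_inj mp); rewrite uE linear0.
have -> : w = 0 by apply: (iota_inj mp); rewrite wE linear0.
by rewrite (right_inv0 lG) (left_inv0 lG) addr0 (linear_form0 (dual_linear ga)).
Qed.

(** The product of pi^# al and pi^# be is related to a pair in C x C with covector ga, so it is pi^#
    ga by uniqueness; pairing it with ga' gives the sum that multiplicativity asks for. *)
Lemma sharp_multiplicative : multiplicative_bivector pi.
Proof.
move=> g h k al al' be be' ga ga' cm cm'; have [gh kE _] := cm; subst k.
have [_ _ [_ _ sm tm] _ _] := lG.
(* By [cotangent_mul_middle] both elements of C have the same pairing with A, which makes the two
   elements of R composable. *)
have mid : rightC iota C be (tgt h) = transport gh (leftC iota C al (src g)).
  apply: (complement_ext mp cC); first exact: (rightC_in am cC).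
    by apply: (transport_in (W := C)); exact: (leftC_in am cC).
  move=> w; have [v ->] := transport_surj gh w.
  rewrite (rightCE am cC) (transport_map (fun x => iota x)) transport_pairing (leftCE am cC).
  by apply/eqP; rewrite -addr_eq0 addrC (cotangent_mul_middle gh v cm).
have r1 := sharpP am cC al; have r2 := sharpP am cC be.
rewrite mid in r2.
have [Z ZE] : exists Z : tangent (Defs.mul g h),
    tangent_mul (sharp iota Rel C al) (sharp iota Rel C be) Z.
  apply: (tangent_mul_exists lG) => // f sf.
  by rewrite (rel_src r1 sf) (rel_tgt r2 sf) transport_anchor.
have := rel_mul (esym (tm g h gh)) (esym (sm g h gh)) ZE cm r1 r2.
move=> /(sharp_unique am cC (transport_in (W := C) _ (rightC_in am cC _ _))
  (transport_in (W := C) _ (leftC_in am cC _ _))) ZE'.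
have [_ _ ga'E] := cm'.
by rewrite /sharp_bivector -ZE' (ga'E _ _ _ ZE) subrr.
Qed.

End Multiplicative.

Theorem proposition4p2 (R : realType) (G : @pregroupoid R)
  (E : precourant (obj G))
  (iota : forall x : obj G, {linear algebroid G x -> E x})
  (B : section (prod_bundle E (opp_courant E)) ->
       section (prod_bundle E (opp_courant E)) ->
       section (prod_bundle E (opp_courant E)))
  (Rel : courant_relation (TTstar (arr G)) (prod_bundle E E)
           (fun g : arr G => (tgt g, src g) : prodman (obj G) (obj G))) :
  lie_groupoid G ->
  algebroid_manin_pair iota ->
  product_bracket B ->
  multiplicative_manin_morphism
    (G := G) (H := pair_groupoid (obj G))
    (E := standard_courant (arr G)) (@tangent_part R (arr G)) (TTstar_groupoid G)
    (F := prod_courant B)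
    (fun p : prodman (obj G) (obj G) => range (iota p.1) `*` range (iota p.2))
    (pair_vb_groupoid E)
    Rel ->
  (forall (g : arr G) (u : algebroid G (tgt g)) (v : algebroid G (src g)),
     Rel g ((right_inv u + left_inv v, 0), (iota (tgt g) u, iota (src g) v))) ->
  forall C : (forall x : obj G, set (E x)),
    isotropic_complement iota C ->
    exists pi : bivector_field (arr G),
      [/\ is_bivector_field pi,
          graph_is_composition Rel C pi,
          quasi_poisson pi (triple_chi iota C) &
          integrates pi (dstar_fun iota C) (dstar_sec iota C)].
Proof.
move=> lG mp PB mor act C cC.
have [B' am] := action_morphism_intro lG mp PB mor act.
exists (sharp_bivector iota Rel C); split.
- exact: (smooth_sharp_bivector am cC).
- exact: (sharp_graph am cC).
- split=> //.
  + split; [exact: (smooth_sharp_bivector am cC) | exact: (sharp_multiplicative am cC)].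
  + exact: (triple_chi_wedge3 lG mp cC).
  + by move=> F sF g; exact: (half_schouten am cC).
  + by move=> F sF g; exact: (schouten_right_chi am cC).
- exact: (sharp_integrates am cC).
Qed.
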